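(* Let $\varphi\in\mathcal G_{>0}$, $\varphi(s)=c_0s+\sum_{k\ge1}c_kk^{-s}$, and assume that $\varphi$ is not an automorphism of $\mathbb C_0$. Let $\sigma(\mathcal C_\varphi)$ denote the spectrum of $\mathcal C_\varphi:f\mapsto f\circ\varphi$ acting on $\mathcal H^\infty_+$. (a) If $c_0\ge2$, then $\sigma(\mathcal C_\varphi)=\{0,1\}$. (b) If $c_0=1$, then $\sigma(\mathcal C_\varphi)=\{0\}\cup\{m^{-c_1}:m\in\mathbb N\}$.
   Context: $\mathbb N=\{1,2,\dots\}$; for $\theta\in\mathbb R$, $\mathbb C_\theta=\{s:\mathrm{Re}\,s>\theta\}$. $\mathcal G_{>0}$ is the set of maps $\varphi(s)=c_0s+\psi(s)$ where $c_0\ge1$ is an integer (the characteristic), $\psi$ is a Dirichlet series $\sum_{k\ge1}c_kk^{-s}$ converging uniformly in $\mathbb C_\varepsilon$ for every $\varepsilon>0$, and either $\psi\equiv i\tau$ for some $\tau\in\mathbb R$ or $\psi(\mathbb C_0)\subset\mathbb C_0$; such $\varphi$ is a self-map of $\mathbb C_0$. $\mathcal H^\infty_+$ is the Fr\'echet space of analytic functions on $\mathbb C_0$ that are bounded on $\mathbb C_\varepsilon$ for all $\varepsilon>0$ and can be represented as a convergent Dirichlet series in $\mathbb C_0$, with seminorms $P_\varepsilon(f)=\sup_{\mathbb C_\varepsilon}|f|$. The spectrum of a continuous operator $T$ on $\mathcal H^\infty_+$ is the set of $\lambda\in\mathbb C$ such that $T-\lambda I$ is not invertible. *)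

(* Defs.v *)
From Stdlib Require Import Reals.
From Coquelicot Require Import Coquelicot.

Open Scope R_scope.
Open Scope C_scope.

Definition half_plane (theta : R) (s : C) : Prop := (theta < Re s)%R.

Definition Cexp (z : C) : C :=
  ((exp (Re z) * cos (Im z))%R, (exp (Re z) * sin (Im z))%R).

(* [nat_Cpow k s] is k^s, for k >= 1. *)
Definition nat_Cpow (k : nat) (s : C) : C := Cexp (s * RtoC (ln (INR k))).

(* Dirichlet series run over k >= 1, so the coefficient [c 0] is never read. *)
Definition dirichlet_term (c : nat -> C) (s : C) (k : nat) : C :=
  c k * nat_Cpow k (- s).

Definition dirichlet_partial_sum (c : nat -> C) (n : nat) (s : C) : C :=
  sum_n_m (dirichlet_term c s) 1 n.

Definition dirichlet_cvu (c : nat -> C) (psi : C -> C) (theta : R) : Prop :=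
  forall eta : R, (0 < eta)%R ->
  exists N : nat, forall n : nat, (N <= n)%nat ->
  forall s : C, half_plane theta s ->
    (Cmod (dirichlet_partial_sum c n s - psi s) < eta)%R.

(* Functions on the right half-plane C_0 are represented by total functions
   [C -> C] whose values off C_0 are irrelevant; this is their equality. *)
Definition eq_C0 (f g : C -> C) : Prop :=
  forall s : C, half_plane 0 s -> f s = g s.

Definition analytic_C0 (f : C -> C) : Prop :=
  forall s : C, half_plane 0 s -> @ex_derive C_AbsRing C_NormedModule f s.

Definition maps_C0 (f : C -> C) : Prop :=
  forall s : C, half_plane 0 s -> half_plane 0 (f s).

Definition automorphism_C0 (phi : C -> C) : Prop :=
  analytic_C0 phi /\ maps_C0 phi /\
  exists g : C -> C,
    analytic_C0 g /\ maps_C0 g /\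
    forall s : C, half_plane 0 s -> g (phi s) = s /\ phi (g s) = s.

(* phi belongs to G_{>0}, with characteristic c0 and Dirichlet coefficients c. *)
Definition G_pos (c0 : nat) (c : nat -> C) (phi : C -> C) : Prop :=
  (1 <= c0)%nat /\
  let psi := fun s : C => phi s - RtoC (INR c0) * s in
  (forall eps : R, (0 < eps)%R -> dirichlet_cvu c psi eps) /\
  ((exists tau : R, forall s : C, half_plane 0 s -> psi s = Ci * RtoC tau) \/
   maps_C0 psi).

Definition Hinf_plus (f : C -> C) : Prop :=
  analytic_C0 f /\
  (forall eps : R, (0 < eps)%R ->
     exists M : R, forall s : C, half_plane eps s -> (Cmod (f s) <= M)%R) /\
  (exists a : nat -> C, forall s : C, half_plane 0 s ->
     filterlim (fun n => dirichlet_partial_sum a n s) eventually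
       (@locally C_NormedModule (f s))).

Definition Psemi (eps : R) (f : C -> C) : R :=
  real (Lub_Rbar (fun x : R => exists s : C, half_plane eps s /\ x = Cmod (f s))).

(* Operators on H^infty_+ are also represented by total maps, of which only
   the action on [Hinf_plus], modulo [eq_C0], matters. *)
Definition operator := (C -> C) -> (C -> C).

Definition linear_operator (T : operator) : Prop :=
  (forall f, Hinf_plus f -> Hinf_plus (T f)) /\
  (forall f g, Hinf_plus f -> Hinf_plus g -> eq_C0 f g -> eq_C0 (T f) (T g)) /\
  (forall f g, Hinf_plus f -> Hinf_plus g ->
     eq_C0 (T (fun s => f s + g s)) (fun s => T f s + T g s)) /\
  (forall (a : C) f, Hinf_plus f ->
     eq_C0 (T (fun s => a * f s)) (fun s => a * T f s)).

(* Continuity for the topology generated by the seminorms P_eps, eps > 0.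
   Since P_eps increases as eps decreases, the balls of single seminorms
   already form a base of neighbourhoods. *)
Definition continuous_operator (T : operator) : Prop :=
  linear_operator T /\
  forall f, Hinf_plus f ->
  forall eps eta : R, (0 < eps)%R -> (0 < eta)%R ->
  exists delta rho : R, (0 < delta)%R /\ (0 < rho)%R /\
  forall g, Hinf_plus g ->
    (Psemi delta (fun s => g s - f s)%C < rho)%R ->
    (Psemi eps (fun s => T g s - T f s)%C < eta)%R.

(* Invertibility in the algebra of continuous operators on H^infty_+. *)
Definition invertible_operator (T : operator) : Prop :=
  continuous_operator T /\
  exists S : operator,
    continuous_operator S /\
    forall f, Hinf_plus f -> eq_C0 (S (T f)) f /\ eq_C0 (T (S f)) f.

Definition spectrum (T : operator) (lambda : C) : Prop :=
  ~ invertible_operator (fun f s => T f s - lambda * f s).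

Definition composition_operator (phi : C -> C) : operator :=
  fun f s => f (phi s).

(* Main.v *)
Require Import Defs.
From Stdlib Require Import Reals ZArith Factorial Lra Lia Classical ClassicalEpsilon.
From Coquelicot Require Import Coquelicot.

(* Bohr's theorem identifies H^infty_+ with the functions that are uniform limits
   of Dirichlet polynomials on every C_eps; this class is stable under sums,
   products, exponentials, hence under composition with phi.  Both directions rest
   on one estimate: truncating a Dirichlet polynomial at N costs at most a factor
   C_delta N^delta in the sup norm on a vertical line.

   On the functions k^(-s), C_phi is triangular, with diagonal d_m = m^(-c_1) if
   c_0 = 1, and d_1 = 1, d_m = 0 (m >= 2) if c_0 >= 2.  If lambda is neither 0 nor
   any d_m, finitely many coefficients are removed by back substitution; for data
   vanishing to high order the Neumann series - sum lambda^(-k-1) g o phi^k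
   converges, because Re psi is bounded below on C_eps (Harnack), so that the
   orbits of phi escape to +infinity at least linearly.  If lambda = d_m with m
   minimal, m^(-s) is not in the range of C_phi - lambda.  If c_0 = 1 and C_phi had
   an inverse S, then u = S(2^(-s)) would satisfy P_eps(u^k) = P_eps(S(2^(-ks))) = O(1),
   so |u| <= 1 and its second coefficient has modulus <= 1; but that coefficient
   is 2^(c_1), and Re c_1 > 0. *)
Local Open Scope R_scope.

(** * Finite sums and the complex exponential *)

(** The Dirichlet series of f o phi is not at hand, and rearranging one would call for absolute
    convergence, which may fail near the imaginary axis. So no coefficient of a composite is
    computed: membership in H^infty_+ passes through uniform approximation, and triangularity is
    read off the limits of F(x) m^x as x tends to +infinity along the reals, which determine the
    coefficients one after the other. No integral is used either. Perron's formula and averages over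
    vertical lines become multipliers, that is, finite combinations of vertical translations; a
    sharp cutoff costs only a logarithmic mass, and this is absorbed in N^delta. Cauchy's formula
    and the mean value property become averages over roots of unity. The inverse must be continuous,
    so each construction of a preimage carries a seminorm bound. The bounds are obtained for one eps
    at a time; uniqueness of the preimage turns them into statements about a single operator. *)

Fixpoint csum (f : nat -> C) (n : nat) : C :=
  match n with O => RtoC 0 | S k => (csum f k + f (S k))%C end.

Fixpoint rsum (f : nat -> R) (n : nat) : R :=
  match n with O => 0 | S k => rsum f k + f (S k) end.

Lemma csum_ext f g n : (forall k, (1 <= k <= n)%nat -> f k = g k) -> csum f n = csum g n.
Proof. induction n; simpl; intros H; auto. rewrite IHn, H; auto; try lia. intros; apply H; lia. Qed.

Lemma csum_plus f g n : csum (fun k => f k + g k)%C n = (csum f n + csum g n)%C.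
Proof. induction n; simpl. ring. rewrite IHn. ring. Qed.

Lemma csum_scal c f n : csum (fun k => c * f k)%C n = (c * csum f n)%C.
Proof. induction n; simpl. ring. rewrite IHn. ring. Qed.

Lemma csum_zero n : csum (fun _ => RtoC 0) n = RtoC 0.
Proof. induction n; simpl; auto. rewrite IHn. ring. Qed.

Lemma csum_minus f g n : csum (fun k => f k - g k)%C n = (csum f n - csum g n)%C.
Proof. induction n; simpl. ring. rewrite IHn. ring. Qed.

Lemma csum_const c n : csum (fun _ => c) n = (RtoC (INR n) * c)%C.
Proof. induction n. simpl. ring. rewrite S_INR, RtoC_plus. simpl csum. rewrite IHn. ring. Qed.

Lemma rsum_le f g n : (forall k, (1 <= k <= n)%nat -> f k <= g k) -> rsum f n <= rsum g n.
Proof. induction n; simpl; intros H. lra. apply Rplus_le_compat. apply IHn; intros; apply H; lia. apply H; lia. Qed.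

Lemma rsum_ext f g n : (forall k, (1 <= k <= n)%nat -> f k = g k) -> rsum f n = rsum g n.
Proof. induction n; simpl; intros H; auto. rewrite IHn, H; auto; try lia. intros; apply H; lia. Qed.

Lemma rsum_scal c f n : rsum (fun k => c * f k) n = c * rsum f n.
Proof. induction n; simpl. ring. rewrite IHn. ring. Qed.

Lemma rsum_const c n : rsum (fun _ => c) n = INR n * c.
Proof. induction n. simpl. ring. rewrite S_INR. simpl rsum. rewrite IHn. ring. Qed.

Lemma rsum_nonneg f n : (forall k, (1 <= k <= n)%nat -> 0 <= f k) -> 0 <= rsum f n.
Proof.
  intros H. replace 0 with (rsum (fun _ => 0) n). now apply rsum_le.
  rewrite rsum_const; ring.
Qed.

Lemma Cmod_csum f n : Cmod (csum f n) <= rsum (fun k => Cmod (f k)) n.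
Proof.
  induction n; simpl. rewrite Cmod_0; lra.
  eapply Rle_trans. apply Cmod_triangle. lra.
Qed.

Lemma Cmod_csum_le f g n :
  (forall k, (1 <= k <= n)%nat -> Cmod (f k) <= g k) -> Cmod (csum f n) <= rsum g n.
Proof. intros H. eapply Rle_trans. apply Cmod_csum. now apply rsum_le. Qed.

Lemma Re_csum f n : Re (csum f n) = rsum (fun k => Re (f k)) n.
Proof. induction n; simpl; auto. now rewrite <- IHn. Qed.

Lemma csum_trunc f n m :
  (n <= m)%nat -> csum (fun k => if (k <=? n)%nat then f k else RtoC 0) m = csum f n.
Proof.
  intros H. induction H.
  - apply csum_ext. intros k Hk. destruct (Nat.leb_spec k n); auto; lia.
  - cbn [csum]. rewrite IHle. destruct (Nat.leb_spec (S m) n). lia. ring.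
Qed.

Lemma csum_single (c : C) n m : (1 <= n <= m)%nat ->
  csum (fun k => if (k =? n)%nat then c else RtoC 0) m = c.
Proof.
  intros [H1 H]. destruct n as [|n]; [lia|]. induction H; cbn [csum].
  - rewrite Nat.eqb_refl.
    rewrite (csum_ext _ (fun _ => RtoC 0)). rewrite csum_zero; ring.
    intros k Hk. destruct (Nat.eqb_spec k (S n)); auto; lia.
  - rewrite IHle. destruct (Nat.eqb_spec (S m) (S n)). lia. ring.
Qed.

Lemma rsum_inv_sq n : rsum (fun k => / (INR k * INR k)) n <= 2.
Proof.
  (* The sharper bound 2 - 1/(n+1) is what lets the induction telescope. *)
  assert (rsum (fun k => / (INR k * INR k)) (S n) <= 2 - / INR (S n)).
  { induction n. simpl. lra.
    change (rsum (fun k : nat => / (INR k * INR k)) (S (S n))) with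
      (rsum (fun k : nat => / (INR k * INR k)) (S n) + / (INR (S (S n)) * INR (S (S n)))).
    assert (0 < INR (S n)) by apply lt_0_INR, Nat.lt_0_succ.
    rewrite (S_INR (S n)). set (x := INR (S n)) in *.
    assert (/ ((x+1)*(x+1)) <= / x - / (x+1)).
    { replace (/ x - / (x+1)) with (/ (x * (x+1))) by (field; lra).
      apply Rinv_le_contravar; nra. }
    lra. }
  simpl in H. assert (0 < INR (S n)) by apply lt_0_INR, Nat.lt_0_succ.
  apply Rinv_0_lt_compat in H0. simpl in H0.
  assert (0 <= / (match n with 0%nat => 1 | S _ => INR n + 1 end * match n with 0%nat => 1 | S _ => INR n + 1 end)).
  { left. apply Rinv_0_lt_compat. destruct n. lra. assert (0 <= INR (S n)) by apply pos_INR. nra. }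
  lra.
Qed.

Ltac pos := repeat first
  [ assumption | lra | apply exp_pos | apply Cmod_ge_0 | apply pos_INR | apply Rabs_pos | apply pow2_ge_0
  | apply Rmult_lt_0_compat | apply Rmult_le_pos | apply Rdiv_lt_0_compat | apply Rinv_0_lt_compat
  | apply pow_lt | apply pow_le | apply Rlt_le, exp_pos | apply Rlt_le, Rinv_0_lt_compat
  | apply Rmin_pos | apply lt_0_INR; lia ].

Lemma Cmod_RtoC_nonneg x : 0 <= x -> Cmod (RtoC x) = x.
Proof. intros. rewrite Cmod_R. now apply Rabs_pos_eq. Qed.

Lemma Cmod_triangle_le x y r : Cmod x + Cmod y <= r -> Cmod (x + y) <= r.
Proof. apply Rle_trans, Cmod_triangle. Qed.

Lemma Cmod_minus_sym x y : Cmod (x - y) = Cmod (y - x).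
Proof. rewrite <- Cmod_opp. f_equal. ring. Qed.

Lemma Cmod_minus_le x y : Cmod (x - y) <= Cmod x + Cmod y.
Proof. unfold Cminus. eapply Rle_trans. apply Cmod_triangle. rewrite Cmod_opp. lra. Qed.

Lemma Cmod_minus_le_trans x y r : Cmod x + Cmod y <= r -> Cmod (x - y) <= r.
Proof. apply Rle_trans, Cmod_minus_le. Qed.

Lemma Cmod_le_minus x y : Cmod x <= Cmod y + Cmod (x - y).
Proof. replace x with (y + (x - y))%C at 1 by ring. apply Cmod_triangle. Qed.

Lemma Re_le_Cmod z : Re z <= Cmod z.
Proof. eapply Rle_trans. apply Rle_abs. apply re_le_Cmod. Qed.

Lemma Re_ge_Cmod z : - Cmod z <= Re z.
Proof. assert (H := re_le_Cmod z). apply Rabs_le_between in H. lra. Qed.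

Lemma Cmod_small z : (forall eta, 0 < eta -> Cmod z <= eta) -> z = RtoC 0.
Proof.
  intros H. apply Cmod_eq_0. destruct (Cmod_ge_0 z); auto.
  specialize (H (Cmod z / 2)). lra.
Qed.

Lemma le_of_lt_all a b : (forall eta, 0 < eta -> a <= b + eta) -> a <= b.
Proof. intros H. destruct (Rle_lt_dec a b); auto. specialize (H ((a-b)/2)). lra. Qed.

Lemma exp_le x y : x <= y -> exp x <= exp y.
Proof. intros [H| ->]; [left; now apply exp_increasing|apply Rle_refl]. Qed.

Lemma Cexp_plus z w : Cexp (z + w) = (Cexp z * Cexp w)%C.
Proof.
  unfold Cexp, Cmult, Re, Im. simpl. rewrite exp_plus, cos_plus, sin_plus. f_equal; ring.
Qed.

Lemma Cexp_0 : Cexp 0 = RtoC 1.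
Proof. unfold Cexp. simpl. rewrite exp_0, cos_0, sin_0. unfold RtoC. f_equal; ring. Qed.

Lemma Cmod_Cexp z : Cmod (Cexp z) = exp (Re z).
Proof.
  unfold Cmod, Cexp. simpl.
  replace (exp (Re z) * cos (Im z) * (exp (Re z) * cos (Im z) * 1) +
    exp (Re z) * sin (Im z) * (exp (Re z) * sin (Im z) * 1)) with (Rsqr (exp (Re z))).
  rewrite sqrt_Rsqr; auto. left; apply exp_pos.
  assert (H := sin2_cos2 (Im z)). unfold Rsqr in *.
  transitivity (exp (Re z) * exp (Re z) * (sin (Im z) * sin (Im z) + cos (Im z) * cos (Im z))); [rewrite H|]; ring.
Qed.

Lemma Cexp_opp z : (Cexp z * Cexp (- z))%C = RtoC 1.
Proof. rewrite <- Cexp_plus. replace (z + - z)%C with (RtoC 0) by ring. apply Cexp_0. Qed.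

Lemma Cexp_neq_0 z : Cexp z <> RtoC 0.
Proof. intros H. assert (H1 := Cexp_opp z). rewrite H in H1. apply C1_nz. rewrite <- H1. ring. Qed.

Lemma Cexp_pow z n : (Cexp z ^ n)%C = Cexp (RtoC (INR n) * z).
Proof.
  induction n. simpl. rewrite <- Cexp_0. f_equal. ring.
  rewrite Cpow_S, IHn, S_INR, RtoC_plus, <- Cexp_plus. f_equal. ring.
Qed.

Lemma Cexp_RtoC x : Cexp (RtoC x) = RtoC (exp x).
Proof. unfold Cexp, RtoC. simpl. rewrite cos_0, sin_0. f_equal; ring. Qed.

(** Componentwise, so that the real mean value theorem and [auto_derive] apply along segments. *)
Definition rderiv (f : R -> C) (t : R) (d : C) : Prop :=
  is_derive (fun u => Re (f u)) t (Re d) /\ is_derive (fun u => Im (f u)) t (Im d).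

Lemma rderiv_const c t : rderiv (fun _ => c) t (RtoC 0).
Proof. split; simpl; auto_derive; auto. Qed.

Lemma rderiv_plus f g t df dg : rderiv f t df -> rderiv g t dg ->
  rderiv (fun u => f u + g u)%C t (df + dg)%C.
Proof.
  intros [H1 H2] [H3 H4]. split; simpl; apply (is_derive_plus (V := R_NormedModule)); auto.
Qed.

Lemma rderiv_scal c f t df : rderiv f t df -> rderiv (fun u => c * f u)%C t (c * df)%C.
Proof.
  intros [H1 H2]. split; simpl.
  - apply (is_derive_minus (V := R_NormedModule)); apply is_derive_scal; auto.
  - apply (is_derive_plus (V := R_NormedModule)); apply is_derive_scal; auto.
Qed.

Lemma rderiv_ext f g t df dg : (forall u, f u = g u) -> df = dg -> rderiv f t df -> rderiv g t dg.
Proof.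
  intros H <- [H1 H2]. split; eapply is_derive_ext; eauto; intros; simpl; now rewrite H.
Qed.

Lemma rderiv_Cexp (z : C) t : rderiv (fun u => Cexp (RtoC u * z)) t (z * Cexp (RtoC t * z)).
Proof.
  split; simpl.
  - auto_derive; auto. unfold Cexp, Re, Im, Rminus; simpl. ring.
  - auto_derive; auto. unfold Cexp, Re, Im, Rminus; simpl. ring.
Qed.

(** With w = f b - f a, Cauchy-Schwarz makes |w| g - Re(conj(w) f) nondecreasing; comparing the
    endpoints gives |w|^2 <= |w| (g b - g a). This does the work of integrating [df]. *)
Lemma mean_value_inequality (f df : R -> C) (g dg : R -> R) a b : a <= b ->
  (forall t, a <= t <= b -> rderiv f t (df t) /\ is_derive g t (dg t) /\ Cmod (df t) <= dg t) ->
  Cmod (f b - f a) <= g b - g a.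
Proof.
  intros Hab H.
  (* If w = 0 there is no direction to project on, but [dg] dominates a modulus, so [g] is
     nondecreasing. *)
  set (w := (f b - f a)%C). destruct (Req_dec (Cmod w) 0) as [E|E].
  - rewrite E. destruct (MVT_gen g a b dg) as (c & Hc & E').
    + rewrite Rmin_left, Rmax_right by lra. intros x Hx. apply H; lra.
    + rewrite Rmin_left, Rmax_right by lra. intros x Hx. apply continuity_pt_filterlim.
      eapply @ex_derive_continuous. eexists. apply H; lra.
    + rewrite Rmin_left, Rmax_right in Hc by lra. rewrite E'.
      destruct (H c Hc) as (_ & _ & Hd). assert (0 <= Cmod (df c)) by pos.
      pos.
  - assert (Hw : 0 < Cmod w) by (assert (0 <= Cmod w) by apply Cmod_ge_0; lra).
    set (h := fun t => Cmod w * g t - (Re w * Re (f t) + Im w * Im (f t))).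
    set (dh := fun t => Cmod w * dg t - (Re w * Re (df t) + Im w * Im (df t))).
    destruct (MVT_gen h a b dh) as (c & Hc & E').
    + rewrite Rmin_left, Rmax_right by lra. intros x Hx.
      destruct (H x) as ((H1 & H2) & H3 & _); [lra|].
      apply (is_derive_minus (V := R_NormedModule)); [|apply (is_derive_plus (V := R_NormedModule))]; apply is_derive_scal; auto.
    + rewrite Rmin_left, Rmax_right by lra. intros x Hx. apply continuity_pt_filterlim.
      destruct (H x) as ((H1 & H2) & H3 & _); [lra|].
      eapply @ex_derive_continuous. eexists.
      apply (is_derive_minus (V := R_NormedModule)); [|apply (is_derive_plus (V := R_NormedModule))]; apply is_derive_scal; eauto.
    + rewrite Rmin_left, Rmax_right in Hc by lra.
      assert (Hd : 0 <= dh c).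
      { destruct (H c Hc) as (_ & _ & Hd). unfold dh.
        assert (Re w * Re (df c) + Im w * Im (df c) <= Cmod w * Cmod (df c)).
        { replace (Re w * Re (df c) + Im w * Im (df c)) with (Re (Cconj w * df c)%C) by (unfold Re, Im; simpl; ring).
          eapply Rle_trans. apply Re_le_Cmod. rewrite Cmod_mult, Cmod_conj. lra. }
        assert (Cmod w * Cmod (df c) <= Cmod w * dg c) by (apply Rmult_le_compat_l; lra). lra. }
      assert (0 <= h b - h a) by (rewrite E'; pos).
      unfold h in H0.
      assert (Re w * (Re (f b) - Re (f a)) + Im w * (Im (f b) - Im (f a)) = Cmod w * Cmod w).
      { transitivity (Cmod w ^ 2); [|ring]. rewrite Cmod2_alt. unfold w, Re, Im; simpl. ring. }
      apply Rmult_le_reg_l with (Cmod w); auto. nra.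
Qed.

(** The first [d] terms of the exponential series, hence a polynomial of degree less than [d]. *)
Fixpoint exp_taylor (d : nat) (z : C) : C :=
  match d with O => RtoC 0 | S k => (exp_taylor k z + RtoC (/ INR (fact k)) * z ^ k)%C end.

Lemma rderiv_real_mult r dr (c : C) t : is_derive r t dr ->
  rderiv (fun u => RtoC (r u) * c)%C t (RtoC dr * c)%C.
Proof.
  intros H. split; unfold Re, Im; simpl.
  - apply (is_derive_ext (fun u => fst c * r u)). intros u; change (fst c * r u = r u * fst c - 0 * snd c); ring.
    replace (dr * fst c - 0 * snd c) with (fst c * dr) by ring. now apply is_derive_scal.
  - apply (is_derive_ext (fun u => snd c * r u)). intros u; change (snd c * r u = r u * snd c + 0 * fst c); ring.
    replace (dr * snd c + 0 * fst c) with (snd c * dr) by ring. now apply is_derive_scal.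
Qed.

Lemma is_derive_pow_S n t : is_derive (fun u : R => u ^ S n) t (INR (S n) * t ^ n).
Proof.
  replace (INR (S n) * t ^ n) with (INR (S n) * 1 * t ^ pred (S n)) by (simpl pred; ring).
  apply (is_derive_pow (fun u => u)). apply (is_derive_id (K := R_AbsRing)).
Qed.

Lemma rderiv_exp_taylor d z t :
  rderiv (fun u => exp_taylor (S d) (RtoC u * z)) t (z * exp_taylor d (RtoC t * z)).
Proof.
  induction d.
  - simpl. apply (rderiv_ext (fun _ => RtoC 1) _ t (RtoC 0)).
    intros; simpl. rewrite Rinv_1. ring. ring. apply rderiv_const.
  - change (rderiv (fun u : R => (exp_taylor (S d) (RtoC u * z) +
        RtoC (/ INR (fact (S d))) * (RtoC u * z) ^ S d)%C) t (z * (exp_taylor d (RtoC t * z) +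
        RtoC (/ INR (fact d)) * (RtoC t * z) ^ d))).
    apply (rderiv_ext (fun u => (exp_taylor (S d) (RtoC u * z) +
        RtoC (/ INR (fact (S d))) * (RtoC (u ^ S d) * z ^ S d))%C) _ t
       (z * exp_taylor d (RtoC t * z) + RtoC (/ INR (fact (S d))) * (RtoC (INR (S d) * t ^ d) * z ^ S d))%C).
    + intros u. rewrite (Cpow_mult_l (RtoC u)), (RtoC_pow u). reflexivity.
    + rewrite (Cpow_mult_l (RtoC t)), <- (RtoC_pow t), Cpow_S.
      replace (RtoC (/ INR (fact d))) with (RtoC (/ INR (fact (S d))) * RtoC (INR (S d)))%C.
      rewrite RtoC_mult. ring.
      rewrite <- RtoC_mult. f_equal. rewrite fact_simpl, mult_INR. field.
      split; [apply INR_fact_neq_0|apply not_0_INR; lia].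
    + apply rderiv_plus; auto. apply rderiv_scal. apply rderiv_real_mult, is_derive_pow_S.
Qed.

(** In t, the remainder of order d + 1 has as derivative z times the remainder of order d, so each
    use of the mean value inequality integrates the bound once. *)
Lemma Cexp_taylor d z t : 0 <= t ->
  Cmod (Cexp (RtoC t * z) - exp_taylor d (RtoC t * z)) <= (t * Cmod z) ^ d / INR (fact d) * exp (t * Cmod z).
Proof.
  revert t. induction d; intros t Ht.
  - simpl exp_taylor. replace (Cexp (RtoC t * z) - 0)%C with (Cexp (RtoC t * z)) by ring. rewrite Cmod_Cexp. simpl.
    unfold Rdiv. rewrite Rinv_1, !Rmult_1_l. rewrite Rmult_0_l, Rminus_0_r. apply exp_le.
    apply Rmult_le_compat_l; auto. apply Re_le_Cmod.
  - assert (H0 : (Cexp (RtoC 0 * z) - exp_taylor (S d) (RtoC 0 * z))%C = RtoC 0).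
    { replace (RtoC 0 * z)%C with (RtoC 0) by ring. rewrite Cexp_0.
      clear. induction d. simpl. rewrite Rinv_1. ring.
      change (exp_taylor (S (S d)) 0) with (exp_taylor (S d) 0 + RtoC (/ INR (fact (S d))) * 0 ^ S d)%C.
      rewrite Cpow_S. etransitivity; [|exact IHd]. ring. }
    set (f := fun u => (Cexp (RtoC u * z) + (-1) * exp_taylor (S d) (RtoC u * z))%C).
    (* The exponential factor is frozen at the right endpoint, which leaves a monomial as
       majorant. *)
    set (K := exp (t * Cmod z)).
    assert (Cmod (f t - f 0) <= (fun u => (u * Cmod z) ^ S d / INR (fact (S d)) * K) t
              - (fun u => (u * Cmod z) ^ S d / INR (fact (S d)) * K) 0).
    { apply (mean_value_inequality f (fun u => z * Cexp (RtoC u * z) + (-1) * (z * exp_taylor d (RtoC u * z)))%C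
         (fun u => (u * Cmod z) ^ S d / INR (fact (S d)) * K)
         (fun u => Cmod z * ((u * Cmod z) ^ d / INR (fact d) * K))); auto.
      intros u Hu. split; [|split].
      - apply rderiv_plus. apply rderiv_Cexp. apply rderiv_scal, rderiv_exp_taylor.
      - apply (is_derive_ext (fun v => (Cmod z ^ S d / INR (fact (S d)) * K) * v ^ S d)).
        { intros v. rewrite Rpow_mult_distr. unfold Rdiv.
          match goal with |- ?a = ?b => change (@eq R a b) end. ring. }
        replace (Cmod z * ((u * Cmod z) ^ d / INR (fact d) * K))
          with (Cmod z ^ S d / INR (fact (S d)) * K * (INR (S d) * u ^ d)).
        apply is_derive_scal, is_derive_pow_S.
        rewrite fact_simpl, mult_INR, Rpow_mult_distr, <- tech_pow_Rmult. field.
        split; [apply INR_fact_neq_0|apply not_0_INR; lia].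
      - replace (z * Cexp (RtoC u * z) + -1 * (z * exp_taylor d (RtoC u * z)))%C
          with (z * (Cexp (RtoC u * z) - exp_taylor d (RtoC u * z)))%C by ring.
        rewrite Cmod_mult. apply Rmult_le_compat_l. apply Cmod_ge_0.
        eapply Rle_trans. apply IHd; lra. apply Rmult_le_compat_l.
        pos. apply INR_fact_lt_0.
        apply exp_le. apply Rmult_le_compat_r; [apply Cmod_ge_0|lra]. }
    replace (Cexp (RtoC t * z) - exp_taylor (S d) (RtoC t * z))%C with (f t - f 0)%C.
    eapply Rle_trans. apply H. cbv beta. rewrite Rmult_0_l, pow_i by lia. unfold K. lra.
    unfold f. transitivity (Cexp (RtoC t * z) - exp_taylor (S d) (RtoC t * z) - (Cexp (RtoC 0 * z) - exp_taylor (S d) (RtoC 0 * z)))%C. ring.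
    rewrite H0. ring.
Qed.

Lemma Cexp_taylor_bound d z :
  Cmod (Cexp z - exp_taylor d z) <= Cmod z ^ d / INR (fact d) * exp (Cmod z).
Proof.
  assert (H := Cexp_taylor d z 1 Rle_0_1). rewrite !Rmult_1_l in H.
  replace (1 * z)%C with z in H by ring. exact H.
Qed.

Lemma Cexp_linear z : Cmod z <= 1 -> Cmod (Cexp z - 1 - z) <= 2 * Cmod z ^ 2.
Proof.
  intros H. assert (H1 := Cexp_taylor_bound 2 z).
  replace (Cexp z - 1 - z)%C with (Cexp z - exp_taylor 2 z)%C.
  eapply Rle_trans. apply H1. simpl fact.
  assert (exp (Cmod z) <= 3).
  { eapply Rle_trans. apply exp_le, H. apply exp_le_3. }
  simpl INR. nra.
  simpl. rewrite Rinv_1. ring.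
Qed.

(** * The sawtooth series *)

(** Partial sums of the Fourier series of (pi - x)/2 on (0, 2 pi). *)
Definition sawtooth (J : nat) (x : R) : R := rsum (fun j => sin (INR j * x) / INR j) J.

Lemma sawtooth_derive J x : is_derive (sawtooth J) x (rsum (fun j => cos (INR j * x)) J).
Proof.
  unfold sawtooth. induction J; cbn [rsum].
  - auto_derive; auto.
  - apply (is_derive_plus (V := R_NormedModule)); auto.
    assert (INR (S J) <> 0) by (apply not_0_INR; lia).
    set (n := INR (S J)) in *. auto_derive; auto. field; auto.
Qed.

Lemma dirichlet_kernel J x :
  2 * sin (x / 2) * rsum (fun j => cos (INR j * x)) J = sin ((INR J + / 2) * x) - sin (x / 2).
Proof.
  induction J; cbn [rsum].
  - replace ((INR 0 + / 2) * x) with (x / 2) by (simpl; field). ring.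
  - rewrite Rmult_plus_distr_l, IHJ, S_INR.
    replace ((INR J + / 2) * x) with ((INR J + 1) * x - x / 2) by field.
    replace ((INR J + 1 + / 2) * x) with ((INR J + 1) * x + x / 2) by field.
    rewrite sin_plus, sin_minus. ring.
Qed.

Lemma sin_mult_PI n : sin (INR n * PI) = 0.
Proof.
  induction n. simpl. rewrite Rmult_0_l. apply sin_0.
  rewrite S_INR. replace ((INR n + 1) * PI) with (INR n * PI + PI) by ring.
  rewrite neg_sin, IHn. ring.
Qed.

Lemma sawtooth_PI J : sawtooth J PI = 0.
Proof.
  unfold sawtooth. rewrite (rsum_ext _ (fun _ => 0)). rewrite rsum_const; ring.
  intros k Hk. rewrite sin_mult_PI. unfold Rdiv; ring.
Qed.

Lemma cos_half_PI_odd J : cos ((INR J + / 2) * PI) = 0.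
Proof.
  replace ((INR J + / 2) * PI) with (INR J * PI + PI / 2) by field.
  rewrite cos_plus, cos_PI2, sin_mult_PI. ring.
Qed.

(* After integrating the Dirichlet kernel by parts once, what remains of the
   error has derivative O(1/(J sin^2(x/2))) and vanishes at [PI]. *)
Lemma sawtooth_approx J x : 0 < x <= PI ->
  Rabs (sawtooth J x - (PI - x) / 2) <= 2 / ((2 * INR J + 1) * sin (x / 2)).
Proof.
  intros Hx. assert (HJ : 0 <= INR J) by pos.
  set (c := 2 * INR J + 1). assert (Hc : 0 < c) by (unfold c; lra).
  assert (Hsin : forall t, x <= t <= PI -> 0 < sin (t / 2)).
  { intros t Ht. apply sin_gt_0; lra. }
  set (G := fun t => sawtooth J t - (PI - t) / 2 + cos ((INR J + / 2) * t) / (c * sin (t / 2))).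
  set (dG := fun t => - (cos ((INR J + / 2) * t) * cos (t / 2)) / (2 * c * (sin (t / 2) * sin (t / 2)))).
  (* A multiple of the cotangent: an explicit antiderivative of the bound [dg] for |[dG]|, vanishing
     at [PI] like [G]. *)
  set (g := fun t => - (cos (t / 2) / (c * sin (t / 2)))).
  set (dg := fun t => / (2 * c * (sin (t / 2) * sin (t / 2)))).
  assert (HG : forall t, x <= t <= PI -> is_derive G t (dG t)).
  { intros t Ht. specialize (Hsin t Ht). unfold G, dG.
    assert (H1 : is_derive (fun t => (PI - t) / 2) t (- / 2)).
    { auto_derive; auto. field. }
    assert (H2 : is_derive (fun t => cos ((INR J + / 2) * t) / (c * sin (t / 2))) t
      (- ((INR J + / 2) * sin ((INR J + / 2) * t)) / (c * sin (t / 2))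
       - cos ((INR J + / 2) * t) * cos (t / 2) / (2 * c * (sin (t / 2) * sin (t / 2))))).
    { auto_derive. apply Rmult_integral_contrapositive; split; lra.
      replace (t * / 2) with (t / 2) by reflexivity. field. lra. }
    assert (H := is_derive_plus (V := R_NormedModule) _ _ _ _ _
       (is_derive_minus (V := R_NormedModule) _ _ _ _ _ (sawtooth_derive J t) H1) H2).
    match type of H with is_derive _ _ ?d => replace (- (cos ((INR J + / 2) * t) * cos (t / 2)) / (2 * c * (sin (t / 2) * sin (t / 2)))) with d; [exact H|] end.
    clear H H1 H2.
    assert (HD := dirichlet_kernel J t).
    replace (rsum (fun j : nat => cos (INR j * t)) J) with ((sin ((INR J + / 2) * t) - sin (t / 2)) / (2 * sin (t / 2))).
    2:{ rewrite <- HD. field. lra. }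
    unfold plus, minus, opp, plus; simpl.
    assert (E : INR J + / 2 = c / 2) by (unfold c; field). rewrite E. field. lra. }
  assert (Hg : forall t, x <= t <= PI -> is_derive g t (dg t)).
  { intros t Ht. specialize (Hsin t Ht). unfold g, dg. auto_derive.
    apply Rmult_integral_contrapositive; split; lra.
    replace (t * / 2) with (t / 2) by reflexivity.
    assert (H := sin2_cos2 (t / 2)). unfold Rsqr in H.
    replace (cos (t/2) * (1 * / 2 * cos (t/2))) with (/2 * (cos (t/2) * cos (t/2))) by ring.
    replace (- (- (1 * / 2 * sin (t / 2)))) with (/2 * sin (t / 2)) by ring.
    field_simplify_eq; [|lra]. nra. }
  assert (H : Cmod (RtoC (G PI) - RtoC (G x)) <= g PI - g x).
  { apply (mean_value_inequality (fun t => RtoC (G t)) (fun t => RtoC (dG t)) g dg); [lra|].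
    intros t Ht. split; [|split; auto].
    - apply (rderiv_ext (fun u => RtoC (G u) * 1)%C _ t (RtoC (dG t) * 1)%C).
      intros; ring. ring. apply rderiv_real_mult. auto.
    - specialize (Hsin t Ht). rewrite Cmod_R. unfold dG, dg.
      unfold Rdiv. rewrite Rabs_mult. rewrite (Rabs_pos_eq (/ _)).
      + match goal with |- _ <= ?q => apply Rle_trans with (1 * q); [|lra] end. apply Rmult_le_compat_r.
        * left. apply Rinv_0_lt_compat. apply Rmult_lt_0_compat. lra. apply Rmult_lt_0_compat; auto.
        * rewrite Rabs_Ropp, Rabs_mult. rewrite <- (Rmult_1_l 1).
          apply Rmult_le_compat; try apply Rabs_pos; apply Rabs_le, COS_bound.
      + left. apply Rinv_0_lt_compat. apply Rmult_lt_0_compat. lra. apply Rmult_lt_0_compat; auto. }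
  rewrite <- RtoC_minus, Cmod_R in H.
  assert (EG : G PI = 0).
  { unfold G. rewrite sawtooth_PI, cos_half_PI_odd. unfold Rdiv. ring. }
  assert (Eg : g PI = 0). { unfold g. rewrite cos_PI2. unfold Rdiv; ring. }
  rewrite EG, Eg in H. unfold Rminus in H. rewrite !Rplus_0_l, Rabs_Ropp in H.
  assert (Hs : 0 < c * sin (x / 2)) by (apply Rmult_lt_0_compat; auto; apply Hsin; lra).
  assert (H2 : forall t, Rabs (cos t / (c * sin (x / 2))) <= / (c * sin (x / 2))).
  { intros t. unfold Rdiv. rewrite Rabs_mult, (Rabs_pos_eq (/ _)).
    match goal with |- _ <= ?q => apply Rle_trans with (1 * q); [|lra] end. apply Rmult_le_compat_r.
    left; now apply Rinv_0_lt_compat. apply Rabs_le, COS_bound.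
    left; now apply Rinv_0_lt_compat. }
  replace (sawtooth J x - (PI - x) / 2) with (G x - cos ((INR J + / 2) * x) / (c * sin (x / 2))) by (unfold G; ring).
  eapply Rle_trans. apply Rabs_triang. rewrite Rabs_Ropp.
  assert (H3 := H2 ((INR J + / 2) * x)).
  assert (H4 := Rle_trans _ _ _ (Rle_abs _) (H2 (x / 2))).
  unfold g in H. unfold Rdiv at 2. lra.
Qed.

(** A weak form of Jordan's inequality for y = x/2: up to pi/3 the cosine is at least 1/2, beyond
    pi/3 the sine is at least sqrt(3)/2. *)
Lemma sin_half_lower x : 0 <= x <= PI -> x / 6 <= sin (x / 2).
Proof.
  intros Hx.
  assert (H : forall y, 0 <= y <= PI / 2 -> y / 3 <= sin y).
  { intros y Hy. destruct (Rle_lt_dec y (PI/3)) as [L|L].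
    - destruct (Req_dec y 0) as [->|Hy0]. rewrite sin_0; lra.
      destruct (MVT_gen sin 0 y cos) as (c & Hc & E).
      + intros; auto_derive; auto; ring.
      + intros. apply continuity_sin.
      + rewrite Rmin_left, Rmax_right in Hc by lra.
        rewrite sin_0 in E.
        assert (cos (PI/3) <= cos c) by (apply cos_decr_1; lra).
        rewrite cos_PI3 in H. nra.
    - assert (sin (PI/3) <= sin y) by (apply sin_incr_1; lra).
      rewrite sin_PI3 in H. assert (HP := PI_4).
      assert (3/2 <= sqrt 3). { rewrite <- (sqrt_Rsqr (3/2)) by lra. apply sqrt_le_1; unfold Rsqr; lra. }
      lra. }
  replace (x / 6) with (x / 2 / 3) by field. apply H. lra.
Qed.

(** In the limit (pi - x)/2 - (pi - 2x)/4 = pi/4 on (0, pi): the linear parts cancel and, by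
    oddness, a pure jump at 0 remains. *)
Definition square_wave (J : nat) (x : R) : R := sawtooth J x - sawtooth J (2 * x) / 2.

Lemma square_wave_odd J x : square_wave J (- x) = - square_wave J x.
Proof.
  assert (forall y, sawtooth J (- y) = - sawtooth J y).
  { intros y. unfold sawtooth. replace (- rsum (fun j => sin (INR j * y) / INR j) J)
      with ((-1) * rsum (fun j => sin (INR j * y) / INR j) J) by ring.
    rewrite <- rsum_scal. apply rsum_ext. intros k Hk.
    replace (INR k * - y) with (- (INR k * y)) by ring. rewrite sin_neg. unfold Rdiv; ring. }
  unfold square_wave. replace (2 * - x) with (- (2 * x)) by ring. rewrite !H. field.
Qed.

(** Both x and 2x lie in (0, pi], where the sawtooth estimate applies; its errors 12 and 6/2 add up
    to 15. *)
Lemma square_wave_approx J x : 0 < x <= 3 / 2 ->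
  Rabs (square_wave J x - PI / 4) <= 15 / ((INR J + 1) * x).
Proof.
  intros Hx. assert (HP := PI2_3_2).
  assert (HJ : 0 <= INR J) by pos.
  assert (H1 := sawtooth_approx J x ltac:(lra)).
  assert (H2 := sawtooth_approx J (2 * x) ltac:(lra)).
  assert (S1 := sin_half_lower x ltac:(lra)).
  assert (S2 := sin_half_lower (2 * x) ltac:(lra)).
  assert (HH : forall y, 0 < y -> y / 6 <= sin (y / 2) -> 2 / ((2 * INR J + 1) * sin (y / 2)) <= 12 / ((INR J + 1) * y)).
  { intros y Hy Hs.
    replace (12 / ((INR J + 1) * y)) with (2 / ((INR J + 1) * (y / 6))) by (field; lra).
    apply Rmult_le_compat_l; [lra|]. apply Rinv_le_contravar.
    apply Rmult_lt_0_compat; lra.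
    apply Rmult_le_compat; lra. }
  assert (A1 := HH x ltac:(lra) S1). assert (A2 := HH (2 * x) ltac:(lra) S2).
  set (q := / ((INR J + 1) * x)).
  replace (12 / ((INR J + 1) * (2 * x))) with (6 * q) in A2 by (unfold q; field; lra).
  replace (12 / ((INR J + 1) * x)) with (12 * q) in A1 by (unfold q; field; lra).
  replace (15 / ((INR J + 1) * x)) with (15 * q) by (unfold q; field; lra).
  unfold square_wave.
  replace (sawtooth J x - sawtooth J (2 * x) / 2 - PI / 4) with
    ((sawtooth J x - (PI - x) / 2) - (sawtooth J (2 * x) - (PI - 2 * x) / 2) / 2) by field.
  apply Rabs_le_between in H1, H2. apply Rabs_le_between. lra.
Qed.

(** * Multipliers of Dirichlet polynomials *)

Definition cis (x : R) : C := (cos x, sin x).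

Lemma cis_plus x y : cis (x + y) = (cis x * cis y)%C.
Proof. unfold cis, Cmult. simpl. rewrite cos_plus, sin_plus. f_equal; ring. Qed.

Lemma Cexp_cis x : Cexp (0, x) = cis x.
Proof. unfold Cexp, cis, Re, Im; simpl. rewrite exp_0. f_equal; ring. Qed.

Lemma Cmod_cis x : Cmod (cis x) = 1.
Proof. rewrite <- Cexp_cis, Cmod_Cexp. unfold Re; simpl. apply exp_0. Qed.

(** A Dirichlet polynomial along a vertical line; the factor n^(-sigma) is kept inside [a n]. *)
Definition osc (a : nat -> C) (X : nat) (t : R) : C :=
  csum (fun n => a n * cis (- (t * ln (INR n))))%C X.

(* [m] acts on Dirichlet polynomials, restricted to a vertical line, like the
   Fourier transform of a measure of mass [kappa] supported on [-T, T]. *)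
Definition multiplier (kappa T : R) (m : nat -> C) : Prop :=
  forall X a K, (forall t, Rabs t <= T -> Cmod (osc a X t) <= K) ->
  Cmod (csum (fun n => a n * m n)%C X) <= kappa * K.

Lemma multiplier_ext k T m m' : (forall n, (1 <= n)%nat -> m n = m' n) -> multiplier k T m -> multiplier k T m'.
Proof.
  intros E H X a K Ha. rewrite <- (csum_ext (fun n => a n * m n)%C). now apply H.
  intros; rewrite E; auto; lia.
Qed.

Lemma multiplier_mono k k' T T' m : 0 <= T -> k <= k' -> T <= T' -> multiplier k T m -> multiplier k' T' m.
Proof.
  intros HT Hk HT' H X a K Ha. eapply Rle_trans. apply H. intros; apply Ha; lra.
  apply Rmult_le_compat_r; auto. eapply Rle_trans. apply Cmod_ge_0. apply (Ha 0). rewrite Rabs_R0; lra.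
Qed.

Lemma multiplier_cis c t T : Rabs t <= T -> multiplier (Cmod c) T (fun n => c * cis (- (t * ln (INR n))))%C.
Proof.
  intros Ht X a K Ha. rewrite (csum_ext _ (fun n => c * (a n * cis (- (t * ln (INR n)))))%C).
  rewrite csum_scal, Cmod_mult. apply Rmult_le_compat_l. apply Cmod_ge_0. now apply Ha.
  intros; ring.
Qed.

Lemma multiplier_const c k T : 0 <= T -> Cmod c = k -> multiplier k T (fun _ => c).
Proof.
  intros HT <-. apply (multiplier_ext _ _ (fun n => c * cis (- (0 * ln (INR n))))%C).
  intros n _. replace (- (0 * ln (INR n))) with 0 by ring. rewrite <- Cexp_cis.
  change (0, 0) with (RtoC 0). rewrite Cexp_0. ring.
  apply multiplier_cis. rewrite Rabs_R0; lra.
Qed.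

Lemma multiplier_plus k k' T m m' : multiplier k T m -> multiplier k' T m' ->
  multiplier (k + k') T (fun n => m n + m' n)%C.
Proof.
  intros H H' X a K Ha. rewrite (csum_ext _ (fun n => a n * m n + a n * m' n)%C) by (intros; ring).
  rewrite csum_plus. apply Cmod_triangle_le.
  specialize (H X a K Ha). specialize (H' X a K Ha). lra.
Qed.

Lemma multiplier_scal c k T m : multiplier k T m -> multiplier (Cmod c * k) T (fun n => c * m n)%C.
Proof.
  intros H X a K Ha. rewrite (csum_ext _ (fun n => c * (a n * m n))%C) by (intros; ring).
  rewrite csum_scal, Cmod_mult, Rmult_assoc. apply Rmult_le_compat_l. apply Cmod_ge_0. now apply H.
Qed.

(** Convolution of the two measures: masses multiply and supports add. *)
Lemma multiplier_mult k k' T T' m m' : multiplier k T m -> multiplier k' T' m' ->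
  multiplier (k * k') (T + T') (fun n => m n * m' n)%C.
Proof.
  intros H H' X a K Ha.
  rewrite (csum_ext _ (fun n => (a n * m' n) * m n)%C) by (intros; ring).
  rewrite Rmult_assoc. apply H. intros t Ht. unfold osc.
  rewrite (csum_ext _ (fun n => (a n * cis (- (t * ln (INR n)))) * m' n)%C) by (intros; ring).
  apply H'. intros t' Ht'. specialize (Ha (t + t')).
  assert (Rabs (t + t') <= T + T') by (eapply Rle_trans; [apply Rabs_triang|lra]).
  specialize (Ha H0). unfold osc in *.
  rewrite (csum_ext _ (fun n => a n * cis (- ((t + t') * ln (INR n))))%C); auto.
  intros k0 Hk0. replace (- ((t + t') * ln (INR k0))) with (- (t * ln (INR k0)) + - (t' * ln (INR k0))) by ring.
  rewrite cis_plus. ring.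
Qed.

Lemma multiplier_pow T m k : 0 <= T -> multiplier 1 T m -> multiplier 1 (INR k * T) (fun n => m n ^ k)%C.
Proof.
  intros HT H. induction k.
  - simpl. replace (0 * T) with 0 by ring. apply multiplier_const. lra. apply Cmod_1.
  - rewrite S_INR. replace ((INR k + 1) * T) with (T + INR k * T) by ring.
    replace 1 with (1 * 1) by ring. now apply multiplier_mult.
Qed.

Lemma multiplier_rsum (kappa : nat -> R) T (m : nat -> nat -> R) J : 0 <= T ->
  (forall j, (1 <= j <= J)%nat -> multiplier (kappa j) T (fun n => RtoC (m j n))) ->
  multiplier (rsum kappa J) T (fun n => RtoC (rsum (fun j => m j n) J)).
Proof.
  intros HT. induction J; intros H; cbn [rsum].
  - apply multiplier_const; auto. apply Cmod_0.
  - apply (multiplier_ext _ _ (fun n => RtoC (rsum (fun j => m j n) J) + RtoC (m (S J) n))%C).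
    intros; now rewrite RtoC_plus. apply multiplier_plus. apply IHJ. intros; apply H; lia. apply H; lia.
Qed.

(** Two point masses 1/2 at h and -h; the shift by [l] only changes their phases. *)
Lemma multiplier_cos h l T : 0 <= h <= T -> multiplier 1 T (fun n => RtoC (cos (h * (ln (INR n) - l)))).
Proof.
  intros Hh.
  apply (multiplier_ext _ _ (fun n => (/ 2 * cis (h * l)) * cis (- (h * ln (INR n))) +
     (/ 2 * cis (- (h * l))) * cis (- (- h * ln (INR n))))%C).
  - intros n _. rewrite <- !Cmult_assoc, <- !cis_plus.
    replace (h * (ln (INR n) - l)) with (- (h * l + - (h * ln (INR n)))) by ring.
    replace (- (h * l) + - (- h * ln (INR n))) with (- (h * l + - (h * ln (INR n)))) by ring.
    unfold cis. rewrite cos_neg, sin_neg.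
    rewrite <- RtoC_inv by lra. apply injective_projections; simpl; field.
  - replace 1 with (Cmod (/ 2 * cis (h * l)) + Cmod (/ 2 * cis (- (h * l)))).
    apply multiplier_plus; apply multiplier_cis. rewrite Rabs_pos_eq; lra. rewrite Rabs_Ropp, Rabs_pos_eq; lra.
    rewrite !Cmod_mult, !Cmod_cis. rewrite <- RtoC_inv by lra. rewrite Cmod_RtoC_nonneg by lra. field.
Qed.

Lemma multiplier_sin h l T : 0 <= h <= T -> multiplier 1 T (fun n => RtoC (sin (h * (ln (INR n) - l)))).
Proof.
  intros Hh. destruct (Req_dec h 0) as [->|Hh0].
  - apply (multiplier_ext _ _ (fun _ => RtoC 0)).
    intros; now rewrite Rmult_0_l, sin_0.
    apply (multiplier_mono 0 _ 0); try lra. apply multiplier_const; [lra|apply Cmod_0].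
  - apply (multiplier_ext _ _ (fun n => RtoC (cos (h * (ln (INR n) - (l + PI / 2 / h)))))).
    + intros n _. replace (h * (ln (INR n) - (l + PI / 2 / h))) with (- (PI / 2 - (h * (ln (INR n) - l)))) by (field; auto).
      now rewrite cos_neg, cos_shift.
    + now apply multiplier_cos.
Qed.

(** Tested on a single term, whose oscillation has modulus 1. *)
Lemma multiplier_bound k T m n : (1 <= n)%nat -> multiplier k T m -> Cmod (m n) <= k.
Proof.
  intros Hn H. specialize (H n (fun j => if (j =? n)%nat then RtoC 1 else RtoC 0) 1).
  rewrite Rmult_1_r in H.
  assert (E : forall g : nat -> C, csum (fun j => (if (j =? n)%nat then RtoC 1 else RtoC 0) * g j)%C n = g n).
  { intros g. rewrite (csum_ext _ (fun j => if (j =? n)%nat then g n else RtoC 0)).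
    apply csum_single; lia. intros j _. destruct (Nat.eqb_spec j n). subst; ring. ring. }
  rewrite E in H. apply H. intros t _. unfold osc. rewrite E, Cmod_cis. lra.
Qed.

Lemma rsum_pow_small (b c : nat -> R) X eta : 0 < eta ->
  (forall k, (1 <= k <= X)%nat -> 0 <= c k < 1) ->
  exists M0, forall M, (M0 <= M)%nat -> rsum (fun k => b k * c k ^ M) X <= eta.
Proof.
  revert eta. induction X; intros eta He H; cbn [rsum].
  - exists 0%nat. intros; lra.
  - destruct (IHX (eta / 2)) as (M1 & H1). lra. intros; apply H; lia.
    assert (Hc := H (S X) ltac:(lia)).
    assert (Hb : 0 < 1 + Rabs (b (S X))) by (assert (0 <= Rabs (b (S X))) by apply Rabs_pos; lra).
    destruct (pow_lt_1_zero (c (S X)) ltac:(rewrite Rabs_pos_eq; lra) (eta / 2 / (1 + Rabs (b (S X))))) as (M2 & H2).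
    pos.
    exists (max M1 M2). intros M HM. specialize (H1 M ltac:(lia)). specialize (H2 M ltac:(lia)).
    assert (b (S X) * c (S X) ^ M <= eta / 2).
    { eapply Rle_trans. apply Rle_abs. rewrite Rabs_mult.
      apply Rle_trans with ((1 + Rabs (b (S X))) * (eta / 2 / (1 + Rabs (b (S X))))).
      apply Rmult_le_compat; try apply Rabs_pos; lra. right; field; lra. }
    lra.
Qed.

Lemma ln_INR_nonneg n : (1 <= n)%nat -> 0 <= ln (INR n).
Proof.
  intros H. rewrite <- ln_1. apply ln_le. lra. apply le_INR in H. exact H.
Qed.

Lemma ln_INR_le n m : (1 <= n <= m)%nat -> ln (INR n) <= ln (INR m).
Proof. intros H. apply ln_le. apply lt_0_INR; lia. apply le_INR; lia. Qed.

Lemma ln_INR_inj n m : (1 <= n)%nat -> (1 <= m)%nat -> ln (INR n) = ln (INR m) -> n = m.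
Proof. intros Hn Hm H. apply INR_eq. apply ln_inv; auto; apply lt_0_INR; lia. Qed.

Lemma cos_upper y : 0 <= y <= 3 -> cos y <= 1 - y ^ 2 / 18.
Proof.
  intros Hy. assert (HP := PI2_3_2). assert (H := sin_half_lower y ltac:(lra)).
  replace y with (2 * (y / 2)) at 1 by field. rewrite cos_2a_sin. nra.
Qed.

Lemma cos_lower y : 0 <= y -> 1 - y ^ 2 / 2 <= cos y.
Proof.
  intros Hy. replace y with (2 * (y / 2)) at 2 by field. rewrite cos_2a_sin.
  assert (H : Rabs (sin (y / 2)) <= y / 2).
  { destruct (MVT_gen sin 0 (y/2) cos) as (c & Hc & E).
    + intros; auto_derive; auto; ring.
    + intros. apply continuity_sin.
    + rewrite sin_0, !Rminus_0_r in E. rewrite E, Rabs_mult, (Rabs_pos_eq (y/2)) by lra.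
      assert (Rabs (cos c) <= 1) by apply Rabs_le, COS_bound. nra. }
  apply Rabs_le_between in H. nra.
Qed.

(** The powers cos^M(h (ln k - ln n)) are multipliers of mass 1, equal to 1 at k = n and tending to
    0 at every other k <= X. Letting M grow isolates [a n], as a mean over the whole line would. *)
Lemma coef_bound a X K n : (1 <= n <= X)%nat ->
  (forall t, Cmod (osc a X t) <= K) -> Cmod (a n) <= K.
Proof.
  intros Hn H. assert (HX := ln_INR_nonneg X ltac:(lia)).
  (* This scale brings all differences of logarithms into [-1, 1], where the cosine equals 1 only at
     0. *)
  set (h := / (1 + ln (INR X))).
  assert (Hh : 0 < h) by pos.
  set (c := fun k => Rabs (cos (h * (ln (INR k) - ln (INR n))))).
  assert (Hc : forall k, (1 <= k <= X)%nat -> k <> n -> 0 <= c k < 1).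
  { intros k Hk Hkn. split. apply Rabs_pos. unfold c.
    set (y := Rabs (h * (ln (INR k) - ln (INR n)))).
    assert (E : cos (h * (ln (INR k) - ln (INR n))) = cos y).
    { unfold y, Rabs. destruct Rcase_abs; auto. now rewrite cos_neg. }
    assert (Hy : 0 < y <= 1).
    { unfold y. split.
      - apply Rabs_pos_lt. apply Rmult_integral_contrapositive; split. lra.
        intros E'. apply Hkn. apply ln_INR_inj; try lia. lra.
      - rewrite Rabs_mult, (Rabs_pos_eq h) by lra.
        assert (Rabs (ln (INR k) - ln (INR n)) <= 1 + ln (INR X)).
        { assert (H1 := ln_INR_nonneg k ltac:(lia)). assert (H2 := ln_INR_nonneg n ltac:(lia)).
          assert (H3 := ln_INR_le k X ltac:(lia)). assert (H4 := ln_INR_le n X ltac:(lia)).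
          apply Rabs_le_between; lra. }
        apply Rle_trans with (h * (1 + ln (INR X))). apply Rmult_le_compat_l; lra.
        unfold h. right; field; lra. }
    rewrite E. assert (H1 := cos_upper y ltac:(lra)). assert (H2 := cos_lower y ltac:(lra)).
    rewrite Rabs_pos_eq; nra. }
  apply le_of_lt_all. intros eta He.
  destruct (rsum_pow_small (fun k => if (k =? n)%nat then 0 else Cmod (a k)) (fun k => if (k =? n)%nat then 0 else c k) X eta He) as (M & HM).
  { intros k Hk. destruct (Nat.eqb_spec k n). lra. now apply Hc. }
  specialize (HM M (le_n _)).
  assert (Hm := multiplier_pow h _ M ltac:(lra) (multiplier_cos h (ln (INR n)) h ltac:(lra)) X a K ltac:(intros; apply H)).
  rewrite Rmult_1_l in Hm.
  set (g := fun k => (a k * RtoC (cos (h * (ln (INR k) - ln (INR n)))) ^ M)%C) in *.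
  assert (E : a n = (csum g X - csum (fun k => if (k =? n)%nat then RtoC 0 else g k) X)%C).
  { rewrite <- csum_minus, (csum_ext _ (fun k => if (k =? n)%nat then a n else RtoC 0)).
    now rewrite csum_single. intros k Hk. destruct (Nat.eqb_spec k n) as [->|].
    - unfold g. rewrite Rminus_eq_0, Rmult_0_r, cos_0, Cpow_1_l. ring.
    - ring. }
  rewrite E. apply Cmod_minus_le_trans.
  apply Rplus_le_compat; auto. eapply Rle_trans; [|exact HM].
  apply Cmod_csum_le. intros k Hk. destruct (Nat.eqb_spec k n).
  rewrite Cmod_0; lra. unfold g. rewrite Cmod_mult, Cmod_pow, Cmod_R. unfold c. lra.
Qed.

Lemma Abel_increasing (f : nat -> C) (w : nat -> R) B n :
  (forall k, (1 <= k <= n)%nat -> Cmod (csum f k) <= B) ->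
  (forall k, (1 <= k < n)%nat -> w k <= w (S k)) ->
  (1 <= n)%nat -> 0 <= w 1%nat ->
  Cmod (csum (fun k => RtoC (w k) * f k)%C n) <= 2 * w n * B.
Proof.
  intros Hf Hw Hn Hw1. destruct n as [|n]; [lia|]. clear Hn.
  (* The boundary term w_n S_n is kept apart, so that each step adds only (w_(n+1) - w_n) B to the
     error. *)
  assert (H : Cmod (csum (fun k => RtoC (w k) * f k)%C (S n) - RtoC (w (S n)) * csum f (S n))%C <= (w (S n) - w 1%nat) * B /\ w 1%nat <= w (S n)).
  { induction n.
    - simpl. split; [|lra]. replace (0 + w 1%nat * f 1%nat - w 1%nat * (0 + f 1%nat))%C with (RtoC 0) by ring.
      rewrite Cmod_0. lra.
    - destruct IHn as (IH & IH'). intros; apply Hf; lia. intros; apply Hw; lia.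
      assert (Hs := Hw (S n) ltac:(lia)). split; [|lra].
      change (csum (fun k => RtoC (w k) * f k)%C (S (S n))) with
        (csum (fun k => RtoC (w k) * f k)%C (S n) + RtoC (w (S (S n))) * f (S (S n)))%C.
      change (csum f (S (S n))) with (csum f (S n) + f (S (S n)))%C.
      match goal with |- Cmod ?z <= _ => replace z with
        ((csum (fun k => RtoC (w k) * f k)%C (S n) - RtoC (w (S n)) * csum f (S n))
         + RtoC (w (S n) - w (S (S n))) * csum f (S n))%C by (rewrite RtoC_minus; ring) end.
      apply Cmod_triangle_le. rewrite Cmod_mult, Cmod_R.
      rewrite <- Rabs_Ropp, Rabs_pos_eq by lra.
      assert (- (w (S n) - w (S (S n))) * Cmod (csum f (S n)) <= - (w (S n) - w (S (S n))) * B).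
      { apply Rmult_le_compat_l. lra. apply Hf; lia. }
      lra. }
  destruct H as [H H'].
  eapply Rle_trans. apply (Cmod_le_minus _ (RtoC (w (S n)) * csum f (S n))%C).
  rewrite Cmod_mult, Cmod_R, Rabs_pos_eq by lra.
  assert (w (S n) * Cmod (csum f (S n)) <= w (S n) * B).
  { apply Rmult_le_compat_l. lra. apply Hf; lia. }
  assert (0 <= B). { eapply Rle_trans. apply Cmod_ge_0. apply (Hf 1%nat); lia. }
  nra.
Qed.

Lemma ln_lower u : 0 < u -> 1 - / u <= ln u.
Proof.
  intros Hu. assert (H := exp_ineq1_le (ln (/ u))). rewrite exp_ln in H by now pos.
  rewrite ln_Rinv in H by auto. lra.
Qed.

Lemma ln_upper u : 0 < u -> ln u <= u - 1.
Proof. intros Hu. assert (H := exp_ineq1_le (ln u)). rewrite exp_ln in H by auto. lra. Qed.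

Lemma harmonic_bound J : (1 <= J)%nat -> rsum (fun j => / INR j) J <= 1 + ln (INR J).
Proof.
  intros H. induction H.
  - simpl. rewrite ln_1. lra.
  - cbn [rsum]. assert (0 < INR m) by pos.
    assert (L := ln_lower (INR (S m) / INR m)). rewrite S_INR in *.
    assert (0 < (INR m + 1) / INR m) by pos.
    specialize (L H1). rewrite ln_div in L by lra.
    replace (1 - / ((INR m + 1) / INR m)) with (/ (INR m + 1)) in L by (field; lra). lra.
Qed.

Lemma nat_ceil x : 0 <= x -> exists n : nat, x <= INR n <= x + 1.
Proof.
  intros Hx. destruct (archimed x) as [H1 H2]. exists (Z.to_nat (up x)).
  rewrite INR_IZR_INZ, Z2Nat.id. lra.
  apply le_IZR. lra.
Qed.

(** * Truncation of Dirichlet polynomials *)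

Lemma one_minus_half_exp u : 0 <= u <= 1 -> exp (- u) <= 1 - u / 2.
Proof.
  intros Hu. rewrite exp_Ropp. assert (H := exp_ineq1_le u).
  apply Rle_trans with (/ (1 + u)). apply Rinv_le_contravar; lra.
  apply Rmult_le_reg_l with (1 + u). lra. rewrite Rinv_r by lra. nra.
Qed.

Lemma exp_pow x n : exp x ^ n = exp (INR n * x).
Proof.
  induction n. simpl. now rewrite Rmult_0_l, exp_0.
  rewrite <- tech_pow_Rmult, IHn, S_INR, <- exp_plus. f_equal; ring.
Qed.

(** A true Gaussian would come from a measure of unbounded support, so V n = cos(h/2 ln n)^(2M) with
    h^2 = c/M takes its place. M >= c l^2 keeps the argument below 1/2 up to X, where the cosine
    lies between two exponentials of its squared argument; M stays below (c + 1) l^2, which bounds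
    the support. *)
Lemma gaussian_multiplier c X : 0 < c -> (1 <= X)%nat -> exists V : nat -> R,
  multiplier 1 ((c + 1) * (1 + ln (INR X)) ^ 2) (fun n => RtoC (V n)) /\
  (forall n, (1 <= n <= X)%nat -> exp (- (c * ln (INR n) ^ 2 / 2)) <= V n <= exp (- (c * ln (INR n) ^ 2 / 36))) /\
  (forall n m, (1 <= n <= m)%nat -> (m <= X)%nat -> V m <= V n).
Proof.
  intros Hc HX. set (l := 1 + ln (INR X)).
  assert (Hl : 1 <= l) by (assert (H := ln_INR_nonneg X HX); unfold l; lra).
  assert (Hl2 : 1 <= l ^ 2) by nra.
  destruct (nat_ceil (c * l ^ 2)) as (M & HM1 & HM2). nra.
  assert (HM : 0 < INR M) by nra.
  set (h := sqrt (c / INR M)).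
  assert (Hcm : 0 < c / INR M) by pos.
  assert (Hh : 0 < h) by (apply sqrt_lt_R0; auto).
  assert (Hh2 : h ^ 2 = c / INR M).
  { unfold h. simpl. rewrite Rmult_1_r. apply sqrt_sqrt. lra. }
  assert (Hhl : h * l <= 1).
  { apply Rnot_lt_le. intros H. assert (1 < (h * l) ^ 2) by nra.
    rewrite Rpow_mult_distr, Hh2 in H0.
    assert (c / INR M * l ^ 2 <= 1). { apply Rmult_le_reg_r with (INR M); auto.
      replace (c / INR M * l ^ 2 * INR M) with (c * l ^ 2) by (field; lra). lra. }
    lra. }
  assert (Hh1 : h <= 1) by nra.
  set (y := fun n => h / 2 * ln (INR n)).
  assert (Hy : forall n, (1 <= n <= X)%nat -> 0 <= y n <= / 2).
  { intros n Hn. unfold y. assert (H := ln_INR_nonneg n ltac:(lia)). assert (H' := ln_INR_le n X ltac:(lia)).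
    split. pos.
    assert (h * ln (INR n) <= h * l) by (apply Rmult_le_compat_l; unfold l; lra). lra. }
  assert (HI : INR (2 * M) = 2 * INR M) by (rewrite mult_INR; simpl; ring).
  assert (Hy2 : forall n, 2 * INR M * y n ^ 2 = c * ln (INR n) ^ 2 / 2).
  { intros n. unfold y. replace (2 * INR M * (h / 2 * ln (INR n)) ^ 2) with (INR M / 2 * h ^ 2 * ln (INR n) ^ 2) by field.
    rewrite Hh2. field. lra. }
  exists (fun n => cos (y n) ^ (2 * M)). split; [|split].
  - apply (multiplier_ext _ _ (fun n => RtoC (cos (h / 2 * (ln (INR n) - 0))) ^ (2 * M))%C).
    { intros n _. rewrite RtoC_pow, Rminus_0_r. reflexivity. }
    apply (multiplier_mono 1 1 (INR (2 * M) * (h / 2))).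
    pos. lra.
    fold l. rewrite HI. nra.
    apply multiplier_pow. lra. apply multiplier_cos. lra.
  - intros n Hn. specialize (Hy n Hn). specialize (Hy2 n). split.
    + replace (- (c * ln (INR n) ^ 2 / 2)) with (INR (2 * M) * (- (y n ^ 2))) by (rewrite HI; lra).
      rewrite <- exp_pow. apply pow_incr. split. left; apply exp_pos.
      eapply Rle_trans; [apply one_minus_half_exp; nra|]. apply cos_lower; lra.
    + replace (- (c * ln (INR n) ^ 2 / 36)) with (INR (2 * M) * (- (y n ^ 2 / 18))) by (rewrite HI; lra).
      rewrite <- exp_pow. apply pow_incr. split.
      assert (H := cos_lower (y n) ltac:(lra)). nra.
      eapply Rle_trans; [apply cos_upper; lra|].
      assert (H := exp_ineq1_le (- (y n ^ 2 / 18))). lra.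
  - intros n m Hn Hm. assert (H1 := Hy n ltac:(lia)). assert (H2 := Hy m ltac:(lia)).
    assert (H3 := ln_INR_le n m Hn). assert (HP := PI2_3_2).
    apply pow_incr. split. assert (H := cos_lower (y m) ltac:(lra)). nra.
    apply cos_decr_1; try lra. unfold y. apply Rmult_le_compat_l; lra.
Qed.

(** The mass is the sum of the amplitudes 1/j, the support is governed by the highest frequency J
    h. *)
Lemma multiplier_sawtooth J h l T : (1 <= J)%nat -> 0 <= h -> INR J * h <= T ->
  multiplier (1 + ln (INR J)) T (fun n => RtoC (sawtooth J (h * (ln (INR n) - l)))).
Proof.
  intros HJ Hh HT. assert (HJ' := pos_INR J).
  assert (0 <= T) by nra.
  apply (multiplier_mono (rsum (fun j => / INR j) J) _ T); try lra. now apply harmonic_bound.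
  unfold sawtooth.
  apply (multiplier_rsum (fun j => / INR j) T (fun j n => sin (INR j * (h * (ln (INR n) - l))) / INR j)); auto.
  intros j Hj. assert (0 < INR j) by pos. assert (INR j <= INR J) by (apply le_INR; lia).
  apply (multiplier_ext _ _ (fun n => RtoC (/ INR j) * RtoC (sin (INR j * h * (ln (INR n) - l))))%C).
  { intros n _. rewrite <- RtoC_mult. f_equal. unfold Rdiv. rewrite Rmult_comm. f_equal. f_equal. ring. }
  replace (/ INR j) with (Cmod (RtoC (/ INR j)) * 1) at 1.
  apply multiplier_scal, multiplier_sin. split. nra. nra.
  rewrite Cmod_RtoC_nonneg. ring. left; now pos.
Qed.

(** A rescaled square wave with its jump between ln n0 and ln(n0 + 1). An accuracy exp(-2Y) takes
    about N Y exp(2Y) frequencies, but the mass is only their logarithm, hence linear in ln N and Y.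
    T is uniform in n0, since all cutoffs n0 <= N are used together in a partial summation. *)
Lemma step_multiplier N Y : (1 <= N)%nat -> ln (INR N) <= Y -> exists T, 0 <= T /\
  forall n0, (1 <= n0 <= N)%nat -> exists U : nat -> R,
  multiplier (8 + ln (INR N) + 3 * Y) T (fun n => RtoC (U n)) /\
  forall n, (1 <= n)%nat -> ln (INR n) <= Y ->
    Rabs (U n - (if (n <=? n0)%nat then 1 else 0)) <= exp (- (2 * Y)).
Proof.
  intros HN HY. assert (HL := ln_INR_nonneg N HN). set (L := ln (INR N)) in *.
  assert (HN1 : 1 <= INR N) by (apply (le_INR 1); lia).
  assert (EN : exp L = INR N) by (apply exp_ln; lra).
  (* The square wave error 15/(J h x) must be at most exp(-2Y) for x as small as 1/(4N), with h =
     1/(Y + 1): hence 15 * 4 = 60. *)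
  set (E := 60 * INR N * (Y + 1) * exp (2 * Y)).
  assert (He := exp_ineq1_le (2 * Y)).
  assert (HE : 1 <= E). { unfold E. assert (1 <= INR N * (Y + 1)) by nra. nra. }
  destruct (nat_ceil E ltac:(lra)) as (J & HJ1 & HJ2).
  assert (HJ : (1 <= J)%nat). { apply INR_le. simpl. lra. }
  assert (HlJ : ln (INR J) <= 6 + L + 3 * Y).
  { apply Rle_trans with (ln (exp (6 + L + 3 * Y))); [|rewrite ln_exp; lra].
    apply ln_le. lra. apply Rle_trans with (61 * (INR N * exp Y * exp (2 * Y))).
    - assert (Y + 1 <= exp Y) by (assert (H := exp_ineq1_le Y); lra).
      assert (INR N * (Y + 1) <= INR N * exp Y) by (apply Rmult_le_compat_l; lra).
      assert (INR N * (Y + 1) * exp (2 * Y) <= INR N * exp Y * exp (2 * Y)) by (apply Rmult_le_compat_r; lra).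
      assert (1 <= INR N * exp Y * exp (2 * Y)). {
        assert (1 <= INR N * (Y + 1)) by nra.
        assert (1 <= INR N * (Y + 1) * exp (2 * Y)) by nra. lra. }
      unfold E in HJ2. lra.
    - replace (6 + L + 3 * Y) with (6 + (L + (Y + 2 * Y))) by ring.
      rewrite (exp_plus 6), (exp_plus L), (exp_plus Y), EN.
      assert (0 < INR N * (exp Y * exp (2 * Y))) by pos.
      assert (61 <= exp 6). { replace 6 with (1+1+1+1+1+1) by ring. rewrite !exp_plus.
        assert (H1 := exp_ineq1 1 ltac:(lra)). set (x := exp 1) in *.
        assert (8 < x*x*x) by nra.
        nra. }
      nra. }
  (* Keeps h |ln n - l| at most 1, inside the range 3/2 where the square wave estimate holds. *)
  set (h := / (Y + 1)). assert (Hh : 0 < h) by pos.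
  assert (HhY : h * (Y + 1) = 1) by (unfold h; field; lra).
  assert (Hh1 : h <= 1) by nra.
  assert (HP := PI2_3_2).
  exists (2 * INR J). split. assert (H := pos_INR J); lra.
  (* Halfway between n0 and n0 + 1, so every ln n is at distance at least 1/(4N) from the jump. *)
  intros n0 Hn0. set (l := ln (INR n0 + / 2)).
  assert (HN0 : 1 <= INR n0) by (apply (le_INR 1); lia).
  assert (HN0N : INR n0 <= INR N) by (apply le_INR; lia).
  exists (fun n => / 2 - 2 / PI * square_wave J (h * (ln (INR n) - l))). split.
  - assert (HT : forall k, 0 <= k <= 2 * h -> INR J * k <= 2 * INR J).
    { intros k Hk. assert (INR J * k <= INR J * 2) by (apply Rmult_le_compat_l; [apply pos_INR|lra]). lra. }
    assert (M1 := multiplier_sawtooth J h l (2 * INR J) HJ ltac:(lra) ltac:(apply HT; lra)).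
    assert (M2 := multiplier_sawtooth J (2 * h) l (2 * INR J) HJ ltac:(lra) ltac:(apply HT; lra)).
    assert (Hln := ln_INR_nonneg J HJ).
    apply (multiplier_ext _ _ (fun n => RtoC (/ 2) + (RtoC (- (2 / PI)) * RtoC (sawtooth J (h * (ln (INR n) - l)))
             + RtoC (/ PI) * RtoC (sawtooth J (2 * h * (ln (INR n) - l)))))%C).
    { intros n _. rewrite <- !RtoC_mult, <- !RtoC_plus. f_equal. unfold square_wave.
      rewrite Rmult_assoc. field. lra. }
    apply (multiplier_mono (/ 2 + (2 / PI * (1 + ln (INR J)) + / PI * (1 + ln (INR J)))) _ (2 * INR J)).
    assert (H := pos_INR J); lra.
    2: lra.
    + assert (3 / PI <= 1). { apply Rmult_le_reg_r with PI. lra. unfold Rdiv. rewrite Rmult_assoc, Rinv_l by lra. lra. }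
      replace (2 / PI * (1 + ln (INR J)) + / PI * (1 + ln (INR J))) with (3 / PI * (1 + ln (INR J))) by (field; lra).
      assert (3 / PI * (1 + ln (INR J)) <= 1 * (1 + ln (INR J))) by (apply Rmult_le_compat_r; lra). lra.
    + apply multiplier_plus. apply multiplier_const. assert (H := pos_INR J); lra. apply Cmod_RtoC_nonneg; lra.
      assert (0 < / PI) by pos.
      apply multiplier_plus.
      replace (2 / PI * (1 + ln (INR J))) with (Cmod (RtoC (- (2 / PI))) * (1 + ln (INR J))). now apply multiplier_scal.
      rewrite Cmod_R, Rabs_Ropp, Rabs_pos_eq. ring. unfold Rdiv; lra.
      replace (/ PI * (1 + ln (INR J))) with (Cmod (RtoC (/ PI)) * (1 + ln (INR J))). now apply multiplier_scal.
      rewrite Cmod_RtoC_nonneg; lra.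
  - intros n Hn HnY.
    assert (Hn1 : 1 <= INR n) by (apply (le_INR 1); lia).
    assert (Hl0 : 0 <= l). { unfold l. rewrite <- ln_1. apply ln_le; lra. }
    assert (Hl1 : l <= Y + 1).
    { apply Rle_trans with (ln (INR N * 2)). apply ln_le; lra. rewrite ln_mult by lra.
      assert (H := ln_upper 2 ltac:(lra)). fold L. lra. }
    assert (Hn2 := ln_INR_nonneg n Hn).
    assert (KEY : forall x, / (4 * INR N) <= x <= Y + 1 ->
      2 / PI * Rabs (square_wave J (h * x) - PI / 4) <= exp (- (2 * Y))).
    { intros x Hx.
      assert (0 < / (4 * INR N)) by pos.
      assert (Hhx : 0 < h * x <= 3 / 2) by nra.
      assert (HS := square_wave_approx J (h * x) Hhx).
      apply Rle_trans with (1 * (15 / ((INR J + 1) * (h * x)))).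
      { apply Rmult_le_compat; auto. pos. apply Rabs_pos.
        apply Rmult_le_reg_r with PI. lra. unfold Rdiv. rewrite Rmult_assoc, Rinv_l by lra. lra. }
      rewrite exp_Ropp, Rmult_1_l.
      assert (0 < exp (2 * Y)) by lra.
      assert (Hden : 15 * exp (2 * Y) <= (INR J + 1) * (h * x)).
      { apply Rle_trans with (E * (h * / (4 * INR N))).
        - unfold E, h. right. field. lra.
        - apply Rmult_le_compat. lra. pos. lra. apply Rmult_le_compat_l; lra. }
      apply Rmult_le_reg_r with ((INR J + 1) * (h * x)). lra.
      unfold Rdiv. rewrite Rmult_assoc, Rinv_l by lra.
      apply Rmult_le_reg_l with (exp (2 * Y)); auto. match goal with |- _ <= ?x * (/ ?x * ?D) => replace (x * (/ x * D)) with D by (field; lra) end. lra. }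
    destruct (Nat.leb_spec n n0) as [H|H].
    + assert (Hx : / (4 * INR N) <= l - ln (INR n)).
      { assert (INR n <= INR n0) by (apply le_INR; lia).
        assert (ln (INR n) <= ln (INR n0)) by (apply ln_le; lra).
        assert (H2 := ln_lower ((INR n0 + / 2) / INR n0) ltac:(pos)).
        rewrite ln_div in H2 by lra. fold l in H2.
        assert (/ (4 * INR N) <= 1 - / ((INR n0 + / 2) / INR n0)); [|lra].
        replace (1 - / ((INR n0 + / 2) / INR n0)) with (/ (2 * (INR n0 + / 2))) by (field; lra).
        apply Rinv_le_contravar; lra. }
      specialize (KEY (l - ln (INR n)) ltac:(lra)).
      replace (h * (ln (INR n) - l)) with (- (h * (l - ln (INR n)))) by ring.
      rewrite square_wave_odd.
      replace (/ 2 - 2 / PI * - square_wave J (h * (l - ln (INR n))) - 1) with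
        (2 / PI * (square_wave J (h * (l - ln (INR n))) - PI / 4)) by (field; lra).
      rewrite Rabs_mult, (Rabs_pos_eq (2 / PI)); auto. pos.
    + assert (Hx : / (4 * INR N) <= ln (INR n) - l).
      { assert (INR (S n0) <= INR n) by (apply le_INR; lia). rewrite S_INR in H0.
        assert (ln (INR n0 + 1) <= ln (INR n)) by (apply ln_le; lra).
        assert (H2 := ln_lower ((INR n0 + 1) / (INR n0 + / 2)) ltac:(pos)).
        rewrite ln_div in H2 by lra. fold l in H2.
        assert (/ (4 * INR N) <= 1 - / ((INR n0 + 1) / (INR n0 + / 2))); [|lra].
        replace (1 - / ((INR n0 + 1) / (INR n0 + / 2))) with (/ (2 * (INR n0 + 1))) by (field; lra).
        apply Rinv_le_contravar; lra. }
      specialize (KEY (ln (INR n) - l) ltac:(lra)).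
      replace (/ 2 - 2 / PI * square_wave J (h * (ln (INR n) - l)) - 0) with
        (- (2 / PI * (square_wave J (h * (ln (INR n) - l)) - PI / 4))) by (field; lra).
      rewrite Rabs_Ropp, Rabs_mult, (Rabs_pos_eq (2 / PI)); auto. pos.
Qed.

(* The Gaussian multiplier V makes the terms with ln n >> ln N negligible and is
   at least N^(-delta/2) up to N; a step multiplier U then cuts the sum at n0,
   and V is removed by partial summation.  The bound does not depend on X. *)
Lemma sum_truncation delta : 0 < delta -> exists C, 0 < C /\
  forall N, (1 <= N)%nat -> exists T0, 0 <= T0 /\
  forall X a K, (N <= X)%nat ->
  (forall t, Rabs t <= T0 * (1 + ln (INR X)) ^ 2 -> Cmod (osc a X t) <= K) ->
  (forall n, (1 <= n <= X)%nat -> Cmod (a n) <= K) ->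
  Cmod (csum a N) <= C * exp (delta * ln (INR N)) * K.
Proof.
  intros Hd.
  (* With c = delta/L, ln n > B L gives c ln n >= 144, so that V n <= exp(-c (ln n)^2 / 36) is below
     n^(-2). *)
  set (B := 144 / delta). assert (HB : 0 < B) by pos.
  set (C := 2 * (26 + 3 * (4 + 3 * B) * (2 / delta))).
  assert (Hd2 : 0 < 2 / delta) by pos.
  assert (HC : 2 <= C) by (unfold C; assert (0 < (4 + 3 * B) * (2 / delta)) by (pos); lra).
  exists C. split. lra. intros N HN.
  (* N = 1 is set apart because L = ln N is a denominator below. *)
  destruct (Nat.eq_dec N 1) as [->|HN1].
  { exists 0. split. lra. intros X a K HX _ Ha. simpl. rewrite ln_1, Rmult_0_r, exp_0.
    replace (0 + a 1%nat)%C with (a 1%nat) by ring.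
    assert (H := Ha 1%nat ltac:(lia)). assert (H' := Cmod_ge_0 (a 1%nat)). nra. }
  set (L := ln (INR N)).
  assert (HL : 0 < L). { unfold L. rewrite <- ln_1. apply ln_increasing. lra. apply (lt_INR 1). lia. }
  set (Y := B * L). assert (HY : 0 < Y) by pos.
  set (Y' := Y + L).
  destruct (step_multiplier N Y' HN) as (TU & HTU & HU). unfold Y'; fold L; lra.
  (* Chosen so that c L^2 / 2 = delta L / 2, which gives 1 / V N <= N^(delta/2). *)
  set (c := delta / L). assert (Hc : 0 < c) by pos.
  exists (c + 1 + TU). split. lra. intros X a K HX Hosc Ha.
  assert (HK : 0 <= K) by (eapply Rle_trans; [apply Cmod_ge_0|apply (Ha 1%nat); lia]).
  assert (HlX := ln_INR_nonneg X ltac:(lia)).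
  destruct (gaussian_multiplier c X Hc ltac:(lia)) as (V & HVm & HV & HVd).
  set (k := 8 + L + 3 * Y').
  assert (Hk : 0 < k) by (unfold k, Y'; lra).
  assert (HV0 : forall n, (1 <= n <= X)%nat -> 0 < V n <= 1).
  { intros n Hn. destruct (HV n Hn) as [H1 H2]. split. eapply Rlt_le_trans; [apply exp_pos|exact H1].
    eapply Rle_trans. apply H2. rewrite <- exp_0. apply exp_le.
    assert (0 <= c * ln (INR n) ^ 2) by pos. lra. }
  assert (HW : forall n0, (1 <= n0 <= N)%nat -> Cmod (csum (fun n => a n * RtoC (V n))%C n0) <= (3 * k + 2) * K).
  { intros n0 Hn0. destruct (HU n0 Hn0) as (U & HUm & HUe).
    assert (HUb : forall n, (1 <= n)%nat -> Rabs (U n) <= k).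
    { intros n Hn. rewrite <- Cmod_R. apply (multiplier_bound _ _ _ n Hn HUm). }
    assert (Hprod := multiplier_mult _ _ _ _ _ _ HVm HUm X a K).
    assert (HP : Cmod (csum (fun n => a n * (RtoC (V n) * RtoC (U n)))%C X) <= 1 * k * K).
    { apply Hprod. intros t Ht. apply Hosc. eapply Rle_trans. exact Ht. nra. }
    clear Hprod.
    rewrite <- (csum_trunc _ n0 X) by lia.
    (* The error terms are O(n^(-2)) in both ranges: for ln n <= Y' because the step is accurate to
       exp(-2Y'), beyond because V is small and U bounded by its mass. Hence the bound is
       independent of X. *)
    set (e := fun n => (a n * RtoC (V n) * RtoC (U n - (if (n <=? n0)%nat then 1 else 0)))%C).
    rewrite (csum_ext _ (fun n => a n * (RtoC (V n) * RtoC (U n)) - e n)%C).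
    2:{ intros n Hn. unfold e. destruct (Nat.leb_spec n n0); rewrite RtoC_minus; ring. }
    rewrite csum_minus. apply Cmod_minus_le_trans.
    assert (He : Cmod (csum e X) <= rsum (fun n => K * (k + 1) * / (INR n * INR n)) X).
    { apply Cmod_csum_le. intros n Hn. unfold e. rewrite !Cmod_mult, Rmult_assoc.
      assert (Hn0' : 0 < INR n) by pos.
      assert (Hsq : / (INR n * INR n) = exp (- (2 * ln (INR n)))).
      { rewrite exp_Ropp. f_equal. replace (2 * ln (INR n)) with (ln (INR n) + ln (INR n)) by ring.
        rewrite exp_plus, exp_ln by auto. reflexivity. }
      rewrite Rmult_assoc. apply Rmult_le_compat. apply Cmod_ge_0.
      pos. apply Ha; lia.
      rewrite !Cmod_R. specialize (HV0 n ltac:(lia)). rewrite (Rabs_pos_eq (V n)) by lra.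
      destruct (Rle_lt_dec (ln (INR n)) Y') as [Hs|Hs].
      - apply Rle_trans with (1 * / (INR n * INR n)).
        apply Rmult_le_compat; try lra. apply Rabs_pos.
        eapply Rle_trans. apply HUe; auto; lia. rewrite Hsq. apply exp_le. lra.
        apply Rmult_le_compat_r. left. pos. lra.
      - rewrite Rmult_comm. apply Rmult_le_compat; try lra. apply Rabs_pos.
        unfold Rminus. eapply Rle_trans. apply Rabs_triang. apply Rplus_le_compat. apply HUb; lia.
        rewrite Rabs_Ropp. destruct (n <=? n0)%nat; rewrite ?Rabs_R1, ?Rabs_R0; lra.
        rewrite Hsq. eapply Rle_trans. apply HV; lia. apply exp_le.
        assert (c * B * L = 144) by (unfold c, B; field; split; lra).
        assert (B * L < ln (INR n)) by (unfold Y', Y in Hs; lra).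
        assert (144 <= c * ln (INR n)) by nra.
        nra. }
    rewrite rsum_scal in He. assert (Hb := rsum_inv_sq X).
    assert (K * (k + 1) * rsum (fun k0 : nat => / (INR k0 * INR k0)) X <= K * (k + 1) * 2).
    { apply Rmult_le_compat_l; auto. pos. }
    lra. }
  rewrite (csum_ext a (fun n => RtoC (/ V n) * (a n * RtoC (V n)))%C).
  2:{ intros n Hn. specialize (HV0 n ltac:(lia)). rewrite RtoC_inv by lra. field.
      intros E. apply RtoC_inj in E. lra. }
  eapply Rle_trans.
  { apply (Abel_increasing (fun n => a n * RtoC (V n))%C (fun n => / V n) ((3 * k + 2) * K) N); auto.
    - intros n Hn. apply Rinv_le_contravar. apply HV0; lia. apply HVd; lia.
    - left. apply Rinv_0_lt_compat, HV0. lia. }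
  assert (HVN : / V N <= exp (delta * L / 2)).
  { destruct (HV N ltac:(lia)) as [H _]. rewrite <- (Ropp_involutive (delta * L / 2)), exp_Ropp.
    apply Rinv_le_contravar. apply exp_pos. eapply Rle_trans; [|exact H]. apply exp_le.
    fold L. unfold c. right. field. lra. }
  (* Half of the exponent delta pays for 1 / V N, the other half absorbs the mass, which is linear
     in L. *)
  assert (He1 : L <= 2 / delta * exp (delta * L / 2)).
  { assert (H := exp_ineq1_le (delta * L / 2)).
    apply Rle_trans with (2 / delta * (delta * L / 2)). right; field; lra. apply Rmult_le_compat_l; lra. }
  assert (He2 : 1 <= exp (delta * L / 2)).
  { rewrite <- exp_0. apply exp_le. assert (0 < delta * L) by pos. lra. }
  set (E := exp (delta * L / 2)) in *.
  assert (HEE : exp (delta * L) = E * E) by (unfold E; rewrite <- exp_plus; f_equal; field).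
  rewrite HEE.
  assert (H1 : 2 * (3 * k + 2) <= C * E).
  { unfold k, Y', Y, C.
    assert ((3 * B + 4) * L <= (3 * B + 4) * (2 / delta * E)) by (apply Rmult_le_compat_l; lra).
    clear - H He2. set (D := 2 / delta) in *. clearbody D E B L.
    replace (2 * (3 * (8 + L + 3 * (B * L + L)) + 2)) with (52 + 6 * ((3 * B + 4) * L)) by ring.
    replace (2 * (26 + 3 * (4 + 3 * B) * D) * E) with (52 * E + 6 * ((3 * B + 4) * (D * E))) by ring. lra. }
  assert (0 <= / V N) by (left; apply Rinv_0_lt_compat, HV0; lia).
  replace (2 * / V N * ((3 * k + 2) * K)) with (/ V N * (2 * (3 * k + 2)) * K) by ring.
  apply Rmult_le_compat_r; auto. replace (C * (E * E)) with (E * (C * E)) by ring.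
  apply Rmult_le_compat; auto. unfold k, Y' in *. lra.
Qed.

(** * Bohr's theorem *)

Lemma dirichlet_partial_sum_csum a n s : dirichlet_partial_sum a n s = csum (dirichlet_term a s) n.
Proof.
  unfold dirichlet_partial_sum. induction n.
  - rewrite sum_n_m_zero by lia. reflexivity.
  - rewrite sum_n_Sm by lia. rewrite IHn. reflexivity.
Qed.

Lemma Cmod_nat_Cpow k s : Cmod (nat_Cpow k s) = exp (Re s * ln (INR k)).
Proof. unfold nat_Cpow. rewrite Cmod_Cexp. f_equal. unfold Re, Im, RtoC; simpl. ring. Qed.

Lemma nat_Cpow_plus k s w : nat_Cpow k (s + w) = (nat_Cpow k s * nat_Cpow k w)%C.
Proof. unfold nat_Cpow. rewrite <- Cexp_plus. f_equal. ring. Qed.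

Lemma nat_Cpow_1 s : nat_Cpow 1 s = RtoC 1.
Proof. unfold nat_Cpow. simpl INR. rewrite ln_1. rewrite Cmult_0_r. apply Cexp_0. Qed.

Lemma nat_Cpow_mul j k s : (1 <= j)%nat -> (1 <= k)%nat -> nat_Cpow (j * k) s = (nat_Cpow j s * nat_Cpow k s)%C.
Proof.
  intros Hj Hk. unfold nat_Cpow. rewrite <- Cexp_plus. f_equal.
  rewrite mult_INR, ln_mult, RtoC_plus by (apply lt_0_INR; lia). ring.
Qed.

Lemma nat_Cpow_neq_0 k s : nat_Cpow k s <> RtoC 0.
Proof. apply Cexp_neq_0. Qed.

Lemma nat_Cpow_RtoC k x : nat_Cpow k (RtoC x) = RtoC (exp (x * ln (INR k))).
Proof. unfold nat_Cpow. now rewrite <- RtoC_mult, Cexp_RtoC. Qed.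

Lemma nat_Cpow_opp k s : (nat_Cpow k s * nat_Cpow k (- s))%C = RtoC 1.
Proof. rewrite <- nat_Cpow_plus. replace (s + - s)%C with (RtoC 0) by ring. unfold nat_Cpow. rewrite Cmult_0_l. apply Cexp_0. Qed.

Lemma nat_Cpow_vertical k s t :
  nat_Cpow k (- (s + (0, t))) = (nat_Cpow k (- s) * cis (- (t * ln (INR k))))%C.
Proof.
  replace (- (s + (0, t)))%C with (- s + (0, (- t)%R))%C.
  rewrite nat_Cpow_plus. f_equal. unfold nat_Cpow. rewrite <- Cexp_cis. f_equal.
  unfold Cmult, RtoC; simpl. f_equal; ring.
  apply injective_projections; simpl; ring.
Qed.

Lemma osc_dirichlet a s X t : osc (dirichlet_term a s) X t = csum (dirichlet_term a (s + (0, t))) X.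
Proof. apply csum_ext. intros k _. unfold dirichlet_term. rewrite nat_Cpow_vertical. ring. Qed.

Lemma dirichlet_term_shift a s w k :
  dirichlet_term a (s + w) k = (nat_Cpow k (- w) * dirichlet_term a s k)%C.
Proof.
  unfold dirichlet_term. replace (- (s + w))%C with (- s + - w)%C by ring. rewrite nat_Cpow_plus. ring.
Qed.

(** The balls of the uniform structure on C are squares, comparable with discs up to a factor sqrt 2
    < 2. *)
Lemma locally_C (x : C) (P : C -> Prop) :
  @locally (NormedModule.UniformSpace C_AbsRing C_NormedModule) x P <->
  exists eta, 0 < eta /\ forall y, Cmod (y - x) < eta -> P y.
Proof.
  split.
  - intros [eps H]. exists eps. split. apply cond_pos. intros y Hy. apply H.
    apply C_NormedModule_mixin_compat1. exact Hy.
  - intros (eta & He & H). assert (0 < eta / 2) by lra. exists (mkposreal _ H0). intros y Hy. apply H.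
    eapply Rlt_le_trans. apply (C_NormedModule_mixin_compat2 x y (mkposreal _ H0)). exact Hy.
    simpl. assert (sqrt 2 <= 2). { rewrite <- (sqrt_Rsqr 2) at 2 by lra. apply sqrt_le_1; unfold Rsqr; lra. }
    nra.
Qed.

Lemma filterlim_C (u : nat -> C) (l : C) :
  filterlim u eventually (@locally (NormedModule.UniformSpace C_AbsRing C_NormedModule) l) <->
  (forall eta, 0 < eta -> exists N, forall n, (N <= n)%nat -> Cmod (u n - l) < eta).
Proof.
  split.
  - intros H eta He. apply (H (fun y => Cmod (y - l) < eta)). apply locally_C. exists eta. auto.
  - intros H P HP. apply locally_C in HP. destruct HP as (eta & He & HP).
    destruct (H eta He) as (N & HN). exists N. intros n Hn. apply HP, HN, Hn.
Qed.

Lemma cauchy_limit (u : nat -> C) :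
  (forall eta, 0 < eta -> exists N, forall n m, (N <= n)%nat -> (N <= m)%nat -> Cmod (u n - u m) < eta) ->
  exists l, forall eta, 0 < eta -> exists N, forall n, (N <= n)%nat -> Cmod (u n - l) < eta.
Proof.
  intros H.
  assert (H1 : ex_finite_lim_seq (fun n => Re (u n))).
  { apply ex_lim_seq_cauchy_corr. intros eps. destruct (H eps (cond_pos eps)) as (N & HN).
    exists N. intros n m Hn Hm. eapply Rle_lt_trans; [|apply (HN n m Hn Hm)].
    replace (Re (u n) - Re (u m)) with (Re (u n - u m)%C) by reflexivity. apply re_le_Cmod. }
  assert (H2 : ex_finite_lim_seq (fun n => Im (u n))).
  { apply ex_lim_seq_cauchy_corr. intros eps. destruct (H eps (cond_pos eps)) as (N & HN).
    exists N. intros n m Hn Hm. eapply Rle_lt_trans; [|apply (HN n m Hn Hm)].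
    replace (Im (u n) - Im (u m)) with (Im (u n - u m)%C) by reflexivity.
    eapply Rle_trans; [|apply Rmax_Cmod]. apply Rmax_r. }
  destruct H1 as [l1 H1], H2 as [l2 H2]. exists (l1, l2).
  intros eta He. apply is_lim_seq_spec in H1, H2.
  assert (He2 : 0 < eta / 2) by lra.
  destruct (H1 (mkposreal _ He2)) as [N1 HN1], (H2 (mkposreal _ He2)) as [N2 HN2]. simpl in *.
  exists (max N1 N2). intros n Hn.
  eapply Rle_lt_trans. apply Cmod_2Rmax. simpl.
  specialize (HN1 n ltac:(lia)). specialize (HN2 n ltac:(lia)).
  assert (sqrt 2 < 2). { rewrite <- (sqrt_Rsqr 2) at 2 by lra. apply sqrt_lt_1; unfold Rsqr; lra. }
  assert (Rmax (Rabs (fst (u n) + - l1)) (Rabs (snd (u n) + - l2)) < eta / 2) by (apply Rmax_lub_lt; auto).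
  assert (0 <= Rmax (Rabs (fst (u n) + - l1)) (Rabs (snd (u n) + - l2))).
  { eapply Rle_trans; [|apply Rmax_l]. apply Rabs_pos. }
  nra.
Qed.

Definition cv_C0 (a : nat -> C) (f : C -> C) : Prop :=
  forall s, half_plane 0 s -> forall eta, 0 < eta -> exists N, forall n, (N <= n)%nat ->
    Cmod (csum (dirichlet_term a s) n - f s) < eta.

Lemma cv_C0_iff a f : cv_C0 a f <-> forall s, half_plane 0 s ->
  filterlim (fun n => dirichlet_partial_sum a n s) eventually (@locally C_NormedModule (f s)).
Proof.
  split; intros H s Hs.
  - apply filterlim_C. intros eta He. destruct (H s Hs eta He) as (N & HN). exists N.
    intros n Hn. rewrite dirichlet_partial_sum_csum. auto.
  - intros eta He. destruct (proj1 (filterlim_C _ _) (H s Hs) eta He) as (N & HN). exists N.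
    intros n Hn. rewrite <- dirichlet_partial_sum_csum. auto.
Qed.

Lemma convergent_bounded (u : nat -> C) l :
  (forall eta, 0 < eta -> exists N, forall n, (N <= n)%nat -> Cmod (u n - l) < eta) ->
  exists B, 0 < B /\ forall n, Cmod (u n) <= B.
Proof.
  intros H. destruct (H 1 Rlt_0_1) as (N & HN).
  exists (1 + Cmod l + rsum (fun k => Cmod (u k)) N + Cmod (u 0%nat)).
  assert (H0 := Cmod_ge_0 l). assert (H1 := Cmod_ge_0 (u 0%nat)).
  assert (Hs : forall M, 0 <= rsum (fun k => Cmod (u k)) M) by (intros; apply rsum_nonneg; intros; apply Cmod_ge_0).
  split. specialize (Hs N). lra.
  intros n. destruct (le_lt_dec N n).
  - specialize (HN n l0). assert (H2 := Cmod_le_minus (u n) l). specialize (Hs N). lra.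
  - destruct n. specialize (Hs N). lra.
    assert (Cmod (u (S n)) <= rsum (fun k => Cmod (u k)) N).
    { assert (Hle : (S n <= N)%nat) by lia. clear - Hle. induction N. lia. cbn [rsum]. destruct (Nat.eq_dec (S N) (S n)) as [E|E].
      - injection E as ->. assert (0 <= rsum (fun k => Cmod (u k)) n) by (apply rsum_nonneg; intros; apply Cmod_ge_0). lra.
      - specialize (IHN ltac:(lia)). assert (H := Cmod_ge_0 (u (S N))). lra. }
    lra.
Qed.

Lemma csum_by_parts_tail (f w : nat -> C) N M : (N <= M)%nat ->
  (csum (fun k => w k * f k) M - csum (fun k => w k * f k) N =
   w (S M) * csum f M - w (S N) * csum f N
   + (csum (fun k => (w k - w (S k)) * csum f k) M - csum (fun k => (w k - w (S k)) * csum f k) N))%C.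
Proof. intros H. induction H. ring. cbn [csum].
  match goal with |- (?A + ?b - ?B = _)%C => replace (A + b - B)%C with (A - B + b)%C by ring end.
  rewrite IHle. ring. Qed.

Lemma csum_tail_le (f : nat -> C) (g : nat -> R) N M : (N <= M)%nat ->
  (forall k, (N < k <= M)%nat -> Cmod (f k) <= g k - g (S k)) ->
  Cmod (csum f M - csum f N) <= g (S N) - g (S M).
Proof.
  intros H. induction H; intros Hf.
  - replace (csum f N - csum f N)%C with (RtoC 0) by ring. rewrite Cmod_0. lra.
  - cbn [csum]. replace (csum f m + f (S m) - csum f N)%C with (csum f m - csum f N + f (S m))%C by ring.
    apply Cmod_triangle_le.
    specialize (IHle ltac:(intros; apply Hf; lia)). specialize (Hf (S m) ltac:(lia)). lra.
Qed.

(** Integrating |z| exp(-Re z u) over [ln k, ln(k+1)], rather than bounding it by its maximum, keeps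
    a right-hand side that telescopes in k. *)
Lemma nat_Cpow_difference k z : (1 <= k)%nat -> 0 < Re z ->
  Cmod (nat_Cpow k (- z) - nat_Cpow (S k) (- z)) <=
  Cmod z / Re z * (exp (- Re z * ln (INR k)) - exp (- Re z * ln (INR (S k)))).
Proof.
  intros Hk Hz. rewrite Cmod_minus_sym.
  assert (Hln := ln_INR_le k (S k) ltac:(lia)).
  set (al := ln (INR k)) in *. set (be := ln (INR (S k))) in *.
  assert (H : Cmod (Cexp (RtoC be * - z) - Cexp (RtoC al * - z)) <=
    - (Cmod z / Re z) * exp (- Re z * be) - (- (Cmod z / Re z) * exp (- Re z * al))).
  { apply (mean_value_inequality (fun u => Cexp (RtoC u * - z)) (fun u => - z * Cexp (RtoC u * - z))%C
      (fun u => - (Cmod z / Re z) * exp (- Re z * u)) (fun u => Cmod z * exp (- Re z * u))); auto.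
    intros t Ht. split; [|split].
    - apply rderiv_Cexp.
    - auto_derive; auto. field. lra.
    - rewrite Cmod_mult, Cmod_opp, Cmod_Cexp. right. f_equal. f_equal. unfold Re, RtoC; simpl. ring. }
  unfold nat_Cpow. fold al be. rewrite !(Cmult_comm (- z)).
  eapply Rle_trans. apply H. right. ring.
Qed.

(** Abel summation from the point eps/2, where the partial sums are bounded. The error grows with
    |s|, so this is not yet uniform convergence; it serves only on vertical segments of length
    polynomial in ln N. *)
Lemma partial_sum_growth a f eps : cv_C0 a f -> 0 < eps -> exists D, 0 < D /\
  forall s N, eps <= Re s -> (1 <= N)%nat ->
  Cmod (csum (dirichlet_term a s) N - f s) <= D * (1 + Cmod s) * exp (- (eps / 2) * ln (INR N)).
Proof.
  intros Hcv He. set (s0 := RtoC (eps / 2)).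
  assert (Hs0 : half_plane 0 s0) by pos.
  destruct (convergent_bounded _ _ (Hcv s0 Hs0)) as (B & HB0 & HB).
  assert (HD : 0 < 2 / eps) by pos.
  exists (B * (3 + 2 / eps)). split. pos.
  intros s N Hs HN. apply le_of_lt_all. intros eta Heta.
  assert (Hs' : half_plane 0 s) by (unfold half_plane; lra).
  destruct (Hcv s Hs' eta Heta) as (M0 & HM0). set (M := max M0 N).
  specialize (HM0 M ltac:(lia)).
  set (z := (s - s0)%C). assert (Hz : Re z = Re s - eps / 2) by (unfold z, s0, Re, RtoC; simpl; ring).
  set (x := Re z) in *. assert (Hx : eps / 2 <= x) by lra.
  assert (Hzs : Cmod z / x <= (2 / eps) * Cmod s + 1).
  { apply Rmult_le_reg_r with x. lra. unfold Rdiv at 1. rewrite Rmult_assoc, Rinv_l, Rmult_1_r by lra.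
    assert (Cmod z <= Cmod s + eps / 2). { unfold z. apply Cmod_minus_le_trans. unfold s0. rewrite Cmod_RtoC_nonneg; lra. }
    assert (Cmod s <= 2 / eps * Cmod s * x).
    { replace (Cmod s) with (2 / eps * Cmod s * (eps / 2)) at 1 by (field; lra).
      apply Rmult_le_compat_l; auto. pos. }
    lra. }
  set (w := fun k => nat_Cpow k (- z)).
  set (W := fun k => exp (- x * ln (INR k))).
  assert (Hww : forall k, Cmod (w k) = W k).
  { intros k. unfold w, W. rewrite Cmod_nat_Cpow. reflexivity. }
  assert (HWd : forall k m, (1 <= k <= m)%nat -> W m <= W k).
  { intros k m Hkm. apply exp_le. assert (H := ln_INR_le k m Hkm). nra. }
  assert (E : forall n, csum (dirichlet_term a s) n = csum (fun k => w k * dirichlet_term a s0 k)%C n).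
  { intros n. apply csum_ext. intros k _. unfold w. rewrite <- dirichlet_term_shift. f_equal. unfold z. ring. }
  assert (Hdiff : Cmod (csum (dirichlet_term a s) M - csum (dirichlet_term a s) N) <= B * (2 + Cmod z / x) * W N).
  { rewrite !E, csum_by_parts_tail by lia.
    assert (H1 := csum_tail_le (fun k => (w k - w (S k)) * csum (dirichlet_term a s0) k)%C
       (fun k => B * (Cmod z / x) * W k) N M ltac:(lia)).
    assert (Hzx : 0 <= Cmod z / x) by pos.
    apply Cmod_triangle_le.
    apply Rle_trans with ((W N * B + W N * B) + B * (Cmod z / x) * W N); [|right; ring].
    apply Rplus_le_compat.
    - apply Cmod_minus_le_trans. rewrite !Cmod_mult, !Hww.
      apply Rplus_le_compat; apply Rmult_le_compat; auto; try apply Cmod_ge_0; try (left; apply exp_pos); apply HWd; lia.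
    - eapply Rle_trans. apply H1.
      + intros k Hk. rewrite Cmod_mult.
        assert (H2 := nat_Cpow_difference k z ltac:(lia) ltac:(fold x; lra)). fold x in H2. fold (W k) (W (S k)) (w k) (w (S k)) in H2.
        apply Rle_trans with (Cmod z / x * (W k - W (S k)) * B); [|right; ring].
        apply Rmult_le_compat; auto; apply Cmod_ge_0.
      + assert (H2 : B * (Cmod z / x) * W (S N) <= B * (Cmod z / x) * W N).
        { apply Rmult_le_compat_l. pos. apply HWd; lia. }
        assert (0 <= B * (Cmod z / x) * W (S M)) by pos.
        lra. }
  replace (csum (dirichlet_term a s) N - f s)%C with
    (- (csum (dirichlet_term a s) M - csum (dirichlet_term a s) N) + (csum (dirichlet_term a s) M - f s))%C by ring.
  apply Cmod_triangle_le. rewrite Cmod_opp. apply Rplus_le_compat; [|lra].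
  eapply Rle_trans. apply Hdiff.
  assert (HWN : W N <= exp (- (eps / 2) * ln (INR N))).
  { apply exp_le. assert (H := ln_INR_nonneg N HN). nra. }
  apply Rmult_le_compat; auto.
  - pos. assert (0 <= Cmod z / x) by pos. lra.
  - left; apply exp_pos.
  - rewrite Rmult_assoc. apply Rmult_le_compat_l. lra. assert (H := Cmod_ge_0 s). nra.
Qed.

(* Once the partial sums up to k are O(k^delta), shifting by [2 delta] gives uniform convergence. *)
Lemma Abel_shift (f : nat -> C) P delta N M : 0 < delta -> (1 <= N <= M)%nat ->
  (forall k, (1 <= k)%nat -> Cmod (csum f k) <= P * exp (delta * ln (INR k))) ->
  Cmod (csum (fun k => nat_Cpow k (- RtoC (2 * delta)) * f k)%C M -
        csum (fun k => nat_Cpow k (- RtoC (2 * delta)) * f k)%C N) <= 4 * P * exp (- delta * ln (INR N)).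
Proof.
  intros Hd HNM Hf.
  assert (HP : 0 <= P).
  { specialize (Hf 1%nat ltac:(lia)). simpl INR in Hf. rewrite ln_1, Rmult_0_r, exp_0 in Hf.
    assert (H := Cmod_ge_0 (csum f 1)). lra. }
  set (v := fun k => exp (- delta * ln (INR k))).
  assert (Hv : forall k, 0 < v k) by (intros; apply exp_pos).
  assert (Hvd : forall k m, (1 <= k <= m)%nat -> v m <= v k).
  { intros k m Hkm. apply exp_le. assert (H := ln_INR_le k m Hkm). nra. }
  assert (Hiv : forall k, exp (delta * ln (INR k)) * v k = 1).
  { intros k. unfold v. rewrite <- exp_plus. replace (delta * ln (INR k) + - delta * ln (INR k)) with 0 by ring. apply exp_0. }
  set (w := fun k => nat_Cpow k (- RtoC (2 * delta))).
  assert (Hw : forall k, w k = RtoC (v k * v k)).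
  { intros k. unfold w, v. rewrite <- RtoC_opp, nat_Cpow_RtoC, <- exp_plus. f_equal. f_equal. ring. }
  change (Cmod (csum (fun k => w k * f k)%C M - csum (fun k => w k * f k)%C N) <= 4 * P * v N).
  rewrite csum_by_parts_tail by lia.
  apply Cmod_triangle_le.
  assert (Hb : forall k m, (1 <= k <= m)%nat -> Cmod (w m * csum f k) <= P * v m).
  { intros k m Hkm. rewrite Cmod_mult, Hw, Cmod_RtoC_nonneg by (pos).
    specialize (Hf k ltac:(lia)). specialize (Hvd k m Hkm).
    apply Rle_trans with (v m * v m * (P * exp (delta * ln (INR k)))).
    apply Rmult_le_compat_l; auto. pos.
    replace (v m * v m * (P * exp (delta * ln (INR k)))) with (P * v m * (exp (delta * ln (INR k)) * v m)) by ring.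
    rewrite <- (Rmult_1_r (P * v m)) at 2. apply Rmult_le_compat_l. pos.
    rewrite <- (Hiv k). apply Rmult_le_compat_l; auto. left; apply exp_pos. }
  assert (H1 := csum_tail_le (fun k => (w k - w (S k)) * csum f k)%C (fun k => 2 * P * v k) N M ltac:(lia)).
  apply Rle_trans with ((P * v N + P * v N) + 2 * P * v N); [|right; ring].
  apply Rplus_le_compat.
  - apply Cmod_minus_le_trans. apply Rplus_le_compat.
    + eapply Rle_trans. apply Hb; lia. apply Rmult_le_compat_l; auto. apply Hvd; lia.
    + eapply Rle_trans. apply Hb; lia. apply Rmult_le_compat_l; auto. apply Hvd; lia.
  - eapply Rle_trans. apply H1.
    + intros k Hk. rewrite Cmod_mult, !Hw, <- RtoC_minus, Cmod_R.
      assert (Hk1 := Hvd k (S k) ltac:(lia)). assert (Hk3 := Hv (S k)).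
      rewrite Rabs_pos_eq by nra.
      apply Rle_trans with ((v k * v k - v (S k) * v (S k)) * (P * exp (delta * ln (INR k)))).
      apply Rmult_le_compat_l. nra. apply Hf; lia.
      assert (Hi := Hiv k). set (e := exp (delta * ln (INR k))) in *.
      (* Since e v_k = 1 and e v_(k+1) <= 1, the term is at most 2 P (v_k - v_(k+1)), which
         telescopes. *)
      replace ((v k * v k - v (S k) * v (S k)) * (P * e)) with (P * (v k - v (S k)) * (e * v k + e * v (S k))) by ring.
      replace (2 * P * v k - 2 * P * v (S k)) with (P * (v k - v (S k)) * 2) by ring.
      apply Rmult_le_compat_l. pos.
      nra.
    + assert (Hk1 := Hvd N (S N) ltac:(lia)). assert (0 < v (S M)) by pos.
      assert (0 <= P * v (S M)) by pos.
      assert (P * v (S N) <= P * v N) by (apply Rmult_le_compat_l; lra). lra.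
Qed.

(** Over heights up to T (1 + ln X)^2 the error of [partial_sum_growth] is a polynomial in ln X
    times a negative power of X, hence at most 1 for suitable large X. *)
Lemma power_beats_log c D T : 0 < c -> forall X0 : nat, exists X, (X0 <= X)%nat /\ (1 <= X)%nat /\
  D * (1 + T * (1 + ln (INR X)) ^ 2) * exp (- c * ln (INR X)) <= 1.
Proof.
  intros Hc X0.
  set (A := Rabs D * (1 + Rabs T)).
  assert (HA : 0 <= A). { pos. assert (H := Rabs_pos T). lra. }
  (* with l = ln X, use exp (c l) >= (c l / 3)^3 *)
  destruct (nat_ceil (exp (1 + 54 * (A + 1) * (8 / (c * c * c)) ))) as (X1 & H1 & _). left; apply exp_pos.
  exists (max (max X0 X1) 3). split. lia. split. lia.
  set (X := max (max X0 X1) 3).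
  set (l := ln (INR X)).
  assert (Hq : 0 < 8 / (c * c * c)) by pos.
  assert (Hl : 1 + 54 * (A + 1) * (8 / (c * c * c)) <= l).
  { rewrite <- (ln_exp (1 + _)). apply ln_le. apply exp_pos. eapply Rle_trans. apply H1. apply le_INR. unfold X; lia. }
  assert (Hq1 : 0 <= 54 * (A + 1) * (8 / (c * c * c))) by pos.
  assert (Hexp : (c * l / 3) ^ 3 <= exp (c * l)).
  { replace (exp (c * l)) with (exp (c * l / 3) ^ 3). apply pow_incr. split.
    pos.
    assert (H := exp_ineq1_le (c * l / 3)). lra. rewrite exp_pow. f_equal. simpl; field. }
  replace (- c * l) with (- (c * l)) by ring. rewrite exp_Ropp.
  apply Rmult_le_reg_r with (exp (c * l)). apply exp_pos.
  rewrite Rmult_assoc, Rinv_l, Rmult_1_r, Rmult_1_l by (apply Rgt_not_eq, exp_pos).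
  eapply Rle_trans; [|exact Hexp].
  apply Rle_trans with (A * 4 * l ^ 2).
  - apply Rle_trans with (Rabs (D * (1 + T * (1 + l) ^ 2))). apply Rle_abs.
    rewrite Rabs_mult. unfold A. rewrite !Rmult_assoc. apply Rmult_le_compat_l. apply Rabs_pos.
    eapply Rle_trans. apply Rabs_triang. rewrite Rabs_R1, Rabs_mult, (Rabs_pos_eq ((1 + l) ^ 2)) by apply pow2_ge_0.
    assert (H := Rabs_pos T). assert ((1 + l) ^ 2 <= 4 * l ^ 2) by nra.
    nra.
  - replace ((c * l / 3) ^ 3) with (c * c * c / 27 * l * l ^ 2) by field.
    apply Rmult_le_compat_r. apply pow2_ge_0.
    apply Rle_trans with (c * c * c / 27 * (54 * (A + 1) * (8 / (c * c * c)))).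
    + replace (c * c * c / 27 * (54 * (A + 1) * (8 / (c * c * c)))) with (16 * (A + 1)) by (field; lra). lra.
    + apply Rmult_le_compat_l; [|lra]. pos.
Qed.

Definition bounded_halfplanes (f : C -> C) : Prop :=
  forall eps, 0 < eps -> exists M, forall s, half_plane eps s -> Cmod (f s) <= M.

Lemma half_plane_le eps eps' s : eps <= eps' -> half_plane eps' s -> half_plane eps s.
Proof. unfold half_plane; intros; lra. Qed.

Definition cvu_C0 (a : nat -> C) (f : C -> C) : Prop :=
  forall eps, 0 < eps -> dirichlet_cvu a f eps.

(** The sum up to N is a truncation of the sum up to a far larger X, which by the crude growth bound
    is within 1 of f at all heights that matter. So the sums up to N are O(N^e) uniformly in C_e,
    and a shift by 2e, with e = eps/4, turns this into uniform convergence in C_eps. *)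
Lemma bohr_uniform a f : cv_C0 a f -> bounded_halfplanes f ->
  cvu_C0 a f.
Proof.
  intros Hcv Hb eps He.
  set (e := eps / 4). assert (He0 : 0 < e) by pos.
  destruct (Hb e He0) as (Mf & HMf).
  destruct (partial_sum_growth a f e Hcv He0) as (D & HD & Hgr).
  destruct (sum_truncation e He0) as (C1 & HC1 & Htr).
  assert (Hse : half_plane 0 (RtoC e)) by pos.
  assert (Hterm : exists A, 0 < A /\ forall n, (1 <= n)%nat -> Cmod (dirichlet_term a (RtoC e) n) <= A).
  { destruct (convergent_bounded _ _ (Hcv _ Hse)) as (B & HB0 & HB). exists (2 * B). split. lra.
    intros [|n] Hn. lia. replace (dirichlet_term a (RtoC e) (S n)) with
      (csum (dirichlet_term a (RtoC e)) (S n) - csum (dirichlet_term a (RtoC e)) n)%C by (simpl; ring).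
    apply Cmod_minus_le_trans. assert (H1 := HB (S n)). assert (H2 := HB n). lra. }
  destruct Hterm as (A & HA & Hterm).
  set (K := Rabs Mf + 1 + A). assert (HMf0 := Rabs_pos Mf).
  assert (HS : forall s N, half_plane e s -> (1 <= N)%nat ->
     Cmod (csum (dirichlet_term a s) N) <= C1 * K * exp (e * ln (INR N))).
  { intros s N Hs HN. destruct (Htr N HN) as (T0 & HT0 & Htr').
    (* X depends on s, but the bound drawn from it does not. *)
    destruct (power_beats_log (e / 2) (D * (1 + Cmod s)) T0 ltac:(lra) N) as (X & HX1 & HX2 & HX).
    replace (C1 * K * exp (e * ln (INR N))) with (C1 * exp (e * ln (INR N)) * K) by ring.
    apply (Htr' X). lia.
    - intros t Ht.
      rewrite osc_dirichlet. set (s' := (s + (0, t))%C).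
      assert (HRe : Re s' = Re s) by (unfold s', Re; simpl; ring).
      assert (Hs' : half_plane e s') by (unfold half_plane; rewrite HRe; exact Hs).
      eapply Rle_trans. apply (Cmod_le_minus _ (f s')).
      assert (H1 := HMf s' Hs'). assert (H2 := Rle_abs Mf).
      assert (H3 : Cmod (csum (dirichlet_term a s') X - f s') <= 1).
      { eapply Rle_trans. apply Hgr; auto. unfold half_plane in Hs'. lra.
        eapply Rle_trans; [|exact HX].
        apply Rmult_le_compat_r. left; apply exp_pos.
        rewrite Rmult_assoc. apply Rmult_le_compat_l. lra.
        assert (Cmod s' <= Cmod s + Rabs t).
        { unfold s'. apply Cmod_triangle_le. apply Rplus_le_compat_l.
          unfold Cmod; simpl. right. rewrite Rmult_0_l, Rplus_0_l, Rmult_1_r. rewrite <- sqrt_Rsqr_abs. reflexivity. }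
        assert (H4 := Cmod_ge_0 s).
        assert (0 <= T0 * (1 + ln (INR X)) ^ 2) by pos.
        nra. }
      unfold K. lra.
    - intros n Hn. apply Rle_trans with A; [|unfold K; lra].
      eapply Rle_trans; [|apply (Hterm n); lia].
      unfold dirichlet_term. rewrite !Cmod_mult, !Cmod_nat_Cpow. apply Rmult_le_compat_l. apply Cmod_ge_0.
      apply exp_le. apply Rmult_le_compat_r. apply ln_INR_nonneg; lia.
      unfold half_plane in Hs. unfold Re, RtoC in *; simpl in *. lra. }
  set (P := C1 * K). assert (HP : 0 < P) by (apply Rmult_lt_0_compat; unfold K; lra).
  intros eta Heta.
  destruct (nat_ceil (exp (ln (16 * P / eta) / e))) as (N & HN & _). left; apply exp_pos.
  assert (H16 : 0 < 16 * P / eta) by pos.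
  assert (HN0 : 0 < INR N) by (eapply Rlt_le_trans; [apply exp_pos|exact HN]).
  assert (HN1 : (1 <= N)%nat) by (apply (INR_lt 0) in HN0; lia).
  exists N. intros n Hn s Hs. rewrite dirichlet_partial_sum_csum.
  assert (Hs0 : half_plane 0 s) by (unfold half_plane in *; lra).
  destruct (Hcv s Hs0 (eta / 4) ltac:(lra)) as (M0 & HM0). set (M := max M0 n).
  specialize (HM0 M ltac:(lia)).
  set (s' := (s - RtoC (2 * e))%C).
  assert (Hs' : half_plane e s') by (unfold half_plane, s', e, Re, RtoC in *; simpl; lra).
  assert (E : forall m, csum (dirichlet_term a s) m = csum (fun k => nat_Cpow k (- RtoC (2 * e)) * dirichlet_term a s' k)%C m).
  { intros m. apply csum_ext. intros k _. rewrite <- dirichlet_term_shift. f_equal. unfold s'. ring. }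
  assert (HA1 := Abel_shift (dirichlet_term a s') P e n M He0 ltac:(lia) (fun k Hk => HS s' k Hs' Hk)).
  rewrite <- !E in HA1.
  assert (Hsmall : 4 * P * exp (- e * ln (INR n)) <= eta / 4).
  { apply Rle_trans with (4 * P * exp (- e * (ln (16 * P / eta) / e))).
    - apply Rmult_le_compat_l. lra. apply exp_le.
      assert (ln (16 * P / eta) / e <= ln (INR n)).
      { rewrite <- (ln_exp (ln (16 * P / eta) / e)). apply ln_le. apply exp_pos. eapply Rle_trans. apply HN. apply le_INR; auto. }
      nra.
    - replace (- e * (ln (16 * P / eta) / e)) with (- ln (16 * P / eta)) by (field; lra).
      rewrite exp_Ropp, exp_ln by auto. right. field. lra. }
  replace (csum (dirichlet_term a s) n - f s)%C with
    (- (csum (dirichlet_term a s) M - csum (dirichlet_term a s) n) + (csum (dirichlet_term a s) M - f s))%C by ring.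
  eapply Rle_lt_trans. apply Cmod_triangle. rewrite Cmod_opp. lra.
Qed.

(** * Uniform limits of Dirichlet polynomials *)

(* [dpoly p p'] : p is a Dirichlet polynomial and p' its derivative. *)
Inductive dpoly : (C -> C) -> (C -> C) -> Prop :=
| dpoly_monomial c k : (1 <= k)%nat ->
    dpoly (fun s => c * nat_Cpow k (- s))%C (fun s => - RtoC (ln (INR k)) * (c * nat_Cpow k (- s)))%C
| dpoly_plus p p' q q' : dpoly p p' -> dpoly q q' ->
    dpoly (fun s => p s + q s)%C (fun s => p' s + q' s)%C
| dpoly_ext p p' q q' : (forall s, p s = q s) -> (forall s, p' s = q' s) -> dpoly p p' -> dpoly q q'.

Lemma dpoly_scal c p p' : dpoly p p' -> dpoly (fun s => c * p s)%C (fun s => c * p' s)%C.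
Proof.
  induction 1.
  - eapply dpoly_ext; [| |apply (dpoly_monomial (c * c0) k H)]; intros; simpl; ring.
  - eapply dpoly_ext; [| |apply (dpoly_plus _ _ _ _ IHdpoly1 IHdpoly2)]; intros; simpl; ring.
  - eapply dpoly_ext; [| |exact IHdpoly]; intros; simpl; now rewrite ?H, ?H0.
Qed.

Lemma dpoly_mult p p' q q' : dpoly p p' -> dpoly q q' ->
  dpoly (fun s => p s * q s)%C (fun s => p' s * q s + p s * q' s)%C.
Proof.
  intros Hp Hq. induction Hp.
  - induction Hq.
    + eapply dpoly_ext; [| |apply (dpoly_monomial (c * c0) (k * k0) ltac:(nia))]; intros; simpl;
        rewrite nat_Cpow_mul by auto.
      ring. rewrite mult_INR, ln_mult, RtoC_plus by (apply lt_0_INR; lia). ring.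
    + eapply dpoly_ext; [| |apply (dpoly_plus _ _ _ _ IHHq1 IHHq2)]; intros; simpl; ring.
    + eapply dpoly_ext; [| |exact IHHq]; intros; simpl; now rewrite ?H0, ?H1.
  - eapply dpoly_ext; [| |apply (dpoly_plus _ _ _ _ IHHp1 IHHp2)]; intros; simpl; ring.
  - eapply dpoly_ext; [| |exact IHHp]; intros; simpl; now rewrite ?H, ?H0.
Qed.

Lemma dpoly_minus p p' q q' : dpoly p p' -> dpoly q q' ->
  dpoly (fun s => p s - q s)%C (fun s => p' s - q' s)%C.
Proof.
  intros Hp Hq. eapply dpoly_ext; [| |apply (dpoly_plus _ _ _ _ Hp (dpoly_scal (-1) _ _ Hq))]; intros; simpl; ring.
Qed.

Lemma dpoly_csum a n : exists p', dpoly (fun s => csum (dirichlet_term a s) n) p'.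
Proof.
  induction n as [|n [p' IH]].
  - exists (fun s => - RtoC (ln (INR 1)) * (0 * nat_Cpow 1 (- s)))%C.
    eapply dpoly_ext; [| |apply (dpoly_monomial 0 1); lia]; intros; simpl; ring.
  - eexists. eapply dpoly_ext; [| |apply (dpoly_plus _ _ _ _ IH (dpoly_monomial (a (S n)) (S n) ltac:(lia)))];
    intros; reflexivity.
Qed.

Lemma dpoly_coefs p p' : dpoly p p' -> exists a X, (1 <= X)%nat /\
  forall n s, (X <= n)%nat -> csum (dirichlet_term a s) n = p s.
Proof.
  induction 1.
  - exists (fun j => if (j =? k)%nat then c else RtoC 0), k. split; auto.
    intros n s Hn. rewrite (csum_ext _ (fun j => if (j =? k)%nat then c * nat_Cpow k (- s) else RtoC 0)%C).
    apply csum_single; lia. intros j _. unfold dirichlet_term. destruct (Nat.eqb_spec j k). now subst. ring.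
  - destruct IHdpoly1 as (a & X & HX & Ha), IHdpoly2 as (b & Y & HY & Hb).
    exists (fun j => a j + b j)%C, (max X Y). split. lia. intros n s Hn.
    rewrite <- (Ha n s), <- (Hb n s), <- csum_plus by lia. apply csum_ext. intros; unfold dirichlet_term; ring.
  - destruct IHdpoly as (a & X & HX & Ha). exists a, X. split; auto. intros n s Hn. rewrite <- H. auto.
Qed.

Lemma dpoly_bounded p p' : dpoly p p' -> exists M, 0 < M /\ forall s, half_plane 0 s -> Cmod (p s) <= M.
Proof.
  induction 1.
  - assert (H0 := Cmod_ge_0 c). exists (Cmod c + 1). split. lra. intros s Hs.
    rewrite Cmod_mult, Cmod_nat_Cpow.
    assert (exp (Re (- s) * ln (INR k)) <= 1).
    { rewrite <- exp_0. apply exp_le. assert (H1 := ln_INR_nonneg k H). unfold half_plane, Re in *. simpl. nra. }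
    nra.
  - destruct IHdpoly1 as (M1 & H1 & B1), IHdpoly2 as (M2 & H2 & B2). exists (M1 + M2). split. lra.
    intros s Hs. apply Cmod_triangle_le. specialize (B1 s Hs). specialize (B2 s Hs). lra.
  - destruct IHdpoly as (M & H2 & B). exists M. split; auto. intros s Hs. rewrite <- H. auto.
Qed.

Definition approx (F : C -> C) : Prop :=
  forall eps eta, 0 < eps -> 0 < eta -> exists p p', dpoly p p' /\
  forall s, half_plane eps s -> Cmod (F s - p s) <= eta.

Lemma approx_bounded F : approx F -> bounded_halfplanes F.
Proof.
  intros H eps He. destruct (H eps 1 He Rlt_0_1) as (p & p' & Hp & Hpe).
  destruct (dpoly_bounded p p' Hp) as (M & HM & HB). exists (1 + M). intros s Hs.
  assert (H1 := Cmod_le_minus (F s) (p s)). specialize (Hpe s Hs).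
  specialize (HB s (half_plane_le 0 eps s ltac:(lra) Hs)). lra.
Qed.

Lemma approx_limit F :
  (forall eps eta, 0 < eps -> 0 < eta -> exists G, approx G /\
     forall s, half_plane eps s -> Cmod (F s - G s) <= eta) -> approx F.
Proof.
  intros H eps eta He Heta. destruct (H eps (eta / 2) He ltac:(lra)) as (G & HG & HFG).
  destruct (HG eps (eta / 2) He ltac:(lra)) as (p & p' & Hp & Hpe). exists p, p'. split; auto.
  intros s Hs. specialize (HFG s Hs). specialize (Hpe s Hs).
  replace (F s - p s)%C with ((F s - G s) + (G s - p s))%C by ring.
  apply Cmod_triangle_le. lra.
Qed.

Lemma approx_ext F G : eq_C0 F G -> approx F -> approx G.
Proof.
  intros E H. apply approx_limit. intros eps eta He Heta. exists F. split; auto. intros s Hs.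
  rewrite E. replace (G s - G s)%C with (RtoC 0) by ring. rewrite Cmod_0; lra.
  apply (half_plane_le 0 eps); auto; lra.
Qed.

Lemma approx_dpoly p p' : dpoly p p' -> approx p.
Proof.
  intros H eps eta He Heta. exists p, p'. split; auto. intros s Hs.
  replace (p s - p s)%C with (RtoC 0) by ring. rewrite Cmod_0; lra.
Qed.

Lemma approx_monomial c k : (1 <= k)%nat -> approx (fun s => c * nat_Cpow k (- s))%C.
Proof. intros H. eapply approx_dpoly, dpoly_monomial, H. Qed.

Lemma approx_nat_Cpow k : (1 <= k)%nat -> approx (fun s => nat_Cpow k (- s)).
Proof. intros H. eapply approx_ext; [|apply (approx_monomial 1 k H)]. intros s _; ring. Qed.

Lemma approx_const c : approx (fun _ => c).
Proof. eapply approx_ext; [|apply (approx_monomial c 1); lia]. intros s _. rewrite nat_Cpow_1; ring. Qed.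

Lemma approx_plus F G : approx F -> approx G -> approx (fun s => F s + G s)%C.
Proof.
  intros HF HG eps eta He Heta.
  destruct (HF eps (eta / 2) He ltac:(lra)) as (p & p' & Hp & Hpe).
  destruct (HG eps (eta / 2) He ltac:(lra)) as (q & q' & Hq & Hqe).
  exists (fun s => p s + q s)%C, (fun s => p' s + q' s)%C. split. now apply dpoly_plus.
  intros s Hs. specialize (Hpe s Hs). specialize (Hqe s Hs).
  replace (F s + G s - (p s + q s))%C with ((F s - p s) + (G s - q s))%C by ring.
  apply Cmod_triangle_le. lra.
Qed.

Lemma approx_mult F G : approx F -> approx G -> approx (fun s => F s * G s)%C.
Proof.
  intros HF HG eps eta He Heta.
  destruct (approx_bounded F HF eps He) as (M & HM).
  set (M' := Rabs M + 1). assert (HM' : 0 < M') by (assert (H := Rabs_pos M); unfold M'; lra).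
  assert (HMe : 0 < eta / 2 / M') by pos.
  destruct (HG eps (eta / 2 / M') He HMe) as (q & q' & Hq & Hqe).
  destruct (dpoly_bounded q q' Hq) as (B & HB & HBq).
  destruct (HF eps (eta / 2 / B) He ltac:(pos)) as (p & p' & Hp & Hpe).
  exists (fun s => p s * q s)%C, (fun s => p' s * q s + p s * q' s)%C. split. now apply dpoly_mult.
  intros s Hs. specialize (Hpe s Hs). specialize (Hqe s Hs). specialize (HM s Hs).
  specialize (HBq s (half_plane_le 0 eps s ltac:(lra) Hs)).
  replace (F s * G s - p s * q s)%C with (F s * (G s - q s) + (F s - p s) * q s)%C by ring.
  apply Cmod_triangle_le. rewrite !Cmod_mult.
  assert (Cmod (F s) <= M') by (unfold M'; assert (H := Rle_abs M); lra).
  assert (Cmod (F s) * Cmod (G s - q s) <= M' * (eta / 2 / M')) by (apply Rmult_le_compat; auto; apply Cmod_ge_0).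
  assert (Cmod (F s - p s) * Cmod (q s) <= (eta / 2 / B) * B) by (apply Rmult_le_compat; auto; apply Cmod_ge_0).
  replace (M' * (eta / 2 / M')) with (eta / 2) in H0 by (field; lra).
  replace (eta / 2 / B * B) with (eta / 2) in H1 by (field; lra). lra.
Qed.

Lemma approx_scal c F : approx F -> approx (fun s => c * F s)%C.
Proof. intros H. apply (approx_mult (fun _ => c)); auto. apply approx_const. Qed.

Lemma approx_minus F G : approx F -> approx G -> approx (fun s => F s - G s)%C.
Proof.
  intros HF HG. eapply approx_ext; [|apply (approx_plus _ _ HF (approx_scal (-1) _ HG))]. intros s _; ring.
Qed.

Lemma approx_pow F n : approx F -> approx (fun s => F s ^ n)%C.
Proof.
  intros H. induction n.
  - eapply approx_ext; [|apply (approx_const 1)]. intros s _; reflexivity.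
  - eapply approx_ext; [|apply (approx_mult _ _ H IHn)]. intros s _; reflexivity.
Qed.

Lemma approx_csum (F : nat -> C -> C) n : (forall k, approx (F k)) -> approx (fun s => csum (fun k => F k s) n).
Proof.
  intros H. induction n; simpl. apply approx_const. now apply approx_plus.
Qed.

Lemma approx_cvu a F : cvu_C0 a F -> approx F.
Proof.
  intros H eps eta He Heta. destruct (H eps He eta Heta) as (N & HN).
  destruct (dpoly_csum a N) as (p' & Hp). eexists _, p'. split. apply Hp.
  intros s Hs. specialize (HN N (le_n _) s Hs). rewrite dirichlet_partial_sum_csum in HN.
  rewrite Cmod_minus_sym. lra.
Qed.

Lemma Cpow_difference (a b : C) m n : 1 <= m -> Cmod a <= m -> Cmod b <= m ->
  Cmod (a ^ n - b ^ n) <= INR n * Cmod (a - b) * m ^ n.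
Proof.
  intros Hm Ha Hb. assert (H0 : forall k, 1 <= m ^ k) by (intros; now apply pow_R1_Rle).
  induction n.
  - simpl. replace (1 - 1)%C with (RtoC 0) by ring. rewrite Cmod_0. lra.
  - rewrite !Cpow_S. replace (a * a ^ n - b * b ^ n)%C with ((a - b) * a ^ n + b * (a ^ n - b ^ n))%C by ring.
    apply Cmod_triangle_le. rewrite !Cmod_mult, Cmod_pow, S_INR, <- tech_pow_Rmult.
    assert (H := Cmod_ge_0 (a - b)). assert (H1 := Cmod_ge_0 (a ^ n - b ^ n)). assert (H2 := Cmod_ge_0 b).
    assert (Cmod a ^ n <= m ^ n) by (apply pow_incr; split; [apply Cmod_ge_0|auto]).
    assert (Cmod (a - b) * Cmod a ^ n <= Cmod (a - b) * (m * m ^ n)).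
    { apply Rmult_le_compat_l; auto. specialize (H0 n). nra. }
    assert (Cmod b * Cmod (a ^ n - b ^ n) <= m * (INR n * Cmod (a - b) * m ^ n)) by (apply Rmult_le_compat; auto).
    lra.
Qed.

(** The approximation (1 + z/d)^d is built from sums and products only, under which [approx] is
    already known to be stable. *)
Lemma Cexp_compound z R0 d : (1 <= d)%nat -> 0 <= R0 -> R0 <= INR d -> Cmod z <= R0 ->
  Cmod (Cexp z - (1 + RtoC (/ INR d) * z) ^ d) <= 2 * R0 ^ 2 * exp R0 / INR d.
Proof.
  intros Hd HR HRd Hz. assert (Hd0 : 0 < INR d) by pos.
  assert (Hid : 0 < / INR d) by pos.
  set (w := (RtoC (/ INR d) * z)%C).
  assert (Hw : Cmod w <= R0 / INR d).
  { unfold w. rewrite Cmod_mult, Cmod_RtoC_nonneg by lra. unfold Rdiv. rewrite Rmult_comm. apply Rmult_le_compat_r; lra. }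
  assert (Hw1 : R0 / INR d <= 1). { apply Rmult_le_reg_r with (INR d); auto. unfold Rdiv. rewrite Rmult_assoc, Rinv_l by lra. lra. }
  replace (Cexp z) with (Cexp w ^ d)%C.
  2:{ rewrite Cexp_pow. f_equal. unfold w. rewrite Cmult_assoc, <- RtoC_mult, Rinv_r by lra. ring. }
  assert (H0w := Cmod_ge_0 w).
  set (m := exp (R0 / INR d)).
  assert (Hm : 1 <= m). { unfold m. rewrite <- exp_0. apply exp_le. pos. }
  eapply Rle_trans. apply (Cpow_difference _ _ m d Hm).
  - rewrite Cmod_Cexp. apply exp_le. eapply Rle_trans. apply Re_le_Cmod. exact Hw.
  - apply Cmod_triangle_le. rewrite Cmod_1. assert (H := exp_ineq1_le (R0 / INR d)). unfold m. lra.
  - replace (m ^ d) with (exp R0). 2:{ unfold m. rewrite exp_pow. f_equal. field. lra. }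
    assert (H := Cexp_linear w ltac:(lra)).
    replace (Cexp w - (1 + w))%C with (Cexp w - 1 - w)%C by ring.
    assert (Cmod (Cexp w - 1 - w) <= 2 * (R0 / INR d) ^ 2) by nra.
    replace (2 * R0 ^ 2 * exp R0 / INR d) with (INR d * (2 * (R0 / INR d) ^ 2) * exp R0) by (field; lra).
    apply Rmult_le_compat_r. left; apply exp_pos. apply Rmult_le_compat_l; lra.
Qed.

Lemma approx_Cexp F : approx F -> approx (fun s => Cexp (F s)).
Proof.
  intros H. apply approx_limit. intros eps eta He Heta.
  destruct (approx_bounded F H eps He) as (M & HM).
  set (R0 := Rabs M). assert (HR : 0 <= R0) by pos.
  set (K := 2 * R0 ^ 2 * exp R0).
  assert (HK : 0 <= K) by pos.
  assert (HKe : 0 <= K / eta) by pos.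
  destruct (nat_ceil (R0 + 1 + K / eta) ltac:(lra)) as (d & Hd & _).
  assert (Hd1 : (1 <= d)%nat). { apply INR_le. simpl. lra. }
  exists (fun s => (1 + RtoC (/ INR d) * F s) ^ d)%C. split.
  - apply approx_pow, approx_plus. apply approx_const. now apply approx_scal.
  - intros s Hs. eapply Rle_trans. apply (Cexp_compound _ R0 d Hd1 HR). lra.
    unfold R0. eapply Rle_trans. now apply HM. apply Rle_abs.
    fold K. apply Rmult_le_reg_r with (INR d). lra. unfold Rdiv. rewrite Rmult_assoc, Rinv_l by lra.
    replace (K * 1) with (eta * (K / eta)) by (field; lra). apply Rmult_le_compat_l; lra.
Qed.

(** On monomials, k^(-(c0 s + psi)) = (k^c0)^(-s) exp(-ln k psi), and k^c0 is again a natural number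
    because c0 is an integer. Uniform approximation on C_eps survives since the symbol maps C_eps
    into itself. *)
Lemma approx_comp F psi c0 : (1 <= c0)%nat -> approx psi -> maps_C0 psi -> approx F ->
  approx (fun s => F (RtoC (INR c0) * s + psi s)%C).
Proof.
  intros Hc0 Hpsi Hmap HF. apply approx_limit. intros eps eta He Heta.
  destruct (HF eps eta He Heta) as (p & p' & Hp & Hpe).
  exists (fun s => p (RtoC (INR c0) * s + psi s)%C). split.
  - clear Hpe. induction Hp.
    + apply approx_scal.
      eapply approx_ext; [|apply (approx_mult _ _ (approx_nat_Cpow (k ^ c0) ltac:(apply Nat.neq_0_lt_0, Nat.pow_nonzero; lia)) (approx_Cexp _ (approx_scal (- RtoC (ln (INR k))) _ Hpsi)))].
      intros s _. unfold nat_Cpow. rewrite <- Cexp_plus. f_equal.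
      rewrite pow_INR. replace (ln (INR k ^ c0)) with (INR c0 * ln (INR k)). rewrite RtoC_mult. ring.
      symmetry. apply ln_pow. apply lt_0_INR; lia.
    + now apply approx_plus.
    + eapply approx_ext; [|exact IHHp]. intros s _. apply H.
  - intros s Hs. apply Hpe. assert (H := Hmap s (half_plane_le 0 eps s ltac:(lra) Hs)).
    unfold half_plane, Re, RtoC in *. simpl.
    assert (1 <= INR c0) by (apply (le_INR 1); lia). nra.
Qed.

(** Cauchy's estimate for Dirichlet coefficients: on the line Re s = e the partial sums are
    uniformly close to f, and [coef_bound] applies to them. *)
Lemma cv_C0_coef_bound a f M eps : cvu_C0 a f -> 0 <= eps ->
  (forall s, half_plane eps s -> Cmod (f s) <= M) ->
  forall n e, (1 <= n)%nat -> eps < e -> Cmod (a n) <= M * exp (e * ln (INR n)).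
Proof.
  intros Hcvu He HM n e Hn Hee.
  assert (H : Cmod (dirichlet_term a (RtoC e) n) <= M).
  { apply le_of_lt_all. intros eta Heta.
    destruct (Hcvu ((eps + e) / 2) ltac:(lra) eta Heta) as (N & HN). set (X := max N n).
    apply (coef_bound _ X). lia. intros t.
    rewrite osc_dirichlet. set (s := (RtoC e + (0, t))%C).
    specialize (HN X ltac:(lia) s). rewrite dirichlet_partial_sum_csum in HN.
    assert (Re s = e) by (unfold s, Re, RtoC; simpl; ring).
    specialize (HN ltac:(unfold half_plane; lra)). specialize (HM s ltac:(unfold half_plane; lra)).
    assert (H1 := Cmod_le_minus (csum (dirichlet_term a s) X) (f s)). lra. }
  unfold dirichlet_term in H. rewrite Cmod_mult, Cmod_nat_Cpow in H.
  replace (Re (- RtoC e) * ln (INR n)) with (- (e * ln (INR n))) in H by (unfold Re, RtoC; simpl; ring).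
  rewrite exp_Ropp in H. apply Rmult_le_reg_r with (/ exp (e * ln (INR n))).
  pos. rewrite Rmult_assoc, Rinv_r by apply Rgt_not_eq, exp_pos. lra.
Qed.

Lemma choice_nat (A : Type) (P : nat -> A -> Prop) :
  (forall n, exists x, P n x) -> exists f : nat -> A, forall n, P n (f n).
Proof.
  intros H. exists (fun n => proj1_sig (constructive_indefinite_description _ (H n))).
  intros n. apply proj2_sig.
Qed.

Lemma inv_INR_S_pos k : 0 < / INR (S k).
Proof. pos. Qed.

Lemma inv_INR_S_small eta : 0 < eta -> exists k, forall l, (k <= l)%nat -> / INR (S l) < eta.
Proof.
  intros H. destruct (nat_ceil (/ eta)) as (k & Hk & _). left; now pos.
  exists k. intros l Hl. rewrite <- (Rinv_inv eta). apply Rinv_lt_contravar.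
  pos.
  apply Rle_lt_trans with (INR k); auto. apply lt_INR; lia.
Qed.

Lemma inv_INR_S_le k l : (k <= l)%nat -> / INR (S l) <= / INR (S k).
Proof. intros H. apply Rinv_le_contravar. apply lt_0_INR; lia. apply le_INR; lia. Qed.

Lemma dirichlet_coef_bound G X K e n : (1 <= n)%nat ->
  (forall s m, Re s = e -> (X <= m)%nat -> Cmod (csum (dirichlet_term G s) m) <= K) ->
  Cmod (dirichlet_term G (RtoC e) n) <= K.
Proof.
  intros Hn H. apply (coef_bound _ (max X n)). lia. intros t.
  rewrite osc_dirichlet. apply H. unfold Re, RtoC; simpl; ring. lia.
Qed.

Lemma dirichlet_term_minus a b s k :
  dirichlet_term (fun j => a j - b j)%C s k = (dirichlet_term a s k - dirichlet_term b s k)%C.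
Proof. unfold dirichlet_term. ring. Qed.

Lemma csum_limit (u : nat -> nat -> C) (v : nat -> C) N :
  (forall n, (1 <= n <= N)%nat -> forall eta, 0 < eta -> exists l0, forall l, (l0 <= l)%nat -> Cmod (v n - u l n) < eta) ->
  forall eta, 0 < eta -> exists l0, forall l, (l0 <= l)%nat -> Cmod (csum v N - csum (u l) N) < eta.
Proof.
  induction N; intros H eta He.
  - exists 0%nat. intros; simpl. replace (0 - 0)%C with (RtoC 0) by ring. rewrite Cmod_0; lra.
  - destruct (IHN ltac:(intros; apply H; auto; lia) (eta / 2) ltac:(lra)) as (l1 & H1).
    destruct (H (S N) ltac:(lia) (eta / 2) ltac:(lra)) as (l2 & H2).
    exists (max l1 l2). intros l Hl. cbn [csum].
    replace (csum v N + v (S N) - (csum (u l) N + u l (S N)))%C with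
      ((csum v N - csum (u l) N) + (v (S N) - u l (S N)))%C by ring.
    eapply Rle_lt_trans. apply Cmod_triangle. specialize (H1 l ltac:(lia)). specialize (H2 l ltac:(lia)). lra.
Qed.

(* Truncation bounds the partial sums of p_l - p_k uniformly in l, so they also
   control those of the coefficientwise limit minus p_k. *)
Lemma approx_dirichlet F : approx F -> exists a, cv_C0 a F.
Proof.
  intros HF.
  destruct (choice_nat ((nat -> C) * nat) (fun k aX => forall n s, (snd aX <= n)%nat -> half_plane (/ INR (S k)) s ->
     Cmod (F s - csum (dirichlet_term (fst aX) s) n) <= / INR (S k))) as (aX & HaX).
  { intros k. destruct (HF _ _ (inv_INR_S_pos k) (inv_INR_S_pos k)) as (p & p' & Hp & Hpe).
    destruct (dpoly_coefs _ _ Hp) as (a & X & _ & Ha). exists (a, X). simpl. intros n s Hn Hs. rewrite Ha; auto. }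
  set (A := fun k => fst (aX k)).
  assert (Hdiff : forall k l s m, (k <= l)%nat -> half_plane (/ INR (S k)) s -> (max (snd (aX k)) (snd (aX l)) <= m)%nat ->
    Cmod (csum (dirichlet_term (fun j => A l j - A k j)%C s) m) <= 2 * / INR (S k)).
  { intros k l s m Hkl Hs Hm. rewrite (csum_ext _ (fun j => dirichlet_term (A l) s j - dirichlet_term (A k) s j)%C)
      by (intros; apply dirichlet_term_minus).
    rewrite csum_minus.
    assert (H1 := HaX k m s ltac:(lia) Hs).
    assert (H2 := HaX l m s ltac:(lia) (half_plane_le _ _ s (inv_INR_S_le k l Hkl) Hs)).
    assert (H3 := inv_INR_S_le k l Hkl). fold (A l) in H2. fold (A k) in H1.
    replace (csum (dirichlet_term (A l) s) m - csum (dirichlet_term (A k) s) m)%C with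
      ((F s - csum (dirichlet_term (A k) s) m) - (F s - csum (dirichlet_term (A l) s) m))%C by ring.
    apply Cmod_minus_le_trans. lra. }
  assert (Hcoef : forall k l e n, (k <= l)%nat -> / INR (S k) < e -> (1 <= n)%nat ->
    Cmod (dirichlet_term (fun j => A l j - A k j)%C (RtoC e) n) <= 2 * / INR (S k)).
  { intros k l e n Hkl He Hn. apply (dirichlet_coef_bound _ (max (snd (aX k)) (snd (aX l))) _ _ _ Hn).
    intros s m Hs Hm. apply Hdiff; auto. unfold half_plane; lra. }
  assert (Hlim : forall n, exists b, (1 <= n)%nat -> forall eta, 0 < eta -> exists l0, forall l, (l0 <= l)%nat -> Cmod (A l n - b) < eta).
  { intros n. destruct (le_lt_dec 1 n) as [Hn|Hn].
    2:{ exists (RtoC 0). intros; lia. }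
    destruct (cauchy_limit (fun l => A l n)) as (b & Hb); [|exists b; auto].
    intros eta Heta.
    (* The abscissa 2 exceeds every 1/(k+1), so one line serves all k. *)
    set (w := nat_Cpow n (- RtoC 2)). assert (Hw : 0 < Cmod w) by (apply Cmod_gt_0, nat_Cpow_neq_0).
    assert (Hk1 : forall k l, (k <= l)%nat -> Cmod (A l n - A k n) * Cmod w <= 2 * / INR (S k)).
    { intros k l Hkl. rewrite <- Cmod_mult. unfold w. apply (Hcoef k l 2 n); auto.
      apply Rle_lt_trans with (/ 1); [|lra]. apply Rinv_le_contravar. lra. apply (le_INR 1); lia. }
    destruct (inv_INR_S_small (eta * Cmod w / 4)) as (k0 & Hk0).
    { pos. }
    exists k0. intros i j Hi Hj. specialize (Hk0 k0 (le_n _)).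
    assert (Hi' := Hk1 k0 i Hi). assert (Hj' := Hk1 k0 j Hj).
    replace (A i n - A j n)%C with ((A i n - A k0 n) - (A j n - A k0 n))%C by ring.
    eapply Rle_lt_trans. apply Cmod_minus_le.
    apply Rmult_lt_reg_r with (Cmod w); auto. lra. }
  destruct (choice_nat C _ Hlim) as (b & Hb).
  exists b. intros s Hs eta Heta. unfold half_plane in Hs.
  set (d := Re s / 4). assert (Hd : 0 < d) by (unfold d; lra).
  destruct (sum_truncation d Hd) as (C1 & HC1 & Htr).
  (* The error below is 8 C1 q from the Abel shift, 2 C1 q from its first term and q from the
     polynomial: in all less than (10 C1 + 2) q. *)
  destruct (inv_INR_S_small (Rmin (2 * d) (eta / (10 * C1 + 2)))) as (k & Hk).
  { pos. }
  specialize (Hk k (le_n _)). apply Rmin_Rgt_l in Hk. destruct Hk as [Hk1 Hk2]. apply Rgt_lt in Hk1, Hk2.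
  assert (Hk0 := inv_INR_S_pos k). set (q := / INR (S k)) in *.
  set (s' := (s - RtoC (2 * d))%C). assert (Hs' : Re s' = 2 * d) by (unfold s', d, Re, RtoC; simpl; field).
  set (P := C1 * (2 * q)). assert (HP : 0 < P) by (pos).
  assert (HT : forall N, (1 <= N)%nat -> Cmod (csum (dirichlet_term (fun j => b j - A k j)%C s') N) <= P * exp (d * ln (INR N))).
  { intros N HN. apply le_of_lt_all. intros et Het.
    destruct (csum_limit (fun l => dirichlet_term (A l) s') (dirichlet_term b s') N) with (eta := et) as (l0 & Hl0); auto.
    { intros n Hn e He. set (w := nat_Cpow n (- s')). assert (Hw : 0 < Cmod w) by (apply Cmod_gt_0, nat_Cpow_neq_0).
      destruct (Hb n ltac:(lia) (e / Cmod w)) as (l1 & Hl1). now pos.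
      exists l1. intros l Hl. specialize (Hl1 l Hl). rewrite <- dirichlet_term_minus. unfold dirichlet_term. fold w.
      rewrite Cmod_mult, Cmod_minus_sym. apply Rmult_lt_reg_r with (/ Cmod w). now pos.
      rewrite Rmult_assoc, Rinv_r by lra. rewrite Rmult_1_r. exact Hl1. }
    set (l := max l0 k). specialize (Hl0 l ltac:(lia)).
    assert (HG : Cmod (csum (dirichlet_term (fun j => A l j - A k j)%C s') N) <= P * exp (d * ln (INR N))).
    { destruct (Htr N HN) as (T0 & HT0 & Htr').
      set (X := max N (max (snd (aX k)) (snd (aX l)))).
      replace (P * exp (d * ln (INR N))) with (C1 * exp (d * ln (INR N)) * (2 * q)) by (unfold P; ring).
      apply (Htr' X). lia.
      - intros t _. rewrite osc_dirichlet. apply Hdiff. lia. unfold half_plane. fold q. replace (Re (s' + (0, t))) with (Re s') by (unfold Re; simpl; ring). lra. lia.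
      - intros n Hn. replace (Cmod (dirichlet_term (fun j => A l j - A k j)%C s' n)) with
          (Cmod (dirichlet_term (fun j => A l j - A k j)%C (RtoC (2 * d)) n)).
        apply Hcoef. lia. exact Hk1. lia.
        unfold dirichlet_term. rewrite !Cmod_mult, !Cmod_nat_Cpow. f_equal. f_equal. f_equal.
        change (- (2 * d) = - Re s'). lra. }
    replace (csum (dirichlet_term (fun j => b j - A k j)%C s') N) with
      (csum (dirichlet_term (fun j => A l j - A k j)%C s') N + (csum (dirichlet_term b s') N - csum (dirichlet_term (A l) s') N))%C.
    apply Cmod_triangle_le. lra.
    rewrite <- csum_minus, <- csum_plus. apply csum_ext. intros; unfold dirichlet_term; ring. }
  exists (max 1 (snd (aX k))). intros N HN.
  assert (HA1 := Abel_shift (dirichlet_term (fun j => b j - A k j)%C s') P d 1 N Hd ltac:(lia) HT).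
  assert (E : forall m, csum (fun i => nat_Cpow i (- RtoC (2 * d)) * dirichlet_term (fun j => b j - A k j)%C s' i)%C m
     = (csum (dirichlet_term b s) m - csum (dirichlet_term (A k) s) m)%C).
  { intros m. rewrite <- csum_minus. apply csum_ext. intros i _. rewrite <- dirichlet_term_shift, <- dirichlet_term_minus. f_equal. unfold s'. ring. }
  rewrite E in HA1.
  assert (H1 : Cmod (csum (fun i => nat_Cpow i (- RtoC (2 * d)) * dirichlet_term (fun j => b j - A k j)%C s' i)%C 1) <= P).
  { simpl csum. rewrite nat_Cpow_1. specialize (HT 1%nat (le_n _)). simpl in HT. rewrite ln_1, Rmult_0_r, exp_0, Rmult_1_r in HT.
    match goal with |- Cmod ?z <= _ => match type of HT with Cmod ?y <= _ => replace z with y by ring end end. exact HT. }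
  set (g1 := csum (fun i => nat_Cpow i (- RtoC (2 * d)) * dirichlet_term (fun j => b j - A k j)%C s' i)%C 1) in *.
  simpl INR in HA1. rewrite ln_1, Rmult_0_r, exp_0, Rmult_1_r in HA1.
  assert (H2 := HaX k N s ltac:(lia)). fold q (A k) in H2. specialize (H2 ltac:(unfold half_plane, d in *; lra)).
  replace (csum (dirichlet_term b s) N - F s)%C with
    ((csum (dirichlet_term b s) N - csum (dirichlet_term (A k) s) N - g1) + g1 - (F s - csum (dirichlet_term (A k) s) N))%C by ring.
  eapply Rle_lt_trans. apply Cmod_minus_le. eapply Rle_lt_trans. apply Rplus_le_compat_r, Cmod_triangle.
  assert (q * (10 * C1 + 2) < eta).
  { apply Rmult_lt_reg_r with (/ (10 * C1 + 2)). pos.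
    rewrite Rmult_assoc, Rinv_r by lra. lra. }
  unfold P in *. lra.
Qed.

(** * Averages over roots of unity *)

Definition root (N j : nat) : C := cis (2 * PI * (INR j / INR N)).

Lemma root_pow N j k : (root N j ^ k)%C = cis (2 * PI * INR k * (INR j / INR N)).
Proof.
  unfold root. rewrite <- Cexp_cis, Cexp_pow, <- Cexp_cis. f_equal.
  unfold Cmult, RtoC; simpl. f_equal; ring.
Qed.

Lemma Cmod_root N j : Cmod (root N j) = 1.
Proof. apply Cmod_cis. Qed.

Lemma cis_2PI_INR k : cis (2 * PI * INR k) = RtoC 1.
Proof.
  unfold cis, RtoC. f_equal.
  - replace (2 * PI * INR k) with (0 + 2 * INR k * PI) by ring. rewrite cos_period. apply cos_0.
  - replace (2 * PI * INR k) with (0 + 2 * INR k * PI) by ring. rewrite sin_period. apply sin_0.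
Qed.

Lemma root_sum_dvd N m : (1 <= N)%nat -> csum (fun j => root N j ^ (N * m))%C N = RtoC (INR N).
Proof.
  intros HN. rewrite (csum_ext _ (fun _ => RtoC 1)). rewrite csum_const; ring.
  intros j _. rewrite root_pow, mult_INR.
  replace (2 * PI * (INR N * INR m) * (INR j / INR N)) with (2 * PI * INR (m * j)).
  apply cis_2PI_INR. rewrite mult_INR. field. apply not_0_INR; lia.
Qed.

Lemma root_sum_ndvd N m : (1 <= N)%nat -> (forall k, m <> N * k)%nat -> csum (fun j => root N j ^ m)%C N = RtoC 0.
Proof.
  intros HN Hm.
  assert (HN0 : 0 < INR N) by (apply lt_0_INR; lia).
  set (z := cis (2 * PI * (INR m / INR N))).
  assert (Hz : z <> RtoC 1).
  { intros E. injection E as E _.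
    assert (Hs : sin (PI * (INR m / INR N)) = 0).
    { replace (2 * PI * (INR m / INR N)) with (2 * (PI * (INR m / INR N))) in E by ring.
      rewrite cos_2a_sin in E. nra. }
    apply sin_eq_0_0 in Hs. destruct Hs as (k & Hk).
    assert (HP := PI_RGT_0).
    assert (E2 : INR m = IZR k * INR N).
    { apply Rmult_eq_reg_l with (PI / INR N). 2: apply Rgt_not_eq, Rdiv_lt_0_compat; lra.
      transitivity (PI * (INR m / INR N)). field; lra. rewrite Hk. field. lra. }
    rewrite !INR_IZR_INZ, <- mult_IZR in E2. apply eq_IZR in E2.
    apply (Hm (Z.to_nat k)). nia. }
  assert (Hp : forall j, (root N j ^ m)%C = (z ^ j)%C).
  { intros j. rewrite root_pow. unfold z. rewrite <- Cexp_cis, <- Cexp_cis, Cexp_pow. f_equal.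
    unfold Cmult, RtoC; simpl. f_equal; field; lra. }
  rewrite (csum_ext _ (fun j => z ^ j)%C) by auto.
  assert (Hg : forall n, ((1 - z) * csum (fun j => z ^ j) n = z * (1 - z ^ n))%C).
  { induction n. simpl; ring. cbn [csum]. rewrite Cmult_plus_distr_l, IHn, !Cpow_S. ring. }
  assert (HzN : (z ^ N)%C = RtoC 1).
  { rewrite <- Hp. unfold root. replace (INR N / INR N) with 1 by (field; lra).
    rewrite <- (Cpow_1_l m). f_equal. replace (2 * PI * 1) with (2 * PI * INR 1) by reflexivity. apply cis_2PI_INR. }
  specialize (Hg N). rewrite HzN in Hg. replace (z * (1 - 1))%C with (RtoC 0) in Hg by ring.
  destruct (Ceq_dec (csum (fun j => z ^ j)%C N) 0) as [E|E]; auto.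
  exfalso. apply (Cmult_neq_0 (1 - z) (csum (fun j => z ^ j)%C N)); auto.
  intros E1. apply Hz. transitivity (1 - (1 - z))%C. ring. rewrite E1. ring.
Qed.

(** The discrete substitute for the integral over the unit circle; on w^m it is exact for 0 <= m <
    N. *)
Definition cmean (N : nat) (g : C -> C) : C := (RtoC (/ INR N) * csum (fun j => g (root N j)) N)%C.

Lemma cmean_ext N f g : (forall w, f w = g w) -> cmean N f = cmean N g.
Proof. intros H. unfold cmean. f_equal. apply csum_ext. intros; apply H. Qed.

Lemma cmean_plus N f g : cmean N (fun w => f w + g w)%C = (cmean N f + cmean N g)%C.
Proof. unfold cmean. rewrite csum_plus. ring. Qed.

Lemma cmean_scal N c f : cmean N (fun w => c * f w)%C = (c * cmean N f)%C.
Proof. unfold cmean. rewrite csum_scal. ring. Qed.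

Lemma cmean_bound N f K : (1 <= N)%nat -> (forall j, Cmod (f (root N j)) <= K) -> Cmod (cmean N f) <= K.
Proof.
  intros HN H. assert (HN0 : 0 < INR N) by (apply lt_0_INR; lia).
  unfold cmean. rewrite Cmod_mult, Cmod_RtoC_nonneg by (left; now pos).
  apply Rle_trans with (/ INR N * (INR N * K)). apply Rmult_le_compat_l. left; now pos.
  rewrite <- rsum_const. apply Cmod_csum_le. auto. right; field; lra.
Qed.

Lemma cmean_pow_dvd N k : (1 <= N)%nat -> cmean N (fun w => w ^ (N * k))%C = RtoC 1.
Proof.
  intros H. unfold cmean. rewrite root_sum_dvd by auto. rewrite <- RtoC_mult. f_equal. field. apply not_0_INR; lia.
Qed.

Lemma cmean_pow_ndvd N m : (1 <= N)%nat -> (forall k, m <> N * k)%nat -> cmean N (fun w => w ^ m)%C = RtoC 0.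
Proof. intros H H1. unfold cmean. rewrite root_sum_ndvd by auto. ring. Qed.

Lemma cmean_exp_taylor N z d : (1 <= d <= N)%nat -> cmean N (fun w => exp_taylor d (z * w)) = RtoC 1.
Proof.
  intros [Hd HN]. induction Hd.
  - transitivity (cmean N (fun w => w ^ (N * 0))%C); [|apply cmean_pow_dvd; lia].
    apply cmean_ext. intros w. rewrite Nat.mul_0_r. simpl. rewrite Rinv_1. ring.
  - cbn [exp_taylor]. rewrite cmean_plus, IHHd by lia.
    rewrite (cmean_ext N _ (fun w => (RtoC (/ INR (fact m)) * z ^ m) * w ^ m)%C).
    2:{ intros w. rewrite Cpow_mult_l. ring. }
    rewrite cmean_scal, cmean_pow_ndvd. ring. lia. intros k E. destruct k; [lia|nia].
Qed.

(** On the N-th roots of unity w^(N-1) = w^(-1), so the mean selects the linear coefficient. The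
    degree must stay below N, as N - 1 + m would otherwise meet the next multiple of N. *)
Lemma cmean_exp_taylor_deriv N z d : (2 <= d <= N)%nat ->
  cmean N (fun w => w ^ (N - 1) * exp_taylor d (z * w))%C = z.
Proof.
  intros [Hd HN]. induction Hd.
  - simpl exp_taylor. rewrite (cmean_ext N _ (fun w => w ^ (N - 1) + z * w ^ (N * 1))%C).
    rewrite cmean_plus, cmean_scal, cmean_pow_dvd, cmean_pow_ndvd. ring. lia. intros k E. destruct k; [lia|nia]. lia.
    intros w. replace (N * 1)%nat with (S (N - 1)) by lia. rewrite (Cpow_S w (N - 1)). simpl. rewrite Rinv_1. ring.
  - cbn [exp_taylor].
    rewrite (cmean_ext N _ (fun w => w ^ (N - 1) * exp_taylor m (z * w) + (RtoC (/ INR (fact m)) * z ^ m) * w ^ (N - 1 + m))%C).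
    2:{ intros w. rewrite Cpow_mult_l, Cpow_add_r. ring. }
    rewrite cmean_plus, IHHd by lia. rewrite cmean_scal, cmean_pow_ndvd. ring. lia.
    intros k E. destruct k; [lia|]. destruct k; [lia|nia].
Qed.

Lemma pow_over_fact_small x eta : 0 < eta -> exists N0, forall N, (N0 <= N)%nat -> Rabs (x ^ N / INR (fact N)) < eta.
Proof.
  intros He. destruct (cv_speed_pow_fact x eta He) as (N0 & H). exists N0. intros N HN.
  specialize (H N HN). unfold Rdist in H. now rewrite Rminus_0_r in H.
Qed.

Lemma cmean_Cexp z eta : 0 < eta -> exists N0, forall N, (N0 <= N)%nat ->
  Cmod (cmean N (fun w => Cexp (z * w)) - 1) <= eta /\
  Cmod (cmean N (fun w => w ^ (N - 1) * Cexp (z * w))%C - z) <= eta.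
Proof.
  intros He. destruct (pow_over_fact_small (Cmod z) (eta / exp (Cmod z))) as (N0 & HN0).
  pos.
  exists (max 2 N0). intros N HN. specialize (HN0 N ltac:(lia)).
  assert (Herr : forall w, Cmod w = 1 -> Cmod (Cexp (z * w) - exp_taylor N (z * w)) <= eta).
  { intros w Hw. eapply Rle_trans. apply Cexp_taylor_bound. rewrite Cmod_mult, Hw, Rmult_1_r.
    apply Rle_trans with (eta / exp (Cmod z) * exp (Cmod z)).
    apply Rmult_le_compat_r. left; apply exp_pos. eapply Rle_trans. apply Rle_abs. lra.
    right; field. apply Rgt_not_eq, exp_pos. }
  split.
  - rewrite <- (cmean_exp_taylor N z N) by lia.
    replace (cmean N (fun w => Cexp (z * w)) - cmean N (fun w => exp_taylor N (z * w)))%C with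
      (cmean N (fun w => Cexp (z * w) + (-1) * exp_taylor N (z * w)))%C by (rewrite cmean_plus, cmean_scal; ring).
    apply cmean_bound. lia. intros j. eapply Rle_trans; [|apply (Herr (root N j)), Cmod_root].
    right; f_equal; ring.
  - assert (E := cmean_exp_taylor_deriv N z N ltac:(lia)).
    match goal with |- Cmod (?a - _) <= _ => replace (a - z)%C with
      (a - cmean N (fun w => w ^ (N - 1) * exp_taylor N (z * w)))%C by (rewrite E; reflexivity) end.
    replace (cmean N (fun w => w ^ (N - 1) * Cexp (z * w)) - cmean N (fun w => w ^ (N - 1) * exp_taylor N (z * w)))%C with
      (cmean N (fun w => w ^ (N - 1) * Cexp (z * w) + (-1) * (w ^ (N - 1) * exp_taylor N (z * w))))%C by (rewrite cmean_plus, cmean_scal; ring).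
    apply cmean_bound. lia. intros j. eapply Rle_trans; [|apply (Herr (root N j)), Cmod_root].
    replace (root N j ^ (N - 1) * Cexp (z * root N j) + -1 * (root N j ^ (N - 1) * exp_taylor N (z * root N j)))%C
      with (root N j ^ (N - 1) * (Cexp (z * root N j) - exp_taylor N (z * root N j)))%C by ring.
    rewrite Cmod_mult, Cmod_pow, Cmod_root, pow1. lra.
Qed.

(** The mean value property and Cauchy's formula for the derivative. They hold only up to eta,
    because the powers w^m of high degree in the exponential series are aliased by the roots of
    unity. *)
Lemma dpoly_circle p p' s r : dpoly p p' -> forall eta, 0 < eta -> exists N0, forall N, (N0 <= N)%nat ->
  Cmod (cmean N (fun w => p (s + RtoC r * w)%C) - p s) <= eta /\
  Cmod (cmean N (fun w => w ^ (N - 1) * p (s + RtoC r * w))%C - RtoC r * p' s) <= eta.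
Proof.
  induction 1; intros eta He.
  - set (A := (c * nat_Cpow k (- s))%C). set (z := (- RtoC (r * ln (INR k)))%C).
    assert (HA := Cmod_ge_0 A).
    destruct (cmean_Cexp z (eta / (Cmod A + 1))) as (N0 & HN0). pos.
    exists N0. intros N HN. destruct (HN0 N HN) as [H1 H2].
    assert (E : forall w, (c * nat_Cpow k (- (s + RtoC r * w)))%C = (A * Cexp (z * w))%C).
    { intros w. unfold A, z. replace (- (s + RtoC r * w))%C with (- s + - (RtoC r * w))%C by ring.
      rewrite nat_Cpow_plus, Cmult_assoc. f_equal. unfold nat_Cpow. f_equal. rewrite RtoC_mult. ring. }
    assert (Hb : forall x, Cmod x <= eta / (Cmod A + 1) -> Cmod (A * x) <= eta).
    { intros x Hx. rewrite Cmod_mult. apply Rle_trans with ((Cmod A + 1) * (eta / (Cmod A + 1))).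
      apply Rmult_le_compat; auto. apply Cmod_ge_0. lra. right; field; lra. }
    split.
    + rewrite (cmean_ext N _ _ E), cmean_scal. replace (A * cmean N (fun w => Cexp (z * w)) - A)%C with
        (A * (cmean N (fun w => Cexp (z * w)) - 1))%C by ring. auto.
    + rewrite (cmean_ext N _ (fun w => A * (w ^ (N - 1) * Cexp (z * w)))%C) by (intros; rewrite E; ring).
      rewrite cmean_scal.
      match goal with |- Cmod ?x <= _ => replace x with (A * (cmean N (fun w => w ^ (N - 1) * Cexp (z * w)) - z))%C end. auto.
      unfold z. rewrite RtoC_mult. fold A. ring.
  - destruct (IHdpoly1 (eta / 2) ltac:(lra)) as (N1 & H1), (IHdpoly2 (eta / 2) ltac:(lra)) as (N2 & H2).
    exists (max N1 N2). intros N HN. destruct (H1 N ltac:(lia)) as [A1 B1], (H2 N ltac:(lia)) as [A2 B2]. split.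
    + rewrite cmean_plus. match goal with |- Cmod (?a + ?b - (?c + ?d)) <= _ => replace (a + b - (c + d))%C with ((a - c) + (b - d))%C by ring end.
      apply Cmod_triangle_le. lra.
    + rewrite (cmean_ext N _ (fun w => w ^ (N - 1) * p (s + RtoC r * w) + w ^ (N - 1) * q (s + RtoC r * w))%C) by (intros; ring).
      rewrite cmean_plus. match goal with |- Cmod (?a + ?b - ?e * (?c + ?d)) <= _ => replace (a + b - e * (c + d))%C with ((a - e * c) + (b - e * d))%C by ring end.
      apply Cmod_triangle_le. lra.
  - destruct (IHdpoly eta He) as (N0 & H2). exists N0. intros N HN. destruct (H2 N HN) as [A B].
    rewrite <- H, <- H0. split.
    + rewrite <- (cmean_ext N (fun w => p (s + RtoC r * w)%C)); auto.
    + rewrite <- (cmean_ext N (fun w => w ^ (N - 1) * p (s + RtoC r * w))%C); auto. intros w; now rewrite H.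
Qed.

Lemma Re_circle s r w : 0 <= r -> Cmod w = 1 -> Re s - r <= Re (s + RtoC r * w).
Proof.
  intros Hr Hw. replace (Re (s + RtoC r * w)) with (Re s + r * Re w) by (unfold Re, RtoC; simpl; ring).
  assert (H := Re_ge_Cmod w). rewrite Hw in H. nra.
Qed.

(** Cauchy's estimate on the circle of radius r about s. *)
Lemma dpoly_deriv_bound p p' s r e M : dpoly p p' -> 0 < r -> e < Re s - r ->
  (forall z, half_plane e z -> Cmod (p z) <= M) -> Cmod (p' s) <= M / r.
Proof.
  intros Hp Hr He HM. apply Rmult_le_reg_r with r; auto. unfold Rdiv. rewrite Rmult_assoc, Rinv_l, Rmult_1_r by lra.
  apply le_of_lt_all. intros eta Heta. destruct (dpoly_circle p p' s r Hp eta Heta) as (N0 & H).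
  destruct (H (S N0) ltac:(lia)) as [_ H1].
  set (m := cmean (S N0) (fun w => w ^ (S N0 - 1) * p (s + RtoC r * w))%C) in *.
  assert (Cmod m <= M).
  { apply cmean_bound. lia. intros j. rewrite Cmod_mult, Cmod_pow, Cmod_root, pow1, Rmult_1_l. apply HM.
    unfold half_plane. eapply Rlt_le_trans. exact He. apply Re_circle. lra. apply Cmod_root. }
  rewrite Rmult_comm. rewrite <- (Cmod_RtoC_nonneg r) at 1 by lra. rewrite <- Cmod_mult.
  assert (H2 := Cmod_le_minus (RtoC r * p' s) m). rewrite Cmod_minus_sym in H1. lra.
Qed.

Lemma approx_circle F s r : approx F -> 0 < r < Re s -> forall eta, 0 < eta -> exists N0, forall N, (N0 <= N)%nat ->
  Cmod (cmean N (fun w => F (s + RtoC r * w)%C) - F s) <= eta.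
Proof.
  intros HF Hr eta He. set (e := (Re s - r) / 2).
  destruct (HF e (eta / 3) ltac:(unfold e; lra) ltac:(lra)) as (p & p' & Hp & Hpe).
  destruct (dpoly_circle p p' s r Hp (eta / 3) ltac:(lra)) as (N0 & H). exists (S N0). intros N HN.
  destruct (H N ltac:(lia)) as [H1 _].
  assert (H2 := Hpe s ltac:(unfold half_plane, e; lra)).
  assert (H3 : Cmod (cmean N (fun w => F (s + RtoC r * w) + (-1) * p (s + RtoC r * w))%C) <= eta / 3).
  { apply cmean_bound. lia. intros j. eapply Rle_trans; [|apply (Hpe (s + RtoC r * root N j)%C)].
    right. f_equal. ring. unfold half_plane. assert (H3 := Re_circle s r (root N j) ltac:(lra) (Cmod_root N j)). unfold e. lra. }
  rewrite cmean_plus, cmean_scal in H3.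
  set (u := cmean N (fun w => F (s + RtoC r * w)%C)) in *. set (v := cmean N (fun w => p (s + RtoC r * w)%C)) in *.
  replace (u - F s)%C with ((u + -1 * v) + (v - p s) - (F s - p s))%C by ring.
  apply Cmod_minus_le_trans. eapply Rle_trans. apply Rplus_le_compat_r, Cmod_triangle. lra.
Qed.

(** * Analyticity of uniform limits *)

Definition cderiv (f : C -> C) (s d : C) : Prop :=
  forall eta, 0 < eta -> exists delta, 0 < delta /\
  forall h, Cmod h < delta -> Cmod (f (s + h)%C - f s - d * h) <= eta * Cmod h.

Lemma cderiv_is_derive f s d : cderiv f s d -> @is_derive C_AbsRing C_NormedModule f s d.
Proof.
  intros H. split. apply is_linear_scal_l.
  intros x Hx. assert (E : s = x) by exact (is_filter_lim_locally_unique (V := AbsRing_NormedModule C_AbsRing) s x Hx). subst x.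
  intros eps. destruct (H eps (cond_pos eps)) as (delta & Hd & Hh).
  exists (mkposreal delta Hd). intros y Hy. change (Cmod (y - s) < delta) in Hy.
  specialize (Hh (y - s)%C Hy). assert (Ey : (s + (y - s))%C = y) by (clear; change C in y; ring). rewrite Ey in Hh.
  change (Cmod (f y - f s - (y - s) * d) <= eps * Cmod (y - s)).
  rewrite (Cmult_comm (y - s)). exact Hh.
Qed.

Lemma dpoly_cderiv p p' s : dpoly p p' -> cderiv p s (p' s).
Proof.
  induction 1.
  - set (A := (c * nat_Cpow k (- s))%C). set (l := ln (INR k)). assert (Hl := ln_INR_nonneg k H). fold l in Hl.
    intros eta He. assert (HA := Cmod_ge_0 A).
    set (D := 2 * Cmod A * l ^ 2 + l + 1). assert (Hl2 := pow2_ge_0 l).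
    assert (HAl : 0 <= Cmod A * l ^ 2) by (pos).
    assert (HD : 1 <= D) by (unfold D; lra).
    exists (Rmin 1 eta / D). split. pos.
    intros h Hh. assert (H0 := Cmod_ge_0 h).
    assert (HhD : D * Cmod h <= Rmin 1 eta).
    { apply Rmult_le_reg_r with (/ D). pos.
      replace (D * Cmod h * / D) with (Cmod h) by (field; lra). unfold Rdiv in Hh. lra. }
    assert (Hm1 := Rmin_l 1 eta). assert (Hm2 := Rmin_r 1 eta).
    set (z := (- (h * RtoC l))%C).
    assert (Hz : Cmod z = Cmod h * l) by (unfold z; rewrite Cmod_opp, Cmod_mult, Cmod_RtoC_nonneg; auto).
    assert (Hz1 : Cmod z <= 1).
    { rewrite Hz. assert (l * Cmod h <= D * Cmod h) by (apply Rmult_le_compat_r; unfold D; lra). lra. }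
    assert (E : (c * nat_Cpow k (- (s + h)))%C = (A * Cexp z)%C).
    { unfold A, z. replace (- (s + h))%C with (- s + - h)%C by ring. rewrite nat_Cpow_plus. unfold nat_Cpow at 2.
      fold l. rewrite Cmult_assoc. f_equal. f_equal. ring. }
    cbv beta. fold A l. rewrite E. replace (A * Cexp z - A - - RtoC l * A * h)%C with (A * (Cexp z - 1 - z))%C by (unfold z; ring).
    rewrite Cmod_mult. assert (H1 := Cexp_linear z Hz1). rewrite Hz in H1.
    apply Rle_trans with (Cmod A * (2 * (Cmod h * l) ^ 2)). apply Rmult_le_compat_l; auto.
    replace (Cmod A * (2 * (Cmod h * l) ^ 2)) with (2 * Cmod A * l ^ 2 * Cmod h * Cmod h) by ring.
    apply Rmult_le_compat_r; auto.
    assert (2 * Cmod A * l ^ 2 * Cmod h <= D * Cmod h) by (apply Rmult_le_compat_r; unfold D; lra). lra.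
  - intros eta He. destruct (IHdpoly1 (eta / 2) ltac:(lra)) as (d1 & Hd1 & H1), (IHdpoly2 (eta / 2) ltac:(lra)) as (d2 & Hd2 & H2).
    exists (Rmin d1 d2). split. now pos. intros h Hh.
    specialize (H1 h ltac:(eapply Rlt_le_trans; [exact Hh|apply Rmin_l])).
    specialize (H2 h ltac:(eapply Rlt_le_trans; [exact Hh|apply Rmin_r])).
    replace (p (s + h) + q (s + h) - (p s + q s) - (p' s + q' s) * h)%C with
      ((p (s + h) - p s - p' s * h) + (q (s + h) - q s - q' s * h))%C by ring.
    apply Cmod_triangle_le. lra.
  - intros eta He. destruct (IHdpoly eta He) as (d1 & Hd1 & H2). exists d1. split; auto. intros h Hh.
    rewrite <- !H, <- H0. auto.
Qed.

Lemma dpoly_rderiv p p' s h t : dpoly p p' -> rderiv (fun u => p (s + RtoC u * h)%C) t (h * p' (s + RtoC t * h))%C.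
Proof.
  induction 1.
  - set (A := (c * nat_Cpow k (- s))%C). set (z := (- (h * RtoC (ln (INR k))))%C).
    assert (E : forall u, (c * nat_Cpow k (- (s + RtoC u * h)))%C = (A * Cexp (RtoC u * z))%C).
    { intros u. unfold A, z. replace (- (s + RtoC u * h))%C with (- s + - (RtoC u * h))%C by ring.
      rewrite nat_Cpow_plus. unfold nat_Cpow at 2. rewrite Cmult_assoc. f_equal. f_equal. ring. }
    apply (rderiv_ext (fun u => A * Cexp (RtoC u * z))%C _ t (A * (z * Cexp (RtoC t * z)))%C).
    intros; now rewrite E. rewrite E. unfold z. ring.
    apply rderiv_scal, rderiv_Cexp.
  - eapply rderiv_ext; [| |apply (rderiv_plus _ _ _ _ _ IHdpoly1 IHdpoly2)]; intros; simpl; ring.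
  - eapply rderiv_ext; [| |exact IHdpoly]; intros; simpl; now rewrite ?H, ?H0.
Qed.

Lemma dpoly_increment p p' s h K : dpoly p p' ->
  (forall t, 0 <= t <= 1 -> Cmod (p' (s + RtoC t * h)%C) <= K) -> Cmod (p (s + h)%C - p s) <= K * Cmod h.
Proof.
  intros Hp HK.
  assert (H := mean_value_inequality (fun u => p (s + RtoC u * h)%C) (fun t => h * p' (s + RtoC t * h))%C
    (fun u => K * Cmod h * u) (fun _ => K * Cmod h) 0 1 ltac:(lra)).
  replace (p (s + h)%C - p s)%C with (p (s + RtoC 1 * h) - p (s + RtoC 0 * h))%C.
  eapply Rle_trans. apply H.
  - intros t Ht. split; [|split]. now apply dpoly_rderiv. auto_derive; auto. ring.
    rewrite Cmod_mult, Rmult_comm. apply Rmult_le_compat_r. apply Cmod_ge_0. auto.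
  - right; ring.
  - f_equal; [f_equal|f_equal; f_equal]; ring.
Qed.

(* Locally uniform convergence of the polynomials forces that of their derivatives. *)
Lemma approx_analytic F : approx F -> analytic_C0 F.
Proof.
  intros HF s Hs. unfold half_plane in Hs. set (e := Re s / 4). assert (He : 0 < e) by pos.
  destruct (choice_nat ((C -> C) * (C -> C)) (fun n pp => dpoly (fst pp) (snd pp) /\
     forall z, half_plane e z -> Cmod (F z - fst pp z) <= / INR (S n))) as (pp & Hpp).
  { intros n. destruct (HF e _ He (inv_INR_S_pos n)) as (p & p' & Hp & Hpe). exists (p, p'). auto. }
  set (p := fun n => fst (pp n)). set (p' := fun n => snd (pp n)).
  assert (Hp : forall n, dpoly (p n) (p' n)) by (intros; apply Hpp).
  assert (Hpe : forall n z, half_plane e z -> Cmod (F z - p n z) <= / INR (S n)) by (intros n; apply (Hpp n)).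
  assert (Hd : forall n m z, (n <= m)%nat -> 2 * e < Re z -> Cmod (p' m z - p' n z) <= 2 * / INR (S n) / e).
  { intros n m z Hnm Hz.
    apply (dpoly_deriv_bound _ _ z e e (2 * / INR (S n)) (dpoly_minus _ _ _ _ (Hp m) (Hp n)) He). lra.
    intros y Hy. assert (H1 := Hpe n y Hy). assert (H2 := Hpe m y Hy). assert (H3 := inv_INR_S_le n m Hnm).
    replace (p m y - p n y)%C with ((F y - p n y) - (F y - p m y))%C by ring.
    apply Cmod_minus_le_trans. lra. }
  destruct (cauchy_limit (fun n => p' n s)) as (D & HD).
  { intros eta Heta. destruct (inv_INR_S_small (eta * e / 4)) as (n0 & Hn0). nra.
    specialize (Hn0 n0 (le_n _)).
    assert (Hb : 2 * / INR (S n0) / e < eta / 2).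
    { apply Rmult_lt_reg_r with e; auto. unfold Rdiv at 1. rewrite Rmult_assoc, Rinv_l by lra. lra. }
    exists n0. intros i j Hi Hj.
    assert (H1 := Hd n0 i s Hi ltac:(unfold e; lra)). assert (H2 := Hd n0 j s Hj ltac:(unfold e; lra)).
    replace (p' i s - p' j s)%C with ((p' i s - p' n0 s) - (p' j s - p' n0 s))%C by ring.
    eapply Rle_lt_trans. apply Cmod_minus_le. lra. }
  exists D. apply cderiv_is_derive. intros eta Heta.
  destruct (inv_INR_S_small (eta * e / 8)) as (n1 & Hn1). nra.
  destruct (HD (eta / 4) ltac:(lra)) as (n2 & Hn2).
  set (n := max n1 n2). specialize (Hn1 n ltac:(lia)). specialize (Hn2 n ltac:(lia)).
  destruct (dpoly_cderiv _ _ s (Hp n) (eta / 4) ltac:(lra)) as (d & Hd0 & Hdd).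
  exists (Rmin d e). split. now pos. intros h Hh.
  specialize (Hdd h ltac:(eapply Rlt_le_trans; [exact Hh|apply Rmin_l])).
  assert (Hhe : Cmod h < e) by (eapply Rlt_le_trans; [exact Hh|apply Rmin_r]).
  assert (Hseg : forall t, 0 <= t <= 1 -> 3 * e < Re (s + RtoC t * h)).
  { intros t Ht. replace (Re (s + RtoC t * h)) with (Re s + t * Re h) by (unfold Re, RtoC; simpl; ring).
    assert (H1 := Re_ge_Cmod h). assert (H2 := Cmod_ge_0 h). unfold e in *. nra. }
  assert (Hsh : Re (s + h) > 3 * e). { specialize (Hseg 1 ltac:(lra)). replace (s + RtoC 1 * h)%C with (s + h)%C in Hseg by ring. lra. }
  assert (Hb : 2 * / INR (S n) / e <= eta / 4).
  { apply Rmult_le_reg_r with e; auto. unfold Rdiv at 1. rewrite Rmult_assoc, Rinv_l by lra. lra. }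
  (* Nothing is known yet about derivatives of F, so the increment of F - p_n is taken as a limit of
     increments of p_m - p_n, whose derivatives are small. *)
  assert (Hinc : Cmod ((F (s + h) - p n (s + h)) - (F s - p n s))%C <= eta / 4 * Cmod h).
  { apply le_of_lt_all. intros et Het.
    destruct (inv_INR_S_small (et / 2)) as (m0 & Hm0). lra.
    set (m := max m0 n). specialize (Hm0 m ltac:(lia)).
    assert (H1 := dpoly_increment _ _ s h (eta / 4) (dpoly_minus _ _ _ _ (Hp m) (Hp n))).
    assert (H2 := Hpe m (s + h)%C ltac:(unfold half_plane; lra)). assert (H3 := Hpe m s ltac:(unfold half_plane, e in *; lra)).
    cbv beta in H1.
    replace ((F (s + h) - p n (s + h)) - (F s - p n s))%C with
      ((p m (s + h) - p n (s + h) - (p m s - p n s)) + (F (s + h) - p m (s + h)) - (F s - p m s))%C by ring.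
    apply Cmod_minus_le_trans. eapply Rle_trans. apply Rplus_le_compat_r, Cmod_triangle.
    assert (Cmod (p m (s + h) - p n (s + h) - (p m s - p n s))%C <= eta / 4 * Cmod h); [|lra].
    apply H1. intros t Ht. eapply Rle_trans. apply Hd. lia. specialize (Hseg t Ht). lra. exact Hb. }
  replace (F (s + h) - F s - D * h)%C with
    (((F (s + h) - p n (s + h)) - (F s - p n s)) + (p n (s + h) - p n s - p' n s * h) + (p' n s - D) * h)%C by ring.
  apply Cmod_triangle_le. eapply Rle_trans. apply Rplus_le_compat_r, Cmod_triangle.
  rewrite Cmod_mult. assert (H0 := Cmod_ge_0 h).
  assert (Cmod (p' n s - D) * Cmod h <= eta / 4 * Cmod h) by (apply Rmult_le_compat_r; lra).
  assert (0 <= eta * Cmod h) by pos. lra.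
Qed.

Lemma approx_Hinf F : approx F -> Hinf_plus F.
Proof.
  intros H. split; [|split]. now apply approx_analytic. now apply approx_bounded.
  destruct (approx_dirichlet F H) as (a & Ha). exists a. now apply cv_C0_iff.
Qed.

Lemma Hinf_coefs f : Hinf_plus f -> exists a, cv_C0 a f /\ cvu_C0 a f.
Proof.
  intros (_ & Hb & a & Ha). exists a. apply cv_C0_iff in Ha. split; auto. now apply bohr_uniform.
Qed.

Lemma Hinf_approx f : Hinf_plus f <-> approx f.
Proof.
  split; [|apply approx_Hinf]. intros H. destruct (Hinf_coefs f H) as (a & _ & Ha). now apply (approx_cvu a).
Qed.

(** * Limits along the real axis and leading coefficients *)

Definition tends (g : R -> C) (l : C) : Prop :=
  forall eta, 0 < eta -> exists x0, forall x, x0 <= x -> Cmod (g x - l) <= eta.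

Lemma tends_unique g l l' : tends g l -> tends g l' -> l = l'.
Proof.
  intros H H'. transitivity (l - l' + l')%C. ring.
  replace (l - l')%C with (RtoC 0). ring. symmetry. apply Cmod_small. intros eta He.
  destruct (H (eta / 2)) as (x0 & H0). lra. destruct (H' (eta / 2)) as (x1 & H1). lra.
  specialize (H0 (Rmax x0 x1) (Rmax_l _ _)). specialize (H1 (Rmax x0 x1) (Rmax_r _ _)).
  replace (l - l')%C with ((g (Rmax x0 x1) - l') - (g (Rmax x0 x1) - l))%C by ring.
  apply Cmod_minus_le_trans. lra.
Qed.

Lemma tends_eventually g h l x1 : (forall x, x1 <= x -> g x = h x) -> tends g l -> tends h l.
Proof.
  intros E H eta He. destruct (H eta He) as (x0 & H0). exists (Rmax x0 x1). intros x Hx.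
  rewrite <- E. apply H0. eapply Rle_trans; [apply Rmax_l|exact Hx]. eapply Rle_trans; [apply Rmax_r|exact Hx].
Qed.

Lemma tends_const c : tends (fun _ => c) c.
Proof. intros eta He. exists 0. intros. replace (c - c)%C with (RtoC 0) by ring. rewrite Cmod_0; lra. Qed.

Lemma tends_plus g h l l' : tends g l -> tends h l' -> tends (fun x => g x + h x)%C (l + l')%C.
Proof.
  intros H H' eta He.
  destruct (H (eta / 2)) as (x0 & H0). lra. destruct (H' (eta / 2)) as (x1 & H1). lra.
  exists (Rmax x0 x1). intros x Hx.
  specialize (H0 x ltac:(eapply Rle_trans; [apply Rmax_l|exact Hx])).
  specialize (H1 x ltac:(eapply Rle_trans; [apply Rmax_r|exact Hx])).
  replace (g x + h x - (l + l'))%C with ((g x - l) + (h x - l'))%C by ring.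
  apply Cmod_triangle_le. lra.
Qed.

Lemma tends_mult g h l l' : tends g l -> tends h l' -> tends (fun x => g x * h x)%C (l * l')%C.
Proof.
  intros H H' eta He.
  set (M := Cmod l' + 1). assert (HM : 0 < M) by (assert (H0 := Cmod_ge_0 l'); unfold M; lra).
  set (M' := Cmod l + 1). assert (HM' : 0 < M') by (assert (H0 := Cmod_ge_0 l); unfold M'; lra).
  destruct (H (eta / 2 / M)) as (x0 & H0). pos.
  destruct (H' (Rmin 1 (eta / 2 / M'))) as (x1 & H1). pos.
  exists (Rmax x0 x1). intros x Hx.
  specialize (H0 x ltac:(eapply Rle_trans; [apply Rmax_l|exact Hx])).
  specialize (H1 x ltac:(eapply Rle_trans; [apply Rmax_r|exact Hx])).
  assert (A := Rmin_l 1 (eta / 2 / M')). assert (B := Rmin_r 1 (eta / 2 / M')).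
  assert (Cmod (h x) <= M). { assert (D := Cmod_le_minus (h x) l'). unfold M. lra. }
  replace (g x * h x - l * l')%C with ((g x - l) * h x + l * (h x - l'))%C by ring.
  apply Cmod_triangle_le. rewrite !Cmod_mult.
  assert (Cmod (g x - l) * Cmod (h x) <= eta / 2 / M * M) by (apply Rmult_le_compat; auto; apply Cmod_ge_0).
  assert (Cmod l * Cmod (h x - l') <= M' * (eta / 2 / M')).
  { apply Rmult_le_compat; try apply Cmod_ge_0. unfold M'; lra. lra. }
  replace (eta / 2 / M * M) with (eta / 2) in H3 by (field; lra).
  replace (M' * (eta / 2 / M')) with (eta / 2) in H4 by (field; lra). lra.
Qed.

Lemma tends_exp_decay (g : R -> C) K c : 0 <= K -> 0 < c ->
  (forall x, 0 <= x -> Cmod (g x) <= K * exp (- (c * x))) -> tends g 0.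
Proof.
  intros HK Hc H eta He. exists (K / (c * eta)).
  assert (0 <= K / (c * eta)) by pos.
  intros x Hx. replace (g x - 0)%C with (g x) by ring. eapply Rle_trans. apply H; lra.
  rewrite exp_Ropp. assert (H1 := exp_ineq1_le (c * x)). assert (H2 := exp_pos (c * x)).
  apply Rmult_le_reg_r with (exp (c * x)); auto. rewrite Rmult_assoc, Rinv_l, Rmult_1_r by lra.
  assert (K <= eta * (c * x)).
  { replace K with (eta * (c * (K / (c * eta)))) by (field; lra). apply Rmult_le_compat_l. lra. apply Rmult_le_compat_l; lra. }
  assert (eta * (c * x) <= eta * exp (c * x)) by (apply Rmult_le_compat_l; lra). lra.
Qed.

Definition vanish (m : nat) (a : nat -> C) : Prop := forall n, (1 <= n < m)%nat -> a n = RtoC 0.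

Lemma cv_C0_coef_linear a F : cv_C0 a F -> exists B, 0 < B /\ forall n, (1 <= n)%nat -> Cmod (a n) <= B * INR n.
Proof.
  intros H. destruct (convergent_bounded _ _ (H (RtoC 1) ltac:(unfold half_plane, Re, RtoC; simpl; lra))) as (B & HB0 & HB).
  exists (2 * B). split. lra. intros [|n] Hn. lia.
  assert (E : Cmod (dirichlet_term a (RtoC 1) (S n)) <= 2 * B).
  { replace (dirichlet_term a (RtoC 1) (S n)) with
      (csum (dirichlet_term a (RtoC 1)) (S n) - csum (dirichlet_term a (RtoC 1)) n)%C by (simpl; ring).
    apply Cmod_minus_le_trans. assert (H1 := HB (S n)). assert (H2 := HB n). lra. }
  unfold dirichlet_term in E. rewrite Cmod_mult, Cmod_nat_Cpow in E.
  assert (HS : 0 < INR (S n)) by pos. revert E HS. set (x := INR (S n)). intros E HS.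
  replace (Re (- RtoC 1) * ln x) with (- ln x) in E by (unfold Re, RtoC; simpl; ring).
  rewrite exp_Ropp, exp_ln in E by auto.
  apply Rmult_le_reg_r with (/ x). now pos. rewrite Rmult_assoc, Rinv_r by lra. lra.
Qed.

(** Of the Re s powers of 1/n, one absorbs the coefficient bound B n and two make the sum converge;
    the remaining Re s - 3 are bounded by those of 1/m. *)
Lemma cv_C0_decay a F B m s : cv_C0 a F -> 0 <= B -> (forall n, (1 <= n)%nat -> Cmod (a n) <= B * INR n) ->
  (1 <= m)%nat -> vanish m a -> 3 <= Re s ->
  Cmod (F s) <= 2 * B * exp (- (Re s - 3) * ln (INR m)).
Proof.
  intros H HB0 HB Hm Hv Hs. apply le_of_lt_all. intros eta He.
  destruct (H s ltac:(unfold half_plane; lra) eta He) as (N & HN). specialize (HN N (le_n _)).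
  assert (H1 := Cmod_le_minus (F s) (csum (dirichlet_term a s) N)). rewrite Cmod_minus_sym in HN.
  assert (Cmod (csum (dirichlet_term a s) N) <= 2 * B * exp (- (Re s - 3) * ln (INR m))); [|lra].
  set (E := exp (- (Re s - 3) * ln (INR m))). assert (HE : 0 < E) by pos.
  apply Rle_trans with (rsum (fun n => B * E * / (INR n * INR n)) N).
  - apply Cmod_csum_le. intros n Hn. unfold dirichlet_term.
    assert (Hn0 : 0 < INR n) by pos.
    assert (0 <= B * E * / (INR n * INR n)) by pos.
    destruct (le_lt_dec m n) as [Hmn|Hmn].
    + rewrite Cmod_mult, Cmod_nat_Cpow.
      apply Rle_trans with (B * INR n * exp (Re (- s) * ln (INR n))). apply Rmult_le_compat_r. left; apply exp_pos. apply HB; lia.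
      replace (Re (- s) * ln (INR n)) with (- (ln (INR n) + ln (INR n) + ln (INR n)) + - (Re s - 3) * ln (INR n)) by (change (Re (- s)) with (- Re s); ring).
      rewrite exp_plus, exp_Ropp, !exp_plus, exp_ln by auto.
      assert (exp (- (Re s - 3) * ln (INR n)) <= E).
      { apply exp_le. assert (H2 := ln_INR_le m n ltac:(lia)). nra. }
      replace (B * INR n * (/ (INR n * INR n * INR n) * exp (- (Re s - 3) * ln (INR n)))) with
        (B * / (INR n * INR n) * exp (- (Re s - 3) * ln (INR n))) by (field; lra).
      replace (B * E * / (INR n * INR n)) with (B * / (INR n * INR n) * E) by ring.
      apply Rmult_le_compat_l; auto. pos.
    + rewrite Hv by lia. rewrite Cmult_0_l, Cmod_0. auto.
  - rewrite rsum_scal. assert (H2 := rsum_inv_sq N).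
    assert (0 <= B * E) by pos.
    assert (B * E * rsum (fun k => / (INR k * INR k)) N <= B * E * 2) by (apply Rmult_le_compat_l; auto). lra.
Qed.

Lemma cv_C0_single c k : (1 <= k)%nat ->
  cv_C0 (fun j => if (j =? k)%nat then c else RtoC 0) (fun s => c * nat_Cpow k (- s))%C.
Proof.
  intros Hk s Hs eta He. exists k. intros n Hn.
  rewrite (csum_ext _ (fun j => if (j =? k)%nat then c * nat_Cpow k (- s) else RtoC 0)%C).
  rewrite csum_single by lia. replace (c * nat_Cpow k (- s) - c * nat_Cpow k (- s))%C with (RtoC 0) by ring. rewrite Cmod_0; lra.
  intros j _. unfold dirichlet_term. destruct (Nat.eqb_spec j k). now subst. ring.
Qed.

Lemma cv_C0_nat_Cpow k : (1 <= k)%nat ->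
  cv_C0 (fun j => if (j =? k)%nat then RtoC 1 else RtoC 0) (fun s => nat_Cpow k (- s)).
Proof.
  intros Hk s Hs eta He. destruct (cv_C0_single 1 k Hk s Hs eta He) as (N & HN). exists N. intros n Hn.
  specialize (HN n Hn). rewrite Cmult_1_l in HN. exact HN.
Qed.

Lemma cv_C0_minus a b F G : cv_C0 a F -> cv_C0 b G -> cv_C0 (fun j => a j - b j)%C (fun s => F s - G s)%C.
Proof.
  intros HF HG s Hs eta He. destruct (HF s Hs (eta / 2) ltac:(lra)) as (N1 & H1), (HG s Hs (eta / 2) ltac:(lra)) as (N2 & H2).
  exists (max N1 N2). intros n Hn. specialize (H1 n ltac:(lia)). specialize (H2 n ltac:(lia)).
  rewrite (csum_ext _ (fun k => dirichlet_term a s k - dirichlet_term b s k)%C) by (intros; apply dirichlet_term_minus).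
  rewrite csum_minus.
  match goal with |- Cmod (?x - ?y - (?z - ?w)) < _ => replace (x - y - (z - w))%C with ((x - z) - (y - w))%C by ring end.
  eapply Rle_lt_trans. apply Cmod_minus_le. lra.
Qed.

Lemma cv_C0_scal c a F : cv_C0 a F -> cv_C0 (fun j => c * a j)%C (fun s => c * F s)%C.
Proof.
  intros HF s Hs eta He. assert (Hc := Cmod_ge_0 c).
  destruct (HF s Hs (eta / (Cmod c + 1))) as (N & HN). pos.
  exists N. intros n Hn. specialize (HN n Hn).
  rewrite (csum_ext _ (fun k => c * dirichlet_term a s k)%C) by (intros; unfold dirichlet_term; ring).
  rewrite csum_scal. replace (c * csum (dirichlet_term a s) n - c * F s)%C with (c * (csum (dirichlet_term a s) n - F s))%C by ring.
  rewrite Cmod_mult. apply Rle_lt_trans with ((Cmod c) * (eta / (Cmod c + 1))). apply Rmult_le_compat_l; lra.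
  apply Rmult_lt_reg_r with (Cmod c + 1). lra. replace (Cmod c * (eta / (Cmod c + 1)) * (Cmod c + 1)) with (Cmod c * eta) by (field; lra). nra.
Qed.

Lemma ln_succ_gap m : (1 <= m)%nat -> 0 < ln (INR (S m)) - ln (INR m).
Proof.
  intros Hm. assert (ln (INR m) < ln (INR (S m))); [|lra]. apply ln_increasing. apply lt_0_INR; lia. apply lt_INR; lia.
Qed.

(** Without its leading monomial the series starts at m + 1 and loses a factor (m/(m+1))^(Re s). The
    estimate is uniform in Im s, so it can be used at phi(x) and at points chosen to rotate
    m^(-s). *)
Lemma leading_term a F m : cv_C0 a F -> (1 <= m)%nat -> vanish m a ->
  forall eta, 0 < eta -> exists x0, 3 <= x0 /\ forall s, x0 <= Re s -> Cmod (F s * nat_Cpow m s - a m) <= eta.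
Proof.
  intros HF Hm Hv eta He.
  set (G := fun s => (F s - a m * nat_Cpow m (- s))%C).
  set (b := fun j => (a j - (if (j =? m)%nat then a m else RtoC 0))%C).
  assert (HG : cv_C0 b G) by (apply cv_C0_minus; auto; now apply cv_C0_single).
  destruct (cv_C0_coef_linear b G HG) as (B & HB0 & HB).
  assert (Hgap := ln_succ_gap m Hm).
  set (K := 2 * B * exp (3 * ln (INR (S m)))).
  assert (HK : 0 <= K) by pos.
  destruct (tends_exp_decay (fun x => RtoC (K * exp (- ((ln (INR (S m)) - ln (INR m)) * x)))) K _ HK Hgap) with (eta := eta) as (x0 & H0); auto.
  { intros x _. rewrite Cmod_RtoC_nonneg. lra. pos. }
  exists (Rmax x0 3). split. apply Rmax_r. intros s Hs'.
  assert (Hs := Rle_trans _ _ _ (Rmax_r x0 3) Hs'). specialize (H0 (Re s) (Rle_trans _ _ _ (Rmax_l x0 3) Hs')).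
  rewrite <- RtoC_minus, Rminus_0_r, Cmod_RtoC_nonneg in H0 by (pos).
  eapply Rle_trans; [|exact H0].
  assert (Hd := cv_C0_decay b G B (S m) s HG ltac:(lra) HB ltac:(lia)).
  assert (Hvb : vanish (S m) b).
  { intros n Hn. unfold b. destruct (Nat.eqb_spec n m) as [->|]. ring. rewrite Hv by lia. ring. }
  specialize (Hd Hvb Hs).
  replace (F s * nat_Cpow m s - a m)%C with (G s * nat_Cpow m s)%C.
  2:{ unfold G. transitivity (F s * nat_Cpow m s - a m * (nat_Cpow m s * nat_Cpow m (- s)))%C. ring.
      rewrite nat_Cpow_opp. ring. }
  rewrite Cmod_mult, Cmod_nat_Cpow.
  apply Rle_trans with (2 * B * exp (- (Re s - 3) * ln (INR (S m))) * exp (Re s * ln (INR m))).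
  apply Rmult_le_compat_r; auto. left; apply exp_pos.
  right. unfold K. rewrite !Rmult_assoc. f_equal. f_equal. rewrite <- !exp_plus. f_equal. ring.
Qed.

Lemma leading_tends a F m : cv_C0 a F -> (1 <= m)%nat -> vanish m a ->
  tends (fun x => F (RtoC x) * nat_Cpow m (RtoC x))%C (a m).
Proof.
  intros HF Hm Hv eta He. destruct (leading_term a F m HF Hm Hv eta He) as (x0 & _ & H).
  exists x0. intros x Hx. exact (H (RtoC x) Hx).
Qed.

(** If the first nonzero coefficient had index n < m, then G(x) n^x would tend to it, but also to 0,
    being G(x) m^x times (n/m)^x. *)
Lemma leading_unique b G m alpha : cv_C0 b G -> (1 <= m)%nat ->
  tends (fun x => G (RtoC x) * nat_Cpow m (RtoC x))%C alpha -> vanish m b /\ b m = alpha.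
Proof.
  intros HG Hm Ht.
  assert (Hv : forall n, (n <= m)%nat -> vanish n b).
  { induction n; intros Hn k Hk. lia.
    specialize (IHn ltac:(lia)). destruct (Nat.eq_dec k n) as [->|]; [|apply IHn; lia].
    apply (tends_unique (fun x => G (RtoC x) * nat_Cpow n (RtoC x))%C). apply leading_tends; auto; lia.
    set (g := ln (INR m) - ln (INR n)).
    assert (Hg : 0 < g). { unfold g. assert (ln (INR n) < ln (INR m)); [|lra]. apply ln_increasing. apply lt_0_INR; lia. apply lt_INR; lia. }
    replace (RtoC 0) with (alpha * 0)%C by ring.
    apply (tends_eventually (fun x => (G (RtoC x) * nat_Cpow m (RtoC x)) * RtoC (exp (- (g * x))))%C _ _ 0).
    - intros x _. rewrite !nat_Cpow_RtoC, <- Cmult_assoc. f_equal. rewrite <- RtoC_mult, <- exp_plus. f_equal. f_equal. unfold g; ring.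
    - apply tends_mult; auto. apply (tends_exp_decay _ 1 g); try lra.
      intros x _. rewrite Cmod_RtoC_nonneg. lra. left; apply exp_pos. }
  split. auto. apply (tends_unique (fun x => G (RtoC x) * nat_Cpow m (RtoC x))%C); auto. apply leading_tends; auto.
Qed.

Lemma tends_Cexp g l : tends g l -> tends (fun x => Cexp (g x)) (Cexp l).
Proof.
  intros H eta He. set (A := Cmod (Cexp l)). assert (HA : 0 < A) by (unfold A; rewrite Cmod_Cexp; apply exp_pos).
  destruct (H (Rmin 1 (eta / (3 * A)))) as (x0 & H0). pos.
  exists x0. intros x Hx. specialize (H0 x Hx). set (w := (g x - l)%C) in *.
  assert (B := Rmin_l 1 (eta / (3 * A))). assert (D := Rmin_r 1 (eta / (3 * A))).
  replace (g x) with (l + w)%C by (unfold w; ring). rewrite Cexp_plus.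
  replace (Cexp l * Cexp w - Cexp l)%C with (Cexp l * ((Cexp w - 1 - w) + w))%C by ring.
  rewrite Cmod_mult. fold A. assert (E := Cexp_linear w ltac:(lra)). assert (F := Cmod_ge_0 w).
  apply Rle_trans with (A * (3 * Cmod w)).
  - apply Rmult_le_compat_l. lra. apply Cmod_triangle_le. nra.
  - apply Rle_trans with (A * (3 * (eta / (3 * A)))). apply Rmult_le_compat_l; lra. right; field; lra.
Qed.

(* The diagonal entries of [C_phi] with respect to the triangular system [k^-s]. *)
Definition diag (c0 : nat) (c : nat -> C) (m : nat) : C :=
  if (c0 =? 1)%nat then nat_Cpow m (- c 1%nat) else if (m =? 1)%nat then RtoC 1 else RtoC 0.

(** [real] sends an infinite supremum to 0, so [Psemi] means what it should only for functions known
    to be bounded; hence the majorant M. *)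
Lemma Psemi_lub eps f M : (forall s, half_plane eps s -> Cmod (f s) <= M) ->
  (forall s, half_plane eps s -> Cmod (f s) <= Psemi eps f) /\ Psemi eps f <= M.
Proof.
  intros HM. unfold Psemi.
  set (E := fun x : R => exists s : C, half_plane eps s /\ x = Cmod (f s)).
  destruct (Lub_Rbar_correct E) as [Hub Hleast].
  set (s1 := RtoC (eps + 1)).
  assert (Hs1 : half_plane eps s1) by (unfold half_plane, s1; simpl; lra).
  assert (HE1 : E (Cmod (f s1))) by (exists s1; auto).
  assert (HMub : is_ub_Rbar E (Finite M)). { intros x (s & Hs & ->). simpl. auto. }
  specialize (Hleast _ HMub). assert (Hub1 := Hub _ HE1).
  destruct (Lub_Rbar E) as [l| |]; simpl in *; try contradiction.
  split; auto. intros s Hs. apply (Hub (Cmod (f s))). exists s; auto.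
Qed.

Lemma Hinf_minus_bounded f g eps : Hinf_plus f -> Hinf_plus g -> 0 < eps ->
  exists M, forall s, half_plane eps s -> Cmod (g s - f s) <= M.
Proof.
  intros Hf Hg He. apply Hinf_approx in Hf, Hg.
  destruct (approx_bounded _ (approx_minus _ _ Hg Hf) eps He) as (M & HM). exists M. exact HM.
Qed.

Lemma Hinf_monomial m : (1 <= m)%nat -> Hinf_plus (fun s => nat_Cpow m (- s)).
Proof. intros. now apply approx_Hinf, approx_nat_Cpow. Qed.

(** * Composition by a symbol in the Gordon-Hedenmalm class *)

Section Symbol.

Variables (c0 : nat) (c : nat -> C) (phi : C -> C).
Let psi := fun s => (phi s - RtoC (INR c0) * s)%C.
Hypothesis Hc0 : (1 <= c0)%nat.
Hypothesis Hcvu : cvu_C0 c psi.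
Hypothesis Hmap : maps_C0 psi.

Lemma symbol_split s : phi s = (RtoC (INR c0) * s + psi s)%C.
Proof. unfold psi. ring. Qed.

Lemma symbol_Re s : Re (phi s) = INR c0 * Re s + Re (psi s).
Proof. rewrite symbol_split. unfold Re, RtoC; simpl. ring. Qed.

Lemma symbol_Re_ge s : half_plane 0 s -> Re s <= Re (phi s).
Proof.
  intros Hs. rewrite symbol_Re. assert (H := Hmap s Hs). unfold half_plane in *.
  assert (1 <= INR c0) by (apply (le_INR 1); lia). nra.
Qed.

Lemma symbol_half_plane eps s : 0 <= eps -> half_plane eps s -> half_plane eps (phi s).
Proof.
  intros He Hs. assert (H := symbol_Re_ge s (half_plane_le 0 eps s He Hs)). unfold half_plane in *. lra.
Qed.

Lemma psi_cv : cv_C0 c psi.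
Proof.
  intros s Hs eta He. unfold half_plane in Hs. destruct (Hcvu (Re s / 2) ltac:(lra) eta He) as (N & HN).
  exists N. intros n Hn. rewrite <- dirichlet_partial_sum_csum. apply HN; auto. unfold half_plane; lra.
Qed.

Lemma psi_approx : approx psi.
Proof. now apply (approx_cvu c). Qed.

Lemma approx_symbol F : approx F -> approx (fun s => F (phi s)).
Proof.
  intros H. eapply approx_ext; [|apply (approx_comp F psi c0 Hc0 psi_approx Hmap H)].
  intros s _. now rewrite <- symbol_split.
Qed.

Lemma psi_tends : tends (fun x => psi (RtoC x)) (c 1%nat).
Proof.
  apply (tends_eventually (fun x => psi (RtoC x) * nat_Cpow 1 (RtoC x))%C _ _ 0).
  intros x _. rewrite nat_Cpow_1. ring. apply leading_tends. apply psi_cv. lia. intros n Hn; lia.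
Qed.

(** If c0 = 1 then x - phi(x) = -psi(x) tends to -c_1. If c0 >= 2 its real part is at most -x, and
    m^(x - phi(x)) tends to 0 unless m = 1. *)
Lemma symbol_tends m : (1 <= m)%nat -> tends (fun x => nat_Cpow m (RtoC x - phi (RtoC x))) (diag c0 c m).
Proof.
  intros Hm. unfold diag. destruct (Nat.eqb_spec c0 1) as [E|E].
  - unfold nat_Cpow. apply tends_Cexp.
    apply (tends_eventually (fun x => (-1) * psi (RtoC x) * RtoC (ln (INR m)))%C _ _ 0).
    intros x _. rewrite symbol_split, E. simpl INR. ring.
    replace (- c 1%nat * RtoC (ln (INR m)))%C with ((-1) * c 1%nat * RtoC (ln (INR m)))%C by ring.
    apply tends_mult. apply tends_mult. apply tends_const. apply psi_tends. apply tends_const.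
  - destruct (Nat.eqb_spec m 1) as [->|Hm1].
    + apply (tends_eventually (fun _ => RtoC 1) _ _ 0). intros; now rewrite nat_Cpow_1. apply tends_const.
    + assert (Hl : 0 < ln (INR m)). { rewrite <- ln_1. apply ln_increasing. lra. apply (lt_INR 1). lia. }
      intros eta He. destruct (tends_exp_decay (fun x => RtoC (exp (- (ln (INR m) * x)))) 1 (ln (INR m))) with (eta := eta) as (x0 & H0); auto; try lra.
      { intros x _. rewrite Cmod_RtoC_nonneg. lra. left; apply exp_pos. }
      exists (Rmax x0 1). intros x Hx. assert (A := Rmax_l x0 1). assert (B := Rmax_r x0 1).
      specialize (H0 x ltac:(lra)).
      rewrite <- RtoC_minus, Rminus_0_r, Cmod_RtoC_nonneg in H0 by (left; apply exp_pos).
      replace (nat_Cpow m (RtoC x - phi (RtoC x)) - 0)%C with (nat_Cpow m (RtoC x - phi (RtoC x))) by ring.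
      eapply Rle_trans; [|exact H0]. rewrite Cmod_nat_Cpow. apply exp_le.
      assert (Re (RtoC x - phi (RtoC x)) <= - x).
      { replace (Re (RtoC x - phi (RtoC x))) with (x - Re (phi (RtoC x))) by (unfold Re, RtoC; simpl; ring).
        rewrite symbol_Re. assert (H1 := Hmap (RtoC x)). unfold half_plane in H1. simpl in H1. specialize (H1 ltac:(lra)).
        simpl. assert (2 <= INR c0) by (apply (le_INR 2); lia). nra. }
      nra.
Qed.

(** Write f(phi(x)) m^x as f(phi(x)) m^(phi(x)) times m^(x - phi(x)); the first factor tends to
    [a m] because Re phi(x) >= x. *)
Lemma comp_leading_tends a f m : cv_C0 a f -> (1 <= m)%nat -> vanish m a ->
  tends (fun x => f (phi (RtoC x)) * nat_Cpow m (RtoC x))%C (diag c0 c m * a m)%C.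
Proof.
  intros Hf Hm Hv. rewrite Cmult_comm.
  apply (tends_eventually (fun x => (f (phi (RtoC x)) * nat_Cpow m (phi (RtoC x))) * nat_Cpow m (RtoC x - phi (RtoC x)))%C _ _ 0).
  { intros x _. rewrite <- Cmult_assoc, <- nat_Cpow_plus. f_equal. f_equal. ring. }
  apply tends_mult; [|now apply symbol_tends].
  intros eta He. destruct (leading_term a f m Hf Hm Hv eta He) as (x0 & H3 & H).
  exists x0. intros x Hx. apply H. apply Rle_trans with x; auto.
  apply (symbol_Re_ge (RtoC x)). unfold half_plane; simpl; lra.
Qed.

(** The whole use made of triangularity: the leading coefficient of f is multiplied by diag -
    lambda. *)
Lemma eigen_leading lambda a f b g m : cv_C0 a f -> cv_C0 b g ->
  (forall s, half_plane 0 s -> (f (phi s) - lambda * f s)%C = g s) ->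
  (1 <= m)%nat -> vanish m a -> vanish m b /\ b m = ((diag c0 c m - lambda) * a m)%C.
Proof.
  intros Hf Hg E Hm Hv. apply (leading_unique b g m); auto.
  apply (tends_eventually (fun x => f (phi (RtoC x)) * nat_Cpow m (RtoC x) + (- lambda) * (f (RtoC x) * nat_Cpow m (RtoC x)))%C _ _ 1).
  intros x Hx. rewrite <- E by (unfold half_plane; simpl; lra). ring.
  replace ((diag c0 c m - lambda) * a m)%C with (diag c0 c m * a m + (- lambda) * a m)%C by ring.
  apply tends_plus. now apply comp_leading_tends. apply tends_mult. apply tends_const. now apply leading_tends.
Qed.

(** At each order below m the factor diag - lambda in [eigen_leading] is nonzero and can be divided
    out. *)
Lemma vanish_from_diag lambda a f b g m : cv_C0 a f -> cv_C0 b g ->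
  (forall s, half_plane 0 s -> (f (phi s) - lambda * f s)%C = g s) ->
  (forall j, (1 <= j < m)%nat -> diag c0 c j <> lambda) -> vanish m b -> vanish m a.
Proof.
  intros Hf Hg E Hd Hb.
  assert (H : forall n, (n <= m)%nat -> vanish n a); [|now apply H].
  induction n; intros Hn k Hk. lia.
  specialize (IHn ltac:(lia)). destruct (Nat.eq_dec k n) as [->|]; [|apply IHn; lia].
  destruct (eigen_leading lambda a f b g n Hf Hg E ltac:(lia) IHn) as [_ H].
  rewrite Hb in H by lia. destruct (Ceq_dec (a n) 0) as [|Hn0]; auto.
  exfalso. apply (Cmult_neq_0 (diag c0 c n - lambda) (a n)); auto.
  intros E1. apply (Hd n ltac:(lia)). transitivity (diag c0 c n - lambda + lambda)%C. ring. rewrite E1; ring.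
Qed.

Lemma eigen_injective lambda f : Hinf_plus f -> (forall j, (1 <= j)%nat -> diag c0 c j <> lambda) ->
  (forall s, half_plane 0 s -> (f (phi s) - lambda * f s)%C = RtoC 0) -> eq_C0 f (fun _ => RtoC 0).
Proof.
  intros Hf Hd E. destruct (Hinf_coefs f Hf) as (a & Ha & _).
  assert (Ha0 : forall n, (1 <= n)%nat -> a n = RtoC 0).
  { intros n Hn. apply (vanish_from_diag lambda a f (fun _ => RtoC 0) (fun _ => RtoC 0) (S n)); auto.
    - intros s Hs eta He. exists 0%nat. intros k _. rewrite (csum_ext _ (fun _ => RtoC 0)). rewrite csum_zero.
      replace (0 - 0)%C with (RtoC 0) by ring. rewrite Cmod_0; lra. intros; unfold dirichlet_term; ring.
    - intros j Hj; apply Hd; lia.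
    - intros j Hj; auto. }
  intros s Hs. apply Cmod_small. intros eta He. destruct (Ha s Hs eta He) as (N & HN). specialize (HN N (le_n _)).
  rewrite (csum_ext _ (fun _ => RtoC 0)) in HN. rewrite csum_zero, Cmod_minus_sym in HN.
  replace (f s - 0)%C with (f s) in HN by ring. lra.
  intros k Hk. unfold dirichlet_term. rewrite Ha0 by lia. ring.
Qed.

(** Otherwise psi - c_1 still has positive real part. Its leading term b_m m^(-s), with m >= 2,
    takes every argument along a vertical line far to the right, so each b_m vanishes in turn and
    psi - c_1 is 0 at s = 1, a contradiction. *)
Lemma c1_Re_pos : 0 < Re (c 1%nat).
Proof.
  apply Rnot_le_lt. intros Hle.
  set (G := fun s => (psi s - c 1%nat * nat_Cpow 1 (- s))%C).
  set (b := fun j => (c j - (if (j =? 1)%nat then c 1%nat else RtoC 0))%C).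
  assert (HG : cv_C0 b G) by (apply cv_C0_minus; [apply psi_cv|now apply cv_C0_single]).
  assert (HGpos : forall s, half_plane 0 s -> 0 < Re (G s)).
  { intros s Hs. unfold G. rewrite nat_Cpow_1. replace (Re (psi s - c 1%nat * 1)) with (Re (psi s) - Re (c 1%nat)) by (unfold Re, RtoC; simpl; ring).
    assert (H := Hmap s Hs). unfold half_plane in H. lra. }
  assert (Hb : forall m, vanish m b).
  { induction m; intros n Hn. lia.
    destruct (Nat.eq_dec n m) as [->|]; [|apply IHm; lia].
    destruct (Nat.eq_dec m 1) as [->|Hm1]. unfold b. simpl. ring.
    assert (Hl : 0 < ln (INR m)). { rewrite <- ln_1. apply ln_increasing. lra. apply (lt_INR 1). lia. }
    assert (Hrot : forall th, 0 <= Re (cis th * b m)).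
    { intros th. apply Rnot_lt_le. intros Hneg. set (d := - Re (cis th * b m)).
      destruct (leading_term b G m HG ltac:(lia) IHm (d / 2) ltac:(unfold d; lra)) as (x & Hx3 & H).
      (* The imaginary part -th / ln m gives m^(-s) the argument [th]. *)
      set (s := (RtoC x + (0, (- th / ln (INR m))%R))%C).
      assert (Hs : Re s = x) by (unfold s, Re, RtoC; simpl; ring).
      assert (H1 := H s ltac:(lra)).
      assert (H2 := HGpos s ltac:(unfold half_plane; lra)).
      assert (E : nat_Cpow m (- s) = (RtoC (exp (- x * ln (INR m))) * cis th)%C).
      { unfold s. rewrite nat_Cpow_vertical, <- RtoC_opp, nat_Cpow_RtoC. f_equal. f_equal. field. lra. }
      assert (EG : G s = (RtoC (exp (- x * ln (INR m))) * (cis th * (G s * nat_Cpow m s)))%C).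
      { transitivity (G s * (nat_Cpow m s * nat_Cpow m (- s)))%C. rewrite nat_Cpow_opp; ring. rewrite E; ring. }
      set (w := (G s * nat_Cpow m s)%C) in *.
      assert (Re (cis th * w) <= - d / 2).
      { replace (cis th * w)%C with (cis th * b m + cis th * (w - b m))%C by ring.
        change (Re (cis th * b m) + Re (cis th * (w - b m)) <= - d / 2).
        assert (H3 := Re_le_Cmod (cis th * (w - b m))). rewrite Cmod_mult, Cmod_cis in H3. unfold d in *. lra. }
      rewrite EG in H2. replace (Re (RtoC (exp (- x * ln (INR m))) * (cis th * w))) with (exp (- x * ln (INR m)) * Re (cis th * w)) in H2
        by (unfold Re, RtoC; simpl; ring).
      assert (H5 := exp_pos (- x * ln (INR m))). unfold d in *. nra. }
    (* The four directions 1, -1, i, -i suffice to force [b m] to be 0. *)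
    assert (R1 := Hrot 0). assert (R2 := Hrot PI). assert (R3 := Hrot (PI / 2)). assert (R4 := Hrot (- (PI / 2))).
    unfold cis in *. rewrite cos_0, sin_0 in R1. rewrite cos_PI, sin_PI in R2. rewrite cos_neg, sin_neg in R4.
    rewrite cos_PI2, sin_PI2 in R3, R4.
    destruct (b m) as [u v]. unfold Re in *. simpl in *. unfold RtoC. f_equal; lra. }
  assert (H0 : G (RtoC 1) = RtoC 0).
  { apply Cmod_small. intros eta He. destruct (HG (RtoC 1) ltac:(unfold half_plane; simpl; lra) eta He) as (N & HN).
    specialize (HN N (le_n _)). rewrite (csum_ext _ (fun _ => RtoC 0)) in HN. rewrite csum_zero, Cmod_minus_sym in HN.
    replace (G (RtoC 1) - 0)%C with (G (RtoC 1)) in HN by ring. lra.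
    intros k Hk. unfold dirichlet_term. rewrite (Hb (S k)) by lia. ring. }
  assert (H1 := HGpos (RtoC 1) ltac:(unfold half_plane; simpl; lra)). rewrite H0 in H1. simpl in H1. lra.
Qed.

(* A sixth of the circle of radius Re s / 2 about s lies where Re psi >= kappa,
   and Re psi > 0 on the rest. *)
Lemma harnack_step kappa sigma : 0 < kappa -> 0 < sigma ->
  (forall s, sigma < Re s -> kappa <= Re (psi s)) ->
  forall s, 4 / 5 * sigma < Re s -> kappa / 6 <= Re (psi s).
Proof.
  intros Hk Hsig H s Hs. apply le_of_lt_all. intros eta He.
  (* Points of this circle at angle at most pi/3 have real part at least (5/4) Re s > sigma: the
     origin of 4/5. *)
  set (r := Re s / 2). assert (Hr : 0 < r < Re s) by (unfold r; lra).
  destruct (approx_circle psi s r psi_approx Hr eta He) as (N0 & HN0).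
  (* A multiple of six, so that the first k roots have angle at most pi/3. *)
  set (k := S N0). set (N := (6 * k)%nat). specialize (HN0 N ltac:(unfold N, k; lia)).
  assert (Hk0 : 0 < INR k) by pos.
  assert (HN : INR N = 6 * INR k) by (unfold N; rewrite mult_INR; simpl; ring).
  assert (HP := PI_RGT_0).
  assert (Hmean : kappa / 6 <= Re (cmean N (fun w => psi (s + RtoC r * w)%C))).
  { unfold cmean. set (S := csum (fun j => psi (s + RtoC r * root N j)%C) N).
    replace (Re (RtoC (/ INR N) * S)) with (/ INR N * Re S) by (unfold Re, RtoC; simpl; ring).
    assert (HS : INR k * kappa <= Re S).
    { unfold S. rewrite Re_csum. apply Rle_trans with (rsum (fun j => if (j <=? k)%nat then kappa else 0) N).
      - right. assert (Hgen : forall M, (k <= M)%nat -> rsum (fun j => if (j <=? k)%nat then kappa else 0) M = INR k * kappa).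
        { intros M HM. induction HM.
          - rewrite <- rsum_const. apply rsum_ext. intros j Hj. destruct (Nat.leb_spec j k); auto; lia.
          - cbn [rsum]. rewrite IHHM. destruct (Nat.leb_spec (Datatypes.S m) k); [lia|ring]. }
        symmetry. apply Hgen. unfold N; lia.
      - apply rsum_le. intros j Hj.
        destruct (Nat.leb_spec j k) as [Hjk|Hjk].
        + apply H. replace (Re (s + RtoC r * root N j)) with (Re s + r * Re (root N j)) by (unfold Re, RtoC; simpl; ring).
          assert (/ 2 <= Re (root N j)).
          { unfold root, cis, Re; simpl. rewrite <- (Rmult_1_l (/ 2)).
            change (1 / 2 <= cos (2 * PI * (INR j / INR N))). rewrite <- cos_PI3.
            assert (Hj0 : 0 <= INR j <= INR k) by (split; [apply pos_INR|apply le_INR; auto]).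
            assert (0 <= INR j / INR N <= / 6).
            { split. pos.
              apply Rmult_le_reg_r with (INR N). lra. unfold Rdiv. rewrite Rmult_assoc, Rinv_l by lra. lra. }
            apply cos_decr_1; nra. }
          unfold r in *. nra.
        + assert (H1 : half_plane 0 (s + RtoC r * root N j)%C).
          { unfold half_plane. assert (H2 := Re_circle s r (root N j) ltac:(lra) (Cmod_root N j)). lra. }
          assert (H2 := Hmap _ H1). unfold half_plane in H2. lra. }
    apply Rmult_le_reg_l with (INR N). lra. replace (INR N * (/ INR N * Re S)) with (Re S) by (field; lra).
    rewrite HN. lra. }
  set (m := cmean N (fun w => psi (s + RtoC r * w)%C)) in *.
  assert (H1 := Re_le_Cmod (m - psi s)). change (Re (m - psi s)) with (Re m - Re (psi s)) in H1. lra.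
Qed.

(** Far to the right psi is within Re(c_1)/2 of c_1. Each [harnack_step] moves the boundary left by
    the factor 4/5 at the price of a factor 6, and finitely many steps reach eps. *)
Lemma psi_lower eps : 0 < eps -> exists kappa, 0 < kappa /\ forall s, eps < Re s -> kappa <= Re (psi s).
Proof.
  intros He. assert (Hc1 := c1_Re_pos).
  destruct (leading_term c psi 1 psi_cv (le_n _) ltac:(intros n Hn; lia) (Re (c 1%nat) / 2) ltac:(lra)) as (sigma & Hs3 & H).
  assert (Hn : forall n s, (4 / 5) ^ n * sigma < Re s -> Re (c 1%nat) / 2 / 6 ^ n <= Re (psi s)).
  { induction n; intros s Hs.
    - rewrite pow_O, Rmult_1_l in Hs. rewrite pow_O. specialize (H s ltac:(lra)). rewrite nat_Cpow_1, Cmult_1_r in H.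
      assert (H1 := Re_ge_Cmod (psi s - c 1%nat)). change (Re (psi s - c 1%nat)) with (Re (psi s) - Re (c 1%nat)) in H1.
      unfold Rdiv. rewrite Rinv_1. lra.
    - assert (H6 : 0 < 6 ^ n) by pos.
      replace (Re (c 1%nat) / 2 / 6 ^ S n) with (Re (c 1%nat) / 2 / 6 ^ n / 6) by (simpl; field; lra).
      apply (harnack_step _ ((4 / 5) ^ n * sigma)).
      pos. pos. auto.
      simpl in Hs. lra. }
  destruct (pow_lt_1_zero (4 / 5) ltac:(rewrite Rabs_pos_eq; lra) (eps / sigma)) as (n & Hn0).
  pos. specialize (Hn0 n (le_n _)).
  exists (Re (c 1%nat) / 2 / 6 ^ n). split. pos.
  intros s Hs. apply Hn. eapply Rle_lt_trans; [|exact Hs].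
  apply Rle_trans with (eps / sigma * sigma). apply Rmult_le_compat_r. lra. eapply Rle_trans; [apply Rle_abs|lra].
  right; field; lra.
Qed.

Lemma symbol_growth eps : 0 < eps -> exists kappa, 0 < kappa /\ forall s, half_plane eps s -> Re s + kappa <= Re (phi s).
Proof.
  intros He. destruct (psi_lower eps He) as (kappa & Hk & H). exists kappa. split; auto.
  intros s Hs. unfold half_plane in Hs. rewrite symbol_Re. specialize (H s Hs).
  assert (1 <= INR c0) by (apply (le_INR 1); lia). nra.
Qed.

(** * Orbits and the Neumann series *)

Fixpoint orbit (k : nat) (s : C) : C := match k with O => s | S j => orbit j (phi s) end.

Lemma orbit_plus j k s : orbit (j + k) s = orbit k (orbit j s).
Proof. revert s. induction j; intros s; simpl; auto. Qed.

Lemma orbit_half_plane eps k s : 0 <= eps -> half_plane eps s -> half_plane eps (orbit k s).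
Proof. intros He. revert s. induction k; intros s Hs; simpl; auto. apply IHk. now apply symbol_half_plane. Qed.

Lemma orbit_linear eps kappa k s : 0 <= eps -> (forall s, half_plane eps s -> Re s + kappa <= Re (phi s)) ->
  half_plane eps s -> Re s + INR k * kappa <= Re (orbit k s).
Proof.
  intros He H. revert s. induction k; intros s Hs.
  - simpl. lra.
  - rewrite S_INR. simpl orbit. specialize (IHk (phi s) (symbol_half_plane eps s He Hs)). specialize (H s Hs). lra.
Qed.

(** The speed [kappa] must not depend on eps, since it fixes the order m0 of vanishing. So the slow,
    eps-dependent growth is used only for k0 steps, until Re >= 3, and the growth valid on C_1 takes
    over; 3 is where the decay estimate starts. *)
Lemma orbit_escape : exists kappa, 0 < kappa /\ forall eps, 0 < eps -> exists k0,
  forall s k, half_plane eps s -> 3 + INR k * kappa <= Re (orbit (k0 + k) s).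
Proof.
  destruct (symbol_growth 1 ltac:(lra)) as (k1 & Hk1 & H1). exists k1. split; auto.
  intros eps He. destruct (symbol_growth eps He) as (ke & Hke & H2).
  destruct (nat_ceil (3 / ke)) as (k0 & Hk0 & _). pos.
  exists k0. intros s k Hs. rewrite orbit_plus.
  assert (H3 := orbit_linear eps ke k0 s ltac:(lra) H2 Hs).
  assert (3 <= INR k0 * ke). { apply Rmult_le_reg_r with (/ ke). now pos. rewrite Rmult_assoc, Rinv_r by lra. lra. }
  unfold half_plane in Hs.
  assert (H4 := orbit_linear 1 k1 k (orbit k0 s) ltac:(lra) H1 ltac:(unfold half_plane; lra)). lra.
Qed.

Lemma approx_orbit g k : approx g -> approx (fun s => g (orbit k s)).
Proof.
  intros H. induction k; simpl; auto. apply (approx_symbol (fun s => g (orbit k s))); auto.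
Qed.

(** The coefficient estimate at abscissa 1 > delta; it is linear in Q, as a continuous inverse
    requires. *)
Lemma Hinf_coef_linear b g Q delta : cvu_C0 b g -> 0 < delta <= / 2 ->
  (forall s, half_plane delta s -> Cmod (g s) <= Q) -> forall n, (1 <= n)%nat -> Cmod (b n) <= Q * INR n.
Proof.
  intros Hcv Hd HQ n Hn. rewrite <- (exp_ln (INR n)) by (apply lt_0_INR; lia). rewrite <- (Rmult_1_l (ln (INR n))).
  apply (cv_C0_coef_bound b g Q delta); auto; lra.
Qed.

(** Indexed from 1 to match [csum], hence the power k of 1/lambda with the iterate k - 1. *)
Definition neumann (lambda : C) (g : C -> C) (k : nat) (s : C) : C := (- (/ lambda) ^ k * g (orbit (k - 1) s))%C.

(** Each step of the orbit costs a factor |1/lambda| and, once the escape is linear, gains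
    m0^(-kappa). The k0 initial steps only enlarge D. *)
Lemma neumann_bound lambda : lambda <> RtoC 0 -> exists m0, (1 <= m0)%nat /\ forall eps, 0 < eps -> exists D, 0 < D /\
  forall b g Q, cv_C0 b g -> cvu_C0 b g -> vanish m0 b ->
  (forall s, half_plane (Rmin eps (/ 2)) s -> Cmod (g s) <= Q) ->
  forall s k, half_plane eps s -> (1 <= k)%nat -> Cmod (neumann lambda g k s) <= Q * D * (/ 2) ^ k.
Proof.
  intros Hl. destruct orbit_escape as (k1 & Hk1 & Hesc).
  set (mu := Cmod (/ lambda)).
  assert (Hmu : 0 < mu). { unfold mu. rewrite Cmod_inv by auto. pos. now apply Cmod_gt_0. }
  (* This makes kappa ln m0 >= 2 mu, hence m0^kappa >= 2 mu: the ratio of the series is at most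
     1/2. *)
  destruct (nat_ceil (exp (2 * mu / k1))) as (m0 & Hm0 & _). left; apply exp_pos.
  assert (Hm0' : 0 < INR m0) by (eapply Rlt_le_trans; [apply exp_pos|exact Hm0]).
  assert (Hm1 : (1 <= m0)%nat) by (apply (INR_lt 0) in Hm0'; lia).
  exists m0. split; auto.
  assert (Hq : exp (- k1 * ln (INR m0)) * mu <= / 2).
  { assert (H : 2 * mu / k1 <= ln (INR m0)). { rewrite <- (ln_exp (2 * mu / k1)). apply ln_le; auto. apply exp_pos. }
    assert (H' : 2 * mu <= k1 * ln (INR m0)).
    { replace (2 * mu) with (k1 * (2 * mu / k1)) by (field; lra). apply Rmult_le_compat_l; lra. }
    replace (- k1 * ln (INR m0)) with (- (k1 * ln (INR m0))) by ring. rewrite exp_Ropp.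
    assert (H2 := exp_ineq1_le (k1 * ln (INR m0))).
    assert (H3 := exp_pos (k1 * ln (INR m0))). set (x := exp (k1 * ln (INR m0))) in *.
    apply Rmult_le_reg_l with x; auto. replace (x * (/ x * mu)) with mu by (field; lra). lra. }
  set (q := exp (- k1 * ln (INR m0))) in *. assert (Hq0 : 0 < q) by pos.
  intros eps He. destruct (Hesc eps He) as (k0 & Hk0).
  (* The base 1 + mu dominates all powers of mu up to k0 + 1, whether mu is below or above 1. *)
  set (E := (1 + mu) ^ (S k0)). assert (HE : 0 < E) by pos.
  exists (2 * E * 2 ^ k0 * 2). split. { assert (0 < 2 ^ k0) by pos. assert (0 < E * 2 ^ k0) by pos. lra. }
  intros b g Q Hcv Hcvu' Hvan HQ s k Hs Hk.
  assert (Hd : 0 < Rmin eps (/ 2) <= / 2) by (split; [pos|apply Rmin_r]).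
  assert (HB := Hinf_coef_linear b g Q _ Hcvu' Hd HQ).
  assert (HQ0 : 0 <= Q). { eapply Rle_trans; [apply Cmod_ge_0|]. apply (HQ s). eapply half_plane_le; [apply Rmin_l|exact Hs]. }
  destruct k as [|k]; [lia|]. clear Hk. unfold neumann. replace (S k - 1)%nat with k by lia.
  rewrite Cmod_mult, Cmod_opp, Cmod_pow. fold mu.
  assert (H2k : (/ 2) ^ S k * 2 = (/ 2) ^ k) by (simpl; field).
  replace (Q * (2 * E * 2 ^ k0 * 2) * (/ 2) ^ S k) with (Q * (2 * E * 2 ^ k0) * (/ 2) ^ k) by (rewrite <- H2k; ring).
  assert (Hpow2 : forall n, 2 ^ n * (/ 2) ^ n = 1).
  { intros n. rewrite <- Rpow_mult_distr. replace (2 * / 2) with 1 by field. apply pow1. }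
  assert (HmuE : forall n, (n <= S k0)%nat -> mu ^ n <= E).
  { intros n Hn. apply Rle_trans with ((1 + mu) ^ n). apply pow_incr; lra. apply Rle_pow; auto; lra. }
  destruct (le_lt_dec k0 k) as [Hkk|Hkk].
  - set (j := (k - k0)%nat). assert (Ek : k = (k0 + j)%nat) by lia. rewrite Ek.
    specialize (Hk0 s j Hs).
    assert (Hj := pos_INR j). assert (Hjk : 0 <= INR j * k1) by pos.
    assert (Hg := cv_C0_decay b g Q m0 (orbit (k0 + j) s) Hcv HQ0 HB Hm1 Hvan ltac:(lra)).
    assert (Hg' : Cmod (g (orbit (k0 + j) s)) <= 2 * Q * q ^ j).
    { eapply Rle_trans. apply Hg. apply Rmult_le_compat_l. lra. unfold q. rewrite exp_pow. apply exp_le.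
      assert (H := ln_INR_nonneg m0 Hm1). nra. }
    replace (mu ^ S (k0 + j)) with (mu ^ S k0 * mu ^ j) by (simpl; rewrite pow_add; ring).
    apply Rle_trans with (mu ^ S k0 * mu ^ j * (2 * Q * q ^ j)).
    apply Rmult_le_compat_l; auto. pos.
    replace (mu ^ S k0 * mu ^ j * (2 * Q * q ^ j)) with (2 * Q * mu ^ S k0 * (q * mu) ^ j) by (rewrite Rpow_mult_distr; ring).
    rewrite (pow_add (/ 2)).
    replace (Q * (2 * E * 2 ^ k0) * ((/ 2) ^ k0 * (/ 2) ^ j)) with (2 * Q * E * (/ 2) ^ j * (2 ^ k0 * (/ 2) ^ k0)) by ring.
    rewrite Hpow2, Rmult_1_r.
    apply Rmult_le_compat. pos. pos.
    apply Rmult_le_compat_l. lra. apply HmuE; lia. apply pow_incr. split. pos. exact Hq.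
  - assert (Hg : Cmod (g (orbit k s)) <= Q).
    { apply HQ. apply orbit_half_plane. lra. eapply half_plane_le; [apply Rmin_l|exact Hs]. }
    apply Rle_trans with (E * Q). apply Rmult_le_compat; [pos|apply Cmod_ge_0|apply HmuE; lia|auto].
    assert (1 <= 2 ^ k0 * (/ 2) ^ k).
    { rewrite <- (Hpow2 k) at 1. apply Rmult_le_compat_r. pos. apply Rle_pow; [lra|lia]. }
    assert (0 <= E * Q) by pos.
    replace (Q * (2 * E * 2 ^ k0) * (/ 2) ^ k) with (2 * (E * Q) * (2 ^ k0 * (/ 2) ^ k)) by ring.
    assert (2 * (E * Q) * 1 <= 2 * (E * Q) * (2 ^ k0 * (/ 2) ^ k)) by (apply Rmult_le_compat_l; lra). lra.
Qed.

Lemma csum_geometric_tail (t : nat -> C) K N M : (N <= M)%nat ->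
  (forall k, (1 <= k)%nat -> Cmod (t k) <= K * (/ 2) ^ k) -> Cmod (csum t M - csum t N) <= K * (/ 2) ^ N - K * (/ 2) ^ M.
Proof.
  intros HNM H. assert (H1 := csum_tail_le t (fun k => 2 * K * (/ 2) ^ k) N M HNM).
  simpl in H1. eapply Rle_trans. apply H1. 2: right; field.
  intros k Hk. eapply Rle_trans. apply H; lia. right; field.
Qed.

(** Solvability together with a seminorm bound, so that continuity of the inverse comes from the
    construction. Here f may depend on eps; uniqueness removes this dependence later. *)
Definition resolvent_estimate (lambda : C) (m : nat) : Prop := forall eps, 0 < eps ->
  exists delta K, 0 < delta /\ 0 <= K /\
  forall b g Q, cv_C0 b g -> cvu_C0 b g -> vanish m b ->
  (forall s, half_plane delta s -> Cmod (g s) <= Q) ->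
  exists f, approx f /\ (forall s, half_plane 0 s -> (f (phi s) - lambda * f s)%C = g s) /\
    forall s, half_plane eps s -> Cmod (f s) <= K * Q.

Lemma resolvent_high lambda : lambda <> RtoC 0 -> exists m0, (1 <= m0)%nat /\ resolvent_estimate lambda m0.
Proof.
  intros Hl. destruct (neumann_bound lambda Hl) as (m0 & Hm0 & Hb). exists m0. split; auto.
  intros eps He. destruct (Hb eps He) as (D0 & HD0 & Hb0).
  exists (Rmin eps (/ 2)), D0. split. pos. split. lra.
  intros b g Q Hcv Hcvu' Hvan HQ.
  assert (Hga : approx g) by now apply (approx_cvu b).
  assert (Hgeo : forall e, 0 < e -> exists K, 0 < K /\ forall s k, half_plane e s -> (1 <= k)%nat -> Cmod (neumann lambda g k s) <= K * (/ 2) ^ k).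
  { intros e He'. destruct (Hb e He') as (D & HD & Hb1).
    destruct (approx_bounded g Hga (Rmin e (/ 2)) ltac:(pos)) as (M & HM).
    exists ((Rabs M + 1) * D). split. pos. assert (H := Rabs_pos M); lra.
    apply (Hb1 b); auto. intros s Hs. eapply Rle_trans. apply HM; auto. assert (H := Rle_abs M). lra. }
  assert (Hsmall : forall K eta, 0 < eta -> exists n0, forall n, (n0 <= n)%nat -> K * (/ 2) ^ n < eta).
  { intros K eta Heta. assert (HK := Rabs_pos K).
    destruct (pow_lt_1_zero (/ 2) ltac:(rewrite Rabs_pos_eq; lra) (eta / (Rabs K + 1))) as (n0 & H0).
    pos. exists n0. intros n Hn. specialize (H0 n Hn).
    assert (H2 : 0 <= (/ 2) ^ n) by pos. rewrite Rabs_pos_eq in H0 by auto.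
    apply Rle_lt_trans with ((Rabs K + 1) * (/ 2) ^ n). apply Rmult_le_compat_r; auto. assert (H := Rle_abs K); lra.
    apply Rmult_lt_reg_r with (/ (Rabs K + 1)). pos.
    replace ((Rabs K + 1) * (/ 2) ^ n * / (Rabs K + 1)) with ((/ 2) ^ n) by (field; lra). exact H0. }
  set (Sn := fun n s => csum (fun k => neumann lambda g k s) n).
  assert (Hlim : forall s, exists l, half_plane 0 s -> forall eta, 0 < eta -> exists n0, forall n, (n0 <= n)%nat -> Cmod (Sn n s - l) < eta).
  { intros s. destruct (Rlt_dec 0 (Re s)) as [Hs|Hs].
    2:{ exists (RtoC 0). intros H. exfalso. apply Hs, H. }
    destruct (Hgeo (Re s / 2) ltac:(lra)) as (K & HK & HKb).
    destruct (cauchy_limit (fun n => Sn n s)) as (l & Hl0); [|exists l; auto].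
    assert (Hpair : forall i j, (i <= j)%nat -> Cmod (Sn j s - Sn i s) <= K * (/ 2) ^ i).
    { intros i j Hij. eapply Rle_trans. apply (csum_geometric_tail (fun k => neumann lambda g k s) K i j Hij).
      intros k Hk. apply HKb; auto. unfold half_plane; lra.
      assert (0 <= K * (/ 2) ^ j) by pos. lra. }
    intros eta Heta. destruct (Hsmall K eta Heta) as (n0 & Hn0). exists n0. intros i j Hi Hj.
    destruct (le_lt_dec i j).
    - rewrite Cmod_minus_sym. eapply Rle_lt_trans. apply Hpair; auto. auto.
    - eapply Rle_lt_trans. apply Hpair. lia. auto. }
  set (f := fun s => proj1_sig (constructive_indefinite_description _ (Hlim s))).
  assert (Hf : forall s, half_plane 0 s -> forall eta, 0 < eta -> exists n0, forall n, (n0 <= n)%nat -> Cmod (Sn n s - f s) < eta).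
  { intros s. unfold f. apply proj2_sig. }
  assert (Hunif : forall e K, 0 < e -> 0 < K -> (forall s k, half_plane e s -> (1 <= k)%nat -> Cmod (neumann lambda g k s) <= K * (/ 2) ^ k) ->
     forall s n, half_plane e s -> Cmod (f s - Sn n s) <= K * (/ 2) ^ n).
  { intros e K He' HK HKb s n Hs. apply le_of_lt_all. intros eta Heta.
    destruct (Hf s (half_plane_le 0 e s ltac:(lra) Hs) eta Heta) as (n0 & Hn0). set (m := max n0 n).
    specialize (Hn0 m ltac:(lia)). rewrite Cmod_minus_sym in Hn0.
    assert (H1 := csum_geometric_tail (fun k => neumann lambda g k s) K n m ltac:(lia) (fun k Hk => HKb s k Hs Hk)).
    fold (Sn m s) (Sn n s) in H1.
    replace (f s - Sn n s)%C with ((f s - Sn m s) + (Sn m s - Sn n s))%C by ring.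
    apply Cmod_triangle_le.
    assert (0 <= K * (/ 2) ^ m) by pos. lra. }
  exists f. split; [|split].
  - apply approx_limit. intros e eta He' Heta. destruct (Hgeo e He') as (K & HK & HKb).
    destruct (Hsmall K eta Heta) as (n & Hn). exists (Sn n). split.
    + apply approx_csum. intros k. apply approx_scal. now apply approx_orbit.
    + intros s Hs. left. eapply Rle_lt_trans. apply (Hunif e K He' HK HKb s n Hs). auto.
  - intros s Hs.
    (* Composition with phi shifts the index by one, so the partial sums telescope to g plus lambda
       times the next term. *)
    assert (Htel : forall n, (Sn n (phi s) - lambda * Sn n s)%C = (g s - (/ lambda) ^ n * g (orbit n s))%C).
    { intros n. unfold Sn, neumann. induction n; cbn [csum]. simpl. ring.
      replace (S n - 1)%nat with n by lia.
      match goal with |- (?A + ?x - lambda * (?B + ?y) = _)%C => replace (A + x - lambda * (B + y))%C with ((A - lambda * B) + x - lambda * y)%C by ring end.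
      rewrite IHn. change (orbit (S n) s) with (orbit n (phi s)). rewrite Cpow_S. field. auto. }
    assert (E : (f (phi s) - lambda * f s - g s)%C = RtoC 0); [|transitivity (f (phi s) - lambda * f s - g s + g s)%C; [ring|rewrite E; ring]].
    apply Cmod_small. intros eta Heta.
    assert (Hs2 : 0 < Re s / 2) by pos.
    assert (Hs2' : half_plane (Re s / 2) s) by (unfold half_plane in *; lra).
    destruct (Hgeo (Re s / 2) Hs2) as (K & HK & HKb).
    assert (HL := Cmod_ge_0 lambda).
    destruct (Hsmall (K * (1 + 2 * Cmod lambda)) eta Heta) as (n & Hn). specialize (Hn n (le_n _)).
    assert (U1 := Hunif _ K Hs2 HK HKb (phi s) n (symbol_half_plane (Re s / 2) s ltac:(lra) Hs2')).
    assert (U2 := Hunif _ K Hs2 HK HKb s n Hs2').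
    assert (U3 := HKb s (S n) Hs2' ltac:(lia)).
    set (x := (/ 2) ^ n) in *. assert (Hx : 0 <= x) by pos.
    replace ((/ 2) ^ S n) with (x / 2) in U3 by (unfold x; simpl; field).
    replace (f (phi s) - lambda * f s - g s)%C with
      ((f (phi s) - Sn n (phi s)) - lambda * (f s - Sn n s) + lambda * neumann lambda g (S n) s)%C.
    2:{ transitivity ((f (phi s) - lambda * f s) - (Sn n (phi s) - lambda * Sn n s) + lambda * neumann lambda g (S n) s)%C. ring.
        rewrite Htel. unfold neumann. replace (S n - 1)%nat with n by lia. rewrite Cpow_S. field. auto. }
    apply Cmod_triangle_le. eapply Rle_trans. apply Rplus_le_compat_r, Cmod_minus_le. rewrite !Cmod_mult.
    assert (Cmod lambda * Cmod (f s - Sn n s) <= Cmod lambda * (K * x)) by (apply Rmult_le_compat_l; auto).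
    assert (Cmod lambda * Cmod (neumann lambda g (S n) s) <= Cmod lambda * (K * (x / 2))) by (apply Rmult_le_compat_l; auto).
    assert (0 <= Cmod lambda * (K * x)) by pos. lra.
  - intros s Hs. apply le_of_lt_all. intros eta Heta.
    destruct (Hf s (half_plane_le 0 eps s ltac:(lra) Hs) eta Heta) as (n & Hn). specialize (Hn n (le_n _)).
    assert (HQ0 : 0 <= Q). { eapply Rle_trans; [apply Cmod_ge_0|]. apply (HQ s). eapply half_plane_le; [apply Rmin_l|exact Hs]. }
    assert (H1 := csum_geometric_tail (fun k => neumann lambda g k s) (Q * D0) 0 n ltac:(lia)
       (fun k Hk => Hb0 b g Q Hcv Hcvu' Hvan HQ s k Hs Hk)).
    fold (Sn n s) in H1. simpl in H1. replace (Sn n s - 0)%C with (Sn n s) in H1 by ring.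
    assert (0 <= Q * D0 * (/ 2) ^ n) by pos.
    assert (H2 := Cmod_le_minus (f s) (Sn n s)). rewrite Cmod_minus_sym in Hn. lra.
Qed.

(** Descending induction on m, with [i] bounding the distance to m0. The coefficient b_m is removed
    by subtracting al h, where h is the image of m^(-s) and al = b_m / (diag - lambda) is O(Q). *)
Lemma resolvent_from lambda : lambda <> RtoC 0 -> (forall j, (1 <= j)%nat -> diag c0 c j <> lambda) ->
  forall m, (1 <= m)%nat -> resolvent_estimate lambda m.
Proof.
  intros Hl Hdiag. destruct (resolvent_high lambda Hl) as (m0 & Hm0 & Hhigh).
  assert (Hdown : forall i m, (1 <= m)%nat -> (m0 <= m + i)%nat -> resolvent_estimate lambda m).
  2:{ intros m Hm. apply (Hdown m0 m Hm). lia. }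
  induction i; intros m Hm Hmi eps He.
  - destruct (Hhigh eps He) as (delta & K & Hd & HK & H). exists delta, K. split; auto. split; auto.
    intros b g Q Hcv Hcvu' Hvan. apply (H b); auto. intros n Hn. apply Hvan. lia.
  - destruct (IHi (S m) ltac:(lia) ltac:(lia) eps He) as (delta & K & Hd & HK & H).
    set (e := fun s => nat_Cpow m (- s)). assert (Hea : approx e) by now apply approx_nat_Cpow.
    set (d := (diag c0 c m - lambda)%C).
    assert (Hd0 : d <> RtoC 0). { intros E. apply (Hdiag m Hm). transitivity (d + lambda)%C. unfold d; ring. rewrite E; ring. }
    assert (Hdm : 0 < Cmod d) by now apply Cmod_gt_0.
    set (h := fun s => (e (phi s) - lambda * e s)%C).
    assert (Hha : approx h). { apply approx_minus. now apply (approx_symbol e). now apply approx_scal. }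
    destruct (Hinf_coefs h (approx_Hinf h Hha)) as (hb & Hhb & _).
    assert (Hec := cv_C0_nat_Cpow m Hm). fold e in Hec.
    destruct (eigen_leading lambda _ e hb h m Hec Hhb ltac:(intros; reflexivity) Hm) as [Hhv Hhm].
    { intros n Hn. destruct (Nat.eqb_spec n m); auto; lia. }
    rewrite Nat.eqb_refl in Hhm. fold d in Hhm.
    assert (Heb : forall s, half_plane 0 s -> Cmod (e s) <= 1).
    { intros s Hs. unfold e. rewrite Cmod_nat_Cpow, <- exp_0. apply exp_le. change (Re (- s)) with (- Re s).
      assert (H1 := ln_INR_nonneg m Hm). unfold half_plane in Hs. nra. }
    assert (HL := Cmod_ge_0 lambda).
    set (A := INR m / Cmod d). assert (HA : 0 <= A) by pos.
    (* As |h| <= 1 + |lambda| and |al| <= A Q, the corrected datum is at most Q (1 + A (1 +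
       |lambda|)); the last A accounts for al m^(-s) in the solution. The cap 1/2 serves the
       coefficient bound. *)
    exists (Rmin delta (/ 2)), (K * (1 + A * (1 + Cmod lambda)) + A).
    assert (HA2 : 0 <= A * (1 + Cmod lambda)) by pos.
    split. pos. split. assert (0 <= K * (1 + A * (1 + Cmod lambda))) by pos. lra.
    intros b g Q Hcv Hcvu' Hvan HQ.
    assert (HB := Hinf_coef_linear b g Q (Rmin delta (/ 2)) Hcvu' ltac:(split; [pos|apply Rmin_r]) HQ m Hm).
    set (al := (b m / d)%C).
    assert (Hal : Cmod al <= A * Q).
    { unfold al. rewrite Cmod_div by auto. unfold A, Rdiv. replace (INR m * / Cmod d * Q) with (Q * INR m * / Cmod d) by ring.
      apply Rmult_le_compat_r; auto. left; now pos. }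
    assert (Hg'a : approx (fun s => g s - al * h s)%C).
    { apply approx_minus. now apply (approx_cvu b). now apply approx_scal. }
    assert (Hg'c : cv_C0 (fun j => b j - al * hb j)%C (fun s => g s - al * h s)%C) by (apply cv_C0_minus; auto; now apply cv_C0_scal).
    destruct (H (fun j => b j - al * hb j)%C (fun s => g s - al * h s)%C (Q * (1 + A * (1 + Cmod lambda))) Hg'c) as (f & Hfa & Hfe & Hfb).
    + apply bohr_uniform; auto. now apply approx_bounded.
    + intros n Hn. destruct (Nat.eq_dec n m) as [->|].
      * rewrite Hhm. unfold al. field. auto.
      * rewrite Hvan, Hhv by lia. ring.
    + intros s Hs. assert (Hs0 : half_plane 0 s) by (eapply half_plane_le; [|exact Hs]; lra).
      apply Cmod_minus_le_trans. rewrite Cmod_mult.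
      assert (Cmod (g s) <= Q) by (apply HQ; eapply half_plane_le; [apply Rmin_l|exact Hs]).
      assert (Cmod (h s) <= 1 + Cmod lambda).
      { unfold h. apply Cmod_minus_le_trans. rewrite Cmod_mult.
        assert (H2 := Heb (phi s) (symbol_half_plane 0 s (Rle_refl 0) Hs0)).
        assert (Cmod lambda * Cmod (e s) <= Cmod lambda * 1) by (apply Rmult_le_compat_l; auto). lra. }
      assert (Cmod al * Cmod (h s) <= A * Q * (1 + Cmod lambda)) by (apply Rmult_le_compat; auto; apply Cmod_ge_0). lra.
    + exists (fun s => f s + al * e s)%C. split; [|split].
      * apply approx_plus; auto. now apply approx_scal.
      * intros s Hs. transitivity ((f (phi s) - lambda * f s) + al * h s)%C. unfold h; ring.
        rewrite Hfe by auto. ring.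
      * intros s Hs. assert (Hs0 : half_plane 0 s) by (eapply half_plane_le; [|exact Hs]; lra).
        apply Cmod_triangle_le. rewrite Cmod_mult. specialize (Hfb s Hs).
        assert (Cmod al * Cmod (e s) <= A * Q * 1) by (apply Rmult_le_compat; auto; apply Cmod_ge_0). lra.
Qed.

(** * Invertibility of C_phi - lambda *)

Definition shifted (lambda : C) : operator := fun f s => (composition_operator phi f s - lambda * f s)%C.

Lemma shifted_Hinf lambda f : Hinf_plus f -> Hinf_plus (shifted lambda f).
Proof.
  intros Hf. apply Hinf_approx in Hf. apply approx_Hinf. apply approx_minus.
  apply (approx_symbol f Hf). now apply approx_scal.
Qed.

Lemma shifted_ext lambda f g : eq_C0 f g -> eq_C0 (shifted lambda f) (shifted lambda g).
Proof.
  intros E s Hs. unfold shifted, composition_operator. rewrite (E s Hs), E; auto.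
  apply (symbol_half_plane 0); auto. lra.
Qed.

(** The symbol maps C_eps into itself, so the same eps serves on both sides. *)
Lemma shifted_continuous lambda : continuous_operator (shifted lambda).
Proof.
  split; [split; [|split; [|split]]|].
  - apply shifted_Hinf.
  - intros f g _ _ E. now apply shifted_ext.
  - intros f g _ _ s _. unfold shifted, composition_operator. ring.
  - intros a f _ s _. unfold shifted, composition_operator. ring.
  - intros f Hf eps eta He Heta. assert (HL := Cmod_ge_0 lambda).
    exists eps, (eta / (2 * (1 + Cmod lambda))). split; auto. split. pos.
    intros g Hg HP. destruct (Hinf_minus_bounded f g eps Hf Hg He) as (M & HM).
    destruct (Psemi_lub eps (fun s => g s - f s)%C M HM) as [Hb _].
    set (rho := eta / (2 * (1 + Cmod lambda))) in *.
    apply Rle_lt_trans with (eta / 2); [|lra].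
    apply (Psemi_lub eps _ (eta / 2)). intros s Hs. unfold shifted, composition_operator.
    replace (g (phi s) - lambda * g s - (f (phi s) - lambda * f s))%C with
      ((g (phi s) - f (phi s)) - lambda * (g s - f s))%C by ring.
    apply Cmod_minus_le_trans. rewrite Cmod_mult.
    assert (H1 := Hb (phi s) (symbol_half_plane eps s ltac:(lra) Hs)). assert (H2 := Hb s Hs). cbv beta in *.
    assert (Cmod lambda * Cmod (g s - f s) <= Cmod lambda * rho) by (apply Rmult_le_compat_l; lra).
    apply Rle_trans with ((1 + Cmod lambda) * rho). lra. unfold rho. right. field. lra.
Qed.

(** Injectivity does most of the work: it makes the chosen preimage linear, and it identifies the
    preimage with the eps-dependent solutions, whose bounds give continuity. *)
Lemma shifted_invertible lambda : lambda <> RtoC 0 -> (forall j, (1 <= j)%nat -> diag c0 c j <> lambda) ->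
  invertible_operator (shifted lambda).
Proof.
  intros Hl Hdiag. split. apply shifted_continuous.
  set (sol := fun g f : C -> C => approx f /\ eq_C0 (shifted lambda f) g).
  assert (Hres := resolvent_from lambda Hl Hdiag 1 (le_n _)).
  assert (Hex : forall eps, 0 < eps -> exists delta K, 0 < delta /\ 0 <= K /\ forall g Q, Hinf_plus g ->
    (forall s, half_plane delta s -> Cmod (g s) <= Q) ->
    exists f, sol g f /\ forall s, half_plane eps s -> Cmod (f s) <= K * Q).
  { intros eps He. destruct (Hres eps He) as (delta & K & Hd & HK & H). exists delta, K. split; auto. split; auto.
    intros g Q Hg HQ. destruct (Hinf_coefs g Hg) as (b & Hb & Hb').
    destruct (H b g Q Hb Hb' ltac:(intros n Hn; lia) HQ) as (f & Hf1 & Hf2 & Hf3). exists f. split; auto. split; auto. }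
  assert (Huniq : forall g g' f f', eq_C0 g g' -> sol g f -> sol g' f' -> eq_C0 f f').
  { intros g g' f f' E (Hf & Ef) (Hf' & Ef') s Hs.
    assert (H := eigen_injective lambda (fun s => f s - f' s)%C).
    assert (H1 : Hinf_plus (fun s => f s - f' s)%C) by (apply approx_Hinf; now apply approx_minus).
    specialize (H H1 Hdiag). transitivity (f s - f' s + f' s)%C. ring.
    assert (Hz : (f s - f' s)%C = RtoC 0); [|rewrite Hz; ring].
    apply (H ltac:(intros z Hz; assert (A := Ef z Hz); assert (B := Ef' z Hz); assert (D := E z Hz);
      unfold shifted, composition_operator in A, B;
      transitivity ((f (phi z) - lambda * f z) - (f' (phi z) - lambda * f' z))%C; [ring|rewrite A, B, D; ring]) s Hs). }
  (* The choice may differ for data that agree only on C_0; [Huniq] shows that the results still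
     agree there. *)
  set (S := fun g => epsilon (inhabits (fun _ : C => RtoC 0)) (sol g)).
  assert (HS : forall g, Hinf_plus g -> sol g (S g)).
  { intros g Hg. unfold S. apply epsilon_spec. destruct (Hex 1 Rlt_0_1) as (delta & K & Hd & HK & H).
    destruct Hg as (Hg1 & Hg2 & Hg3). destruct (Hg2 delta Hd) as (M & HM).
    destruct (H g M (conj Hg1 (conj Hg2 Hg3)) HM) as (f & Hf & _). now exists f. }
  exists S. split; [split; [split; [|split; [|split]]|]|].
  - intros f Hf. apply approx_Hinf, HS, Hf.
  - intros f g Hf Hg E. apply (Huniq f g); auto.
  - intros f g Hf Hg.
    assert (Hfg : Hinf_plus (fun s => f s + g s)%C) by (apply approx_Hinf, approx_plus; now apply Hinf_approx).
    apply (Huniq (fun s => f s + g s)%C (fun s => f s + g s)%C); auto. intros s _; reflexivity.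
    destruct (HS f Hf) as [A1 A2], (HS g Hg) as [B1 B2]. split. now apply approx_plus.
    intros s Hs. rewrite <- (A2 s Hs), <- (B2 s Hs). unfold shifted, composition_operator. ring.
  - intros a f Hf. assert (Haf : Hinf_plus (fun s => a * f s)%C) by (apply approx_Hinf, approx_scal; now apply Hinf_approx).
    apply (Huniq (fun s => a * f s)%C (fun s => a * f s)%C); auto. intros s _; reflexivity.
    destruct (HS f Hf) as [A1 A2]. split. now apply approx_scal.
    intros s Hs. rewrite <- (A2 s Hs). unfold shifted, composition_operator. ring.
  - intros f Hf eps eta He Heta. destruct (Hex eps He) as (delta & K & Hd & HK & H).
    exists delta, (eta / (2 * (K + 1))). split; auto. split. pos.
    intros g Hg HP. set (rho := eta / (2 * (K + 1))) in *.
    destruct (Hinf_minus_bounded f g delta Hf Hg Hd) as (M & HM).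
    destruct (Psemi_lub delta (fun s => g s - f s)%C M HM) as [Hb _]. cbv beta in Hb.
    assert (Hgf : Hinf_plus (fun s => g s - f s)%C) by (apply approx_Hinf, approx_minus; now apply Hinf_approx).
    destruct (H (fun s => g s - f s)%C rho Hgf) as (u & Hu & Hub).
    { intros s Hs. specialize (Hb s Hs). lra. }
    assert (Hrho : 0 < rho) by pos.
    apply Rle_lt_trans with (K * rho).
    + apply (Psemi_lub eps _ (K * rho)). intros s Hs.
      rewrite <- (Huniq (fun s => g s - f s)%C (fun s => g s - f s)%C u (fun s => S g s - S f s)%C); auto.
      intros z _; reflexivity.
      destruct (HS f Hf) as [A1 A2], (HS g Hg) as [B1 B2]. split. now apply approx_minus.
      intros z Hz. rewrite <- (A2 z Hz), <- (B2 z Hz). unfold shifted, composition_operator. ring.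
      apply (half_plane_le 0 eps); auto; lra.
    + apply Rlt_le_trans with ((2 * (K + 1)) * rho). apply Rmult_lt_compat_r; lra. unfold rho. right; field; lra.
  - intros f Hf. split.
    + apply (Huniq (shifted lambda f) (shifted lambda f)). intros z _; reflexivity.
      apply HS. now apply shifted_Hinf. split. now apply Hinf_approx. intros z _; reflexivity.
    + apply HS, Hf.
Qed.

(** By minimality of m a preimage of m^(-s) would start at order m, where the factor diag - lambda
    is 0; but the coefficient to be produced is 1. *)
Lemma shifted_not_invertible lambda m : (1 <= m)%nat -> diag c0 c m = lambda ->
  (forall j, (1 <= j < m)%nat -> diag c0 c j <> lambda) -> ~ invertible_operator (shifted lambda).
Proof.
  intros Hm Hdm Hd (_ & S & ((HS & _) & _) & Hinv).
  assert (He := Hinf_monomial m Hm). set (e := fun s => nat_Cpow m (- s)) in *.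
  destruct (Hinv e He) as [_ Hinv'].
  destruct (Hinf_coefs (S e) (HS e He)) as (a & Ha & _).
  assert (Hec := cv_C0_nat_Cpow m Hm). fold e in Hec.
  assert (Hv : vanish m (fun j => if (j =? m)%nat then RtoC 1 else RtoC 0)).
  { intros n Hn. destruct (Nat.eqb_spec n m); auto; lia. }
  assert (Hva := vanish_from_diag lambda a (S e) _ e m Ha Hec Hinv' Hd Hv).
  destruct (eigen_leading lambda a (S e) _ e m Ha Hec Hinv' Hm Hva) as [_ H].
  rewrite Nat.eqb_refl, Hdm in H. apply C1_nz. rewrite H. ring.
Qed.

Lemma pow_bounded_le_1 x B : (forall k, x ^ k <= B) -> x <= 1.
Proof.
  intros H. apply Rnot_lt_le. intros Hx.
  destruct (Pow_x_infinity x ltac:(rewrite Rabs_pos_eq; lra) (B + 1)) as (N & HN).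
  specialize (HN N (le_n _)). specialize (H N). rewrite Rabs_pos_eq in HN by (pos). lra.
Qed.

Lemma shifted_0_not_invertible : c0 = 1%nat -> ~ invertible_operator (shifted 0).
Proof.
  intros E1 (_ & S & ((HS & HSext & HSadd & HSscal) & HScont) & Hinv).
  assert (He1 := Hinf_monomial 2 ltac:(lia)). set (e := fun s => nat_Cpow 2 (- s)) in *.
  set (u := S e). assert (Hu : Hinf_plus u) by now apply HS.
  assert (Hue : forall s, half_plane 0 s -> u (phi s) = e s).
  { intros s Hs. destruct (Hinv e He1) as [_ H]. specialize (H s Hs). rewrite <- H. unfold shifted, composition_operator, u. ring. }
  (* S is multiplicative, so u^k = S(2^(-ks)), and these are bounded uniformly in k. *)
  assert (Hpow : forall k, eq_C0 (S (fun s => e s ^ k)%C) (fun s => u s ^ k)%C).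
  { intros k.
    assert (Huk : Hinf_plus (fun s => u s ^ k)%C) by (apply approx_Hinf, approx_pow; now apply Hinf_approx).
    assert (Hek : Hinf_plus (fun s => e s ^ k)%C) by (apply approx_Hinf, approx_pow; now apply Hinf_approx).
    intros s Hs. destruct (Hinv _ Huk) as [H _]. rewrite <- (H s Hs).
    apply HSext; auto. now apply shifted_Hinf.
    intros z Hz. unfold shifted, composition_operator. rewrite Hue by auto. ring. }
  assert (Hu1 : forall s, half_plane 0 s -> Cmod (u s) <= 1).
  { intros s Hs. set (eps := Re s / 2). assert (Heps : 0 < eps) by pos.
    set (z0 := fun _ : C => RtoC 0). assert (Hz0 : Hinf_plus z0) by (apply approx_Hinf, approx_const).
    destruct (HScont z0 Hz0 eps 1 Heps Rlt_0_1) as (delta & rho & Hd & Hrho & H).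
    assert (Hz : forall s, half_plane 0 s -> S z0 s = RtoC 0).
    { intros z Hz. assert (Hs0 := HSscal 0 z0 Hz0 z Hz). cbv beta in Hs0.
      rewrite (HSext z0 (fun s => 0 * z0 s)%C); auto. rewrite Hs0. ring.
      apply approx_Hinf, approx_scal; now apply Hinf_approx. intros y _. unfold z0. ring. }
    (* Continuity of S at 0 is tested on (rho/2) e^k, of seminorm at most rho/2 < rho; its image is
       then below 1 on C_eps, for the same rho and every k. *)
    apply (pow_bounded_le_1 _ (2 / rho)). intros k.
    assert (Hek : Hinf_plus (fun s => e s ^ k)%C) by (apply approx_Hinf, approx_pow; now apply Hinf_approx).
    set (g := fun s => (RtoC (rho / 2) * e s ^ k)%C).
    assert (Hg : Hinf_plus g) by (apply approx_Hinf, approx_scal; now apply Hinf_approx).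
    assert (HP : Psemi delta (fun s => g s - z0 s)%C < rho).
    { apply Rle_lt_trans with (rho / 2); [|lra]. apply (Psemi_lub delta _ (rho / 2)).
      intros z Hzd. unfold z0, g. replace (RtoC (rho / 2) * e z ^ k - 0)%C with (RtoC (rho / 2) * e z ^ k)%C by ring.
      rewrite Cmod_mult, Cmod_pow, Cmod_RtoC_nonneg by lra. rewrite <- (Rmult_1_r (rho / 2)) at 2.
      apply Rmult_le_compat_l. lra. rewrite <- (pow1 k). apply pow_incr. split. apply Cmod_ge_0.
      unfold e. rewrite Cmod_nat_Cpow, <- exp_0. apply exp_le. change (Re (- z)) with (- Re z).
      assert (H1 := ln_INR_nonneg 2 ltac:(lia)). unfold half_plane in Hzd. nra. }
    specialize (H g Hg HP).
    destruct (Hinf_minus_bounded (S z0) (S g) eps (HS _ Hz0) (HS _ Hg) Heps) as (M & HM).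
    destruct (Psemi_lub eps _ M HM) as [Hb _]. cbv beta in Hb.
    assert (Hse : half_plane eps s) by (unfold half_plane, eps in *; lra).
    specialize (Hb s Hse).
    rewrite Hz in Hb by auto. unfold g in Hb. rewrite (HSscal (RtoC (rho / 2)) _ Hek s Hs), (Hpow k s Hs) in Hb.
    replace (RtoC (rho / 2) * u s ^ k - 0)%C with (RtoC (rho / 2) * u s ^ k)%C in Hb by ring.
    rewrite Cmod_mult, Cmod_pow, Cmod_RtoC_nonneg in Hb by lra.
    apply Rmult_le_reg_l with (rho / 2). lra. replace (rho / 2 * (2 / rho)) with 1 by (field; lra).
    eapply Rle_trans; [exact Hb|]. left. exact H. }
  destruct (Hinf_coefs u Hu) as (a & Ha & Ha').
  assert (Hc1 := c1_Re_pos).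
  assert (Hec := cv_C0_nat_Cpow 2 ltac:(lia)). fold e in Hec.
  assert (Hinv' : forall s, half_plane 0 s -> (u (phi s) - 0 * u s)%C = e s) by (intros s Hs; rewrite Hue by auto; ring).
  assert (Hdiag : forall j, diag c0 c j = nat_Cpow j (- c 1%nat)) by (intros j; unfold diag; now rewrite E1).
  assert (Hva : vanish 2 a).
  { apply (vanish_from_diag 0 a u _ e 2 Ha Hec Hinv').
    intros j Hj. rewrite Hdiag. apply nat_Cpow_neq_0. intros n Hn. destruct (Nat.eqb_spec n 2); auto; lia. }
  destruct (eigen_leading 0 a u _ e 2 Ha Hec Hinv' ltac:(lia) Hva) as [_ H].
  simpl (if (2 =? 2)%nat then _ else _) in H. rewrite Hdiag in H.
  assert (Hln : 0 < ln (INR 2)). { rewrite <- ln_1. apply ln_increasing; simpl; lra. }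
  set (r := Re (c 1%nat)) in *.
  assert (Hmod : Cmod (a 2%nat) = exp (r * ln (INR 2))).
  { assert (H1 : Cmod (nat_Cpow 2 (- c 1%nat)) * Cmod (a 2%nat) = 1).
    { rewrite <- Cmod_mult, <- Cmod_1. f_equal. rewrite H. ring. }
    rewrite Cmod_nat_Cpow in H1. change (Re (- c 1%nat)) with (- r) in H1.
    replace (- r * ln (INR 2)) with (- (r * ln (INR 2))) in H1 by ring. rewrite exp_Ropp in H1.
    assert (H2 := exp_pos (r * ln (INR 2))). set (x := exp (r * ln (INR 2))) in *.
    transitivity (x * (/ x * Cmod (a 2%nat))). field; lra. rewrite H1; ring. }
  (* Any abscissa in (0, r) yields the contradiction; r/2 gives 2^r <= 2^(r/2). *)
  assert (Hcb := cv_C0_coef_bound a u 1 0 Ha' ltac:(lra) Hu1 2 (r / 2) ltac:(lia) ltac:(lra)).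
  rewrite Hmod, Rmult_1_l in Hcb. assert (exp (r / 2 * ln (INR 2)) < exp (r * ln (INR 2))) by (apply exp_increasing; nra). lra.
Qed.

(** The moduli m^(-Re c_1) are strictly decreasing because Re c_1 > 0; thus every m is the least
    index of its diagonal value. *)
Lemma diag_distinct : c0 = 1%nat -> forall i j, (1 <= i < j)%nat -> diag c0 c i <> diag c0 c j.
Proof.
  intros E i j Hij H. unfold diag in H. rewrite E in H. simpl in H.
  assert (Hc1 := c1_Re_pos). assert (H1 : Cmod (nat_Cpow i (- c 1%nat)) = Cmod (nat_Cpow j (- c 1%nat))) by now rewrite H.
  rewrite !Cmod_nat_Cpow in H1. apply exp_inv in H1. change (Re (- c 1%nat)) with (- Re (c 1%nat)) in H1.
  assert (ln (INR i) < ln (INR j)) by (apply ln_increasing; [apply lt_0_INR|apply lt_INR]; lia). nra.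
Qed.

End Symbol.

(** * Affine symbols and the spectrum *)

Lemma affine_cderiv a b f s : half_plane 0 s -> (forall z, half_plane 0 z -> f z = (a * z + b)%C) -> cderiv f s a.
Proof.
  intros Hs H eta He. exists (Re s). split. exact Hs. intros h Hh.
  rewrite !H; auto. replace (a * (s + h) + b - (a * s + b) - a * h)%C with (RtoC 0) by ring.
  rewrite Cmod_0. pos.
  unfold half_plane. change (Re (s + h)) with (Re s + Re h). assert (H1 := Re_ge_Cmod h). lra.
Qed.

(** The inverse is the affine map s -> (s - i tau)/c0. This settles the constant alternative for
    psi, so that psi may be taken to map C_0 into itself. *)
Lemma affine_automorphism c0 tau phi : (1 <= c0)%nat ->
  (forall s, half_plane 0 s -> (phi s - RtoC (INR c0) * s)%C = (Ci * RtoC tau)%C) -> automorphism_C0 phi.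
Proof.
  intros Hc0 H. set (n := INR c0). assert (Hn : 1 <= n) by (apply (le_INR 1); lia).
  assert (Hn0 : RtoC n <> RtoC 0) by (intros E; apply RtoC_inj in E; lra).
  assert (E : forall s, half_plane 0 s -> phi s = (RtoC n * s + Ci * RtoC tau)%C).
  { intros s Hs. rewrite <- (H s Hs). fold n. ring. }
  assert (Hmap : maps_C0 phi).
  { intros s Hs. rewrite E by auto. unfold half_plane, Re, RtoC, Ci in *. simpl. nra. }
  assert (Hg : maps_C0 (fun s => RtoC (/ n) * s + - (RtoC (/ n) * (Ci * RtoC tau)))%C).
  { intros s Hs. unfold half_plane, Re, RtoC, Ci in *. simpl.
    assert (0 < / n) by pos. nra. }
  split; [|split; auto].
  - intros s Hs. eexists. apply cderiv_is_derive. now apply (affine_cderiv (RtoC n) (Ci * RtoC tau)%C).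
  - exists (fun s => RtoC (/ n) * s + - (RtoC (/ n) * (Ci * RtoC tau)))%C. split; [|split; auto].
    + intros s Hs. eexists. apply cderiv_is_derive. now apply (affine_cderiv (RtoC (/ n)) (- (RtoC (/ n) * (Ci * RtoC tau)))%C).
    + intros s Hs. rewrite E by auto. rewrite E by (apply Hg; auto). rewrite RtoC_inv by lra. split; field; auto.
Qed.

Theorem theorem3p7 (c0 : nat) (c : nat -> C) (phi : C -> C)
    (Hphi : G_pos c0 c phi) (Hnaut : ~ automorphism_C0 phi) :
  ((2 <= c0)%nat ->
     forall lambda : C,
       spectrum (composition_operator phi) lambda <->
       (lambda = RtoC 0 \/ lambda = RtoC 1)) /\
  (c0 = 1%nat ->
     forall lambda : C,
       spectrum (composition_operator phi) lambda <->
       (lambda = RtoC 0 \/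
        exists m : nat, (1 <= m)%nat /\ lambda = nat_Cpow m (Copp (c 1%nat)))).
Proof.
  destruct Hphi as (Hc0 & Hcvu & [(tau & Htau)|Hmap]).
  { exfalso. apply Hnaut. now apply (affine_automorphism c0 tau). }
  split.
  - intros H2 lambda. assert (Hd1 : diag c0 c 1 = RtoC 1) by (unfold diag; destruct (Nat.eqb_spec c0 1); [lia|reflexivity]).
    assert (Hd2 : forall m, (2 <= m)%nat -> diag c0 c m = RtoC 0).
    { intros m Hm. unfold diag. destruct (Nat.eqb_spec c0 1); [lia|]. destruct (Nat.eqb_spec m 1); [lia|reflexivity]. }
    split.
    + intros Hs. apply NNPP. intros Hn. apply Hs. apply (shifted_invertible c0 c phi Hc0 Hcvu Hmap).
      tauto. intros j Hj E. destruct (Nat.eq_dec j 1) as [->|Hj1].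
      rewrite Hd1 in E. apply Hn; auto. rewrite Hd2 in E by lia. apply Hn; auto.
    + intros [-> | ->].
      (* For c0 >= 2 the value 0 is itself a diagonal entry, first met at m = 2. *)
      * apply (shifted_not_invertible c0 c phi Hc0 Hcvu Hmap 0 2). lia. apply Hd2; lia.
        intros j Hj. replace j with 1%nat by lia. rewrite Hd1. apply C1_nz.
      * apply (shifted_not_invertible c0 c phi Hc0 Hcvu Hmap 1 1); auto. intros; lia.
  - intros E lambda. assert (Hd : forall m, diag c0 c m = nat_Cpow m (- c 1%nat)) by (intros; unfold diag; now rewrite E).
    split.
    + intros Hs. apply NNPP. intros Hn. apply Hs. apply (shifted_invertible c0 c phi Hc0 Hcvu Hmap).
      tauto. intros j Hj Ej. apply Hn. right. exists j. split; auto. now rewrite <- Hd.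
    + intros [->|(m & Hm & ->)].
      * now apply (shifted_0_not_invertible c0 c phi Hc0 Hcvu Hmap).
      * apply (shifted_not_invertible c0 c phi Hc0 Hcvu Hmap _ m Hm); auto.
        intros j Hj. rewrite <- Hd. now apply (diag_distinct c0 c phi Hc0 Hcvu Hmap E).
Qed.
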